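(* Let $n\ge2$, $1<\rho<n$, $\widetilde\rho=\frac{\rho n}{\rho n+\rho-n}$, and let $\Omega\in L^\rho(\mathbb S^{n-1})$ with $\int_{\mathbb S^{n-1}}\Omega\,d\sigma=0$. Let $\widetilde\rho\le s<n$, let $$s<p<n,\qquad \frac1p-\frac1q=\frac1n,$$ and let $w$ be a weight with $w^s\in A_{p/s,\,q/s}$. Then, for every $f\in C_c^\infty(\mathbb R^n)$, $$\|T^\ast_\Omega f\|_{L^q(w^q)}\le C\,\|\Omega\|_{L^\rho(\mathbb S^{n-1})}\,\|\nabla f\|_{L^p(w^p)},$$ with $C=C\bigl(n,p,q,\rho,s,[w^s]_{A_{p/s,q/s}}\bigr)$.
   Context: For $f\in C_c^\infty(\mathbb R^n)$, $$T^\ast_\Omega f(x)=\sup_{\varepsilon>0}\Bigl|\int_{|y|>\varepsilon}\frac{\Omega(y/|y|)}{|y|^n}f(x-y)\,dy\Bigr|.$$ A weight is a nonnegative locally integrable function on $\mathbb R^n$. For a weight $u$ and $0<r<\infty$, $\|h\|_{L^r(u)}=(\int_{\mathbb R^n}|h|^r u\,dx)^{1/r}$. For $1<P\le R<\infty$, $w\in A_{P,R}$ means $$[w]_{A_{P,R}}:=\sup_Q\Bigl(\frac1{|Q|}\int_Q w^R\Bigr)^{1/R}\Bigl(\frac1{|Q|}\int_Q w^{-P'}\Bigr)^{1/P'}<\infty,$$ the supremum being over all cubes $Q$ with sides parallel to the axes, and $P'=P/(P-1)$. *)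

(* Defs.v *)
From HB Require Import structures.
From mathcomp Require Import all_boot all_order all_algebra.
From mathcomp Require Import all_classical all_reals all_analysis.
From mathcomp Require Import measurable_realfun.

Set Implicit Arguments.
Unset Strict Implicit.
Unset Printing Implicit Defensive.
Import Order.TTheory GRing.Theory Num.Theory.
Import numFieldNormedType.Exports.

Local Open Scope classical_set_scope.
Local Open Scope ring_scope.

(* 'rV[R]_n is the normed space R^n (its library norm is the sup norm); it gets
   the sigma-algebra generated by the coordinates, i.e. the Borel sets. *)
Section measurable_rV.
Context (R : realType) (n : nat).

Definition rV_coord (i : 'I_n) (x : 'rV[R]_n) : R := x ord0 i.

HB.instance Definition _ := @isMeasurable.Build default_measure_display
  'rV[R]_n (g_sigma_preimage rV_coord)
  (@sigma_algebra0 _ _ _) (@sigma_algebraC _ _) (@sigma_algebra_bigcup _ _ _).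

Lemma measurable_rV_coord (i : 'I_n) :
  measurable_fun [set: 'rV[R]_n] (fun x : 'rV[R]_n => x ord0 i).
Proof.
move=> _ Y mY; rewrite setTI; apply: sub_sigma_algebra => /=.
rewrite -bigcup_seq/=; exists i => /=; first by rewrite mem_index_enum.
by exists Y => //; rewrite setTI.
Qed.

Lemma measurable_fun_rV d (T : measurableType d) (f : T -> 'rV[R]_n) :
  (forall i, measurable_fun [set: T] (fun t => f t ord0 i)) ->
  measurable_fun [set: T] f.
Proof.
move=> mf _ A mA.
suff : preimage_set_system [set: T] f (g_sigma_preimage rV_coord) `<=` measurable.
  by apply; exists A.
rewrite -g_sigma_preimageE; apply: smallest_sub.
  exact: sigma_algebra_measurable.
move=> _ [B + <-]; rewrite -bigcup_seq => -[i _ [C mC <-]].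
by rewrite !setTI -comp_preimage -[X in measurable X]setTI; exact: mf.
Qed.

End measurable_rV.

Section lebesgue_rV.
Context (R : realType).

Definition rV_cons n (z : R * 'rV[R]_n) : 'rV[R]_n.+1 :=
  row_mx (const_mx z.1 : 'rV_1) z.2.

Definition rV_uncons n (x : 'rV[R]_n.+1) : R * 'rV[R]_n :=
  (x ord0 ord0, rsubmx (x : 'rV_(1 + n))).

Lemma rV_cons0 n (z : R * 'rV[R]_n) : rV_cons z ord0 ord0 = z.1.
Proof.
by rewrite /rV_cons mxE; case: splitP => j // _; rewrite mxE.
Qed.

Lemma rV_consS n (z : R * 'rV[R]_n) (i : 'I_n) :
  rV_cons z ord0 (lift ord0 i) = z.2 ord0 i.
Proof.
rewrite /rV_cons mxE; case: splitP => j /=; first by rewrite ord1.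
by move=> /eqP; rewrite eqSS => /eqP/val_inj ->.
Qed.

Lemma rV_consK n : cancel (@rV_cons n) (@rV_uncons n).
Proof.
by case=> t x; rewrite /rV_uncons rV_cons0/=; congr pair; exact: row_mxKr.
Qed.

Lemma measurable_rV_cons n : measurable_fun setT (@rV_cons n).
Proof.
apply: measurable_fun_rV => i; case: (unliftP ord0 i) => [j|] ->.
  under eq_fun do rewrite rV_consS.
  exact: (measurableT_comp (measurable_rV_coord j) measurable_snd).
under eq_fun do rewrite rV_cons0.
exact: measurable_fst.
Qed.

Lemma measurable_rV_uncons n : measurable_fun setT (@rV_uncons n).
Proof.
apply: measurable_fun_pair; first exact: measurable_rV_coord.
apply: measurable_fun_rV => i.
under eq_fun do rewrite mxE.
exact: measurable_rV_coord.
Qed.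

Section step.
Context n (m : {sigma_finite_measure set 'rV[R]_n -> \bar R}).

Definition lebesgue_rV_step : set 'rV[R]_n.+1 -> \bar R :=
  pushforward (@lebesgue_measure R \x m)%E (@rV_cons n).

Let mcons := @measurable_rV_cons n.

Let step0 : lebesgue_rV_step set0 = 0%E.
Proof. by rewrite /lebesgue_rV_step /pushforward preimage_set0 measure0. Qed.

Let step_ge0 A : (0 <= lebesgue_rV_step A)%E.
Proof. exact: measure_ge0. Qed.

Let step_sigma_additive : semi_sigma_additive lebesgue_rV_step.
Proof. exact: measure_semi_sigma_additive. Qed.

HB.instance Definition _ := isMeasure.Build _ _ _ lebesgue_rV_step
  step0 step_ge0 step_sigma_additive.

Let step_sigma_finite : sigma_finite [set: 'rV[R]_n.+1] lebesgue_rV_step.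
Proof.
have /sigma_finiteP[F [TF ndF Foo]] := sigma_finiteT (@lebesgue_measure R).
have /sigma_finiteP[G [TG ndG Goo]] := sigma_finiteT m.
exists (fun k => @rV_uncons n @^-1` (F k `*` G k)).
  apply/esym/seteqP; split => // x _.
  have [k _ Fk] : (\bigcup_k F k) (rV_uncons x).1 by rewrite -TF.
  have [l _ Gl] : (\bigcup_k G k) (rV_uncons x).2 by rewrite -TG.
  exists (maxn k l) => //; split.
    by move: Fk; exact/subsetPset/ndF/leq_maxl.
  by move: Gl; exact/subsetPset/ndG/leq_maxr.
move=> k; have [mF Fk] := Foo k; have [mG Gk] := Goo k; split.
  rewrite -[X in measurable X]setTI; apply: measurable_rV_uncons => //.
  exact: measurableX.
rewrite /lebesgue_rV_step /pushforward -comp_preimage.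
rewrite (_ : _ \o _ = id); last by apply/funext => z; exact: rV_consK.
rewrite preimage_id product_measure1E// lte_mul_pinfty// ge0_fin_numE//.
Qed.

HB.instance Definition _ := Measure_isSigmaFinite.Build _ _ _ lebesgue_rV_step
  step_sigma_finite.

End step.

Fixpoint lebesgue_rV n : {sigma_finite_measure set 'rV[R]_n -> \bar R} :=
  if n is n'.+1 then lebesgue_rV_step (lebesgue_rV n')
  else \d_(0 : 'rV[R]_0).

Lemma lebesgue_rV_box n (A : 'I_n -> set R) :
  (forall i, measurable (A i)) ->
  lebesgue_rV n [set x | forall i, A i (x ord0 i)] =
  (\prod_(i < n) lebesgue_measure (A i))%E.
Proof.
elim: n => [|n IHn] in A * => mA.
  rewrite big_ord0 /= diracE mem_set//=; by case.
have mB : measurable [set x : 'rV[R]_n | forall i, A (lift ord0 i) (x ord0 i)].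
  rewrite (_ : mkset _ = \bigcap_i (if insub i is Some j then
     (fun x : 'rV[R]_n => x ord0 j) @^-1` (A (lift ord0 j)) else setT)).
    apply: bigcapT_measurable => i; case: insubP => //= j _ _.
    by rewrite -[X in measurable X]setTI; apply: measurable_rV_coord.
  apply/seteqP; split => x /= Ax.
    by move=> i _; case: insubP => //= j _ _; exact: Ax.
  by move=> i; have := Ax i I; rewrite valK.
rewrite big_ord_recl -IHn// -product_measure1E//=; last exact: mA.
rewrite /lebesgue_rV_step /pushforward.
congr (_ _); apply/seteqP; split => -[t x] /=.
  move=> H; split => [|i]; first by have := H ord0; rewrite rV_cons0.
  by have := H (lift ord0 i); rewrite rV_consS.
move=> [At Ax] i; case: (unliftP ord0 i) => [j|] ->.
  by rewrite rV_consS.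
by rewrite rV_cons0.
Qed.

End lebesgue_rV.
Arguments lebesgue_rV {R} n.

Section euclidean.
Context (R : realType) (n : nat).

Definition enorm (x : 'rV[R]_n) : R := Num.sqrt (\sum_(i < n) x ord0 i ^+ 2).

Lemma enorm_ge0 x : 0 <= enorm x.
Proof. exact: sqrtr_ge0. Qed.

Lemma enormZ (c : R) x : 0 <= c -> enorm (c *: x) = c * enorm x.
Proof.
move=> c0; rewrite /enorm; under eq_bigr do rewrite mxE exprMn.
by rewrite -mulr_sumr sqrtrM ?sqr_ge0// sqrtr_sqr ger0_norm.
Qed.

Lemma measurable_enorm : measurable_fun [set: 'rV[R]_n] enorm.
Proof.
apply: (measurableT_comp (continuous_measurable_fun (@sqrt_continuous R))).
apply: measurable_sum => i; apply: measurable_funX.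
exact: measurable_rV_coord.
Qed.

Definition direction (x : 'rV[R]_n) : 'rV[R]_n := (enorm x)^-1 *: x.

Lemma enorm_direction x : 0 < enorm x -> enorm (direction x) = 1.
Proof.
move=> x0; rewrite /direction enormZ ?invr_ge0 ?(ltW x0)//.
by rewrite mulVf// gt_eqF.
Qed.

Lemma measurable_direction : measurable_fun [set: 'rV[R]_n] direction.
Proof.
apply: measurable_fun_rV => i; rewrite /direction.
under eq_fun do rewrite mxE -powR_inv1 ?enorm_ge0//.
apply: measurable_funM; last exact: measurable_rV_coord.
apply: (measurableT_comp (measurable_powR _)); exact: measurable_enorm.
Qed.

(* Surface measure: the measure sigma on the unit sphere with
   dx = r^(n-1) dr dsigma, i.e. sigma(A) = n |{x : 0 < |x| <= 1, x/|x| in A}|.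
   It is a measure on R^n carried by the sphere. *)
Definition sphere_measure (A : set 'rV[R]_n) : \bar R :=
  (n%:R%:E * lebesgue_rV n [set x | (0 < enorm x <= 1)%R /\ A (direction x)])%E.

Let punctured_ball := [set x | 0 < enorm x <= 1].

Let measurable_punctured_ball : measurable punctured_ball.
Proof.
rewrite (_ : punctured_ball = setT `&` enorm @^-1` `]0, 1]%classic).
  by apply: measurable_enorm => //; exact: measurable_itv.
by rewrite setTI; apply/seteqP; split => x /=; rewrite in_itv.
Qed.

Let measurable_cone A : measurable A ->
  measurable [set x | 0 < enorm x <= 1 /\ A (direction x)].
Proof.
move=> mA; apply: (@measurableI _ _ punctured_ball) => //.
by rewrite -[X in measurable X]setTI; exact: measurable_direction.
Qed.

Let sphere_measure0 : sphere_measure set0 = 0%E.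
Proof.
rewrite /sphere_measure (_ : mkset _ = set0) ?measure0 ?mule0//.
by apply/seteqP; split => x //= -[].
Qed.

Let sphere_measure_ge0 A : (0 <= sphere_measure A)%E.
Proof. by rewrite mule_ge0// lee_fin. Qed.

Let sphere_measure_sigma_additive : semi_sigma_additive sphere_measure.
Proof.
move=> F mF tF mUF.
have n0 : (0 <= n%:R :> R) by [].
pose m := mscale (NngNum n0) (mrestr (lebesgue_rV n) measurable_punctured_ball).
have mE A : m (direction @^-1` A) = sphere_measure A.
  by rewrite /sphere_measure -[mkset _]/(punctured_ball `&` _) setIC.
have mdir A : measurable A -> measurable (direction @^-1` A).
  by move=> mA; rewrite -[X in measurable X]setTI; exact: measurable_direction.
rewrite -mE preimage_bigcup (_ : (fun k => _) =
    (fun k => \sum_(0 <= i < k) m (direction @^-1` F i))%E); last first.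
  by apply/funext => k; apply: eq_bigr => i _; rewrite mE.
apply: measure_semi_sigma_additive.
- by move=> i; exact: mdir.
- apply/trivIsetP => i j _ _ ij; rewrite -preimage_setI.
  by move/trivIsetP : tF => ->//; rewrite preimage_set0.
- by rewrite -preimage_bigcup; exact: mdir.
Qed.

HB.instance Definition _ := isMeasure.Build _ _ _ sphere_measure
  sphere_measure0 sphere_measure_ge0 sphere_measure_sigma_additive.

Lemma sphere_measureC : sphere_measure [set x | enorm x != 1] = 0%E.
Proof.
rewrite /sphere_measure (_ : mkset _ = set0) ?measure0 ?mule0//.
apply/seteqP; split => x //= -[/andP[x0 _]].
by rewrite enorm_direction// eqxx.
Qed.

End euclidean.

Section analysis_on_rV.
Context (R : realType) (n : nat).
Implicit Types (f w : 'rV[R]_n -> R) (x y : 'rV[R]_n) (Q : set 'rV[R]_n).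

(* Measurability with respect to the completion of [mu]: for [mu = lebesgue_rV n]
   this is Lebesgue measurability. *)
Definition ae_measurable_fun d (T : measurableType d)
    (mu : {measure set T -> \bar R}) (g : T -> R) :=
  exists2 h : T -> R, measurable_fun [set: T] h & {ae mu, forall t, g t = h t}.

Definition mem_Lp d (T : measurableType d)
    (mu : {measure set T -> \bar R}) (r : R) (g : T -> R) :=
  ae_measurable_fun mu g /\ finite_norm mu r%:E g.

Definition basis_vector (i : 'I_n) : 'rV[R]_n := delta_mx ord0 i.

Definition iter_partial (s : seq 'I_n) f : 'rV[R]_n -> R :=
  foldr (fun i g => fun x => 'D_(basis_vector i) g x) f s.

Definition smooth f := forall s : seq 'I_n,
  continuous (iter_partial s f) /\
  forall i x, derivable (iter_partial s f) x (basis_vector i).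

Definition Cc_infty f := smooth f /\ compact (closure [set x | f x != 0]).

Definition gradient f x : 'rV[R]_n := \row_i 'D_(basis_vector i) f x.

Definition maximal_rough_singular_integral (Omega f : 'rV[R]_n -> R) x : \bar R :=
  ereal_sup [set
    `| \int[lebesgue_rV n]_(y in [set y | (eps < enorm y)%R])
         (Omega (direction y) / enorm y ^+ n * f (x - y))%:E |%E
    | eps in [set eps : R | 0 < eps]].

Definition weight w :=
  [/\ forall x, 0 <= w x,
      ae_measurable_fun (lebesgue_rV n) w &
      forall K, compact K -> (\int[lebesgue_rV n]_(x in K) (w x)%:E < +oo)%E].

Definition weighted_norm (r : R) (u : 'rV[R]_n -> R) (h : 'rV[R]_n -> \bar R) :
    \bar R :=
  ((\int[lebesgue_rV n]_x (`|h x| `^ r * (u x)%:E)) `^ r^-1)%E.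

Definition cube (a : 'rV[R]_n) (l : R) : set 'rV[R]_n :=
  [set x | forall i, a ord0 i <= x ord0 i <= a ord0 i + l].

Definition average Q (g : 'rV[R]_n -> \bar R) : \bar R :=
  ((lebesgue_rV n Q)^-1 * \int[lebesgue_rV n]_(x in Q) g x)%E.

(* [w x `^ (- P')] is the inverse in [\bar R] of [w x `^ P'], which is +oo where
   [w x = 0]; the real-valued [powR] would give 0 there. *)
Definition Apq_const (P Q : R) w : \bar R :=
  let P' := P / (P - 1) in
  ereal_sup [set
    ((average (cube al.1 al.2) (fun x => (w x `^ Q)%:E)) `^ Q^-1 *
     (average (cube al.1 al.2) (fun x => ((w x `^ P')%:E)^-1)) `^ P'^-1)%E
    | al in [set al : 'rV[R]_n * R | 0 < al.2]].

Definition Apq (P Q : R) w := (Apq_const P Q w < +oo)%E.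

End analysis_on_rV.

(* Main.v *)
From HB Require Import structures.
Require Import Defs.
From mathcomp Require Import all_boot all_order all_algebra.
From mathcomp Require Import all_classical all_reals all_analysis.
From mathcomp Require Import measurable_realfun.
From mathcomp Require Import ring lra.
Set Implicit Arguments.
Unset Strict Implicit.
Unset Printing Implicit Defensive.
Import Order.TTheory GRing.Theory Num.Theory.
Import numFieldNormedType.Exports.

Local Open Scope classical_set_scope.
Local Open Scope ring_scope.

(** The maximal operator is dominated pointwise by a sum over dyadic scales of
    averages of the gradient, and that sum is bounded with weights by an
    argument of Hedberg type.

    Pointwise domination. On an annulus of radius about [2^k] the kernel
    [Omega(y/|y|)/|y|^n] has integral zero ([kernel_cancellation]), so a
    constant may be subtracted from [f(x - y)]. Hoelder's inequality with
    exponents [rho] and [rho'] and the Sobolev-Poincare inequality for the pair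
    [(rho~, rho')], which is a Sobolev pair because
    [1/rho~ = 1/rho' + 1/n], then control the annulus by
    [||Omega||_rho * 2^k * (average of |grad f|^rho~)^(1/rho~)] over a cube of
    side about [2^k]; since [rho~ <= s] the exponent [rho~] may be raised to
    [s] ([annulus_bound]). Every truncated integral is a finite sum of such
    annuli ([truncated_bound]), so the same bound holds for the supremum
    ([maximal_pointwise]).

    Weighted bound. Let [F = |grad f|^s], [P = p/s], [Q = q/s], [m = w^q] and
    [tau = w^(-s P')]. Up to a constant the contribution of the scale [2^k] is
    [b_k^(1/s)], where [b_k = |L_k|^(1/P - 1/Q - 1) * (integral of F over L_k)]
    and [L_k] is a cube of side about [2^k] containing [x]. The [A_(P,Q)]
    condition compares the [m]- and [tau]-masses of cubes, and yields two
    bounds on [b_k]: one by a constant times [m(L_k)^(-1/Q)]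
    ([frac_avg_le_Phi]), from the global norm of [F], and one by
    [m(L_k)^(1/P - 1/Q)] times a power of a maximal function at [x]
    ([frac_avg_le_m_maximal]). The masses [m(L_k)] grow at least geometrically
    in [k] ([mass_reverse_doubling]), so the smaller of the two bounds is
    summable, with any positive exponent ([sum_min_le]), and the sum is a
    product of powers of the global norm and of the maximal function. The
    latter is bounded by the maximal theorem for doubling measures
    ([maxop_strong]), applied once with [tau] and once with [m]; this gives
    [fractional_bound].

    The Sobolev-Poincare inequality is itself obtained from [fractional_bound]
    with the weights [m = tau = 1] and exponent [1] in place of [1/s], because
    [f(z)] minus an average of [f] telescopes along concentric cubes into
    averages of the gradient ([chain_le]).

    What is left is measure theory: [Omega] and [w] are only almost everywhere
    equal to Borel functions, and finiteness of the [A_(P,Q)] constant forces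
    [w] to be zero almost everywhere or positive almost everywhere
    ([Apq_dichotomy]). *)

(** * Lebesgue measure on the space of row vectors *)

Section rV_measure.
Context (R : realType).

Lemma measurable_rV_box n (A : 'I_n -> set R) : (forall i, measurable (A i)) ->
  measurable [set x : 'rV[R]_n | forall i, A i (x ord0 i)].
Proof.
move=> mA; rewrite (_ : mkset _ = \bigcap_(i in [set: 'I_n])
   ((fun x : 'rV[R]_n => x ord0 i) @^-1` A i)).
  apply: fin_bigcap_measurable => // i _.
  by rewrite -[X in measurable X]setTI; apply: measurable_rV_coord.
by apply/seteqP; split => x /= H i *; apply: H.
Qed.

(** An open set is the union of the boxes it contains with rational centres and
    radii [1/(k+1)], and these are countably many. *)
Lemma open_measurable_rV n (U : set 'rV[R]_n) : open U -> measurable U.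
Proof.
move=> oU.
pose b (qk : 'rV[rat]_n * nat) : set 'rV[R]_n :=
  [set x | forall i, ball (ratr (qk.1 ord0 i) : R) (qk.2.+1%:R^-1) (x ord0 i)].
have -> : U = \bigcup_(qk in [set qk | b qk `<=` U]) b qk.
  apply/seteqP; split => [x Ux|x [qk /= bU bx]]; last exact: bU.
  have /nbhs_ballP [e /= e0 eU] : nbhs x U by exact: open_nbhs_nbhs.
  have [k ke] : exists k : nat, k.+1%:R^-1 < e / 2.
    have [k ke] := @ltr_add_invr R 0 (e / 2) (divr_gt0 e0 (ltr0n _ 2)).
    by exists k; rewrite add0r in ke.
  have H i : exists q : rat, ball (x ord0 i) (k.+1%:R^-1) (ratr q : R).
    have : x ord0 i - k.+1%:R^-1 < x ord0 i + k.+1%:R^-1.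
      by rewrite ltrBlDr -addrA ltrDl addr_gt0 ?invr_gt0.
    move=> /rat_in_itvoo[q]; rewrite in_itv/= => xq.
    by exists q; rewrite /ball/= distrC ltr_distl.
  have [q Hq] := choice H.
  exists (\row_i q i, k) => /=.
    move=> y by_; apply: eU; split => // i j; rewrite [i]ord1 /=.
    have := by_ j; rewrite /= mxE => yq.
    have := @ball_triangle _ _ _ _ _ _ _ (Hq j) yq; apply: le_ball.
    by rewrite (splitr e) lerD// ltW.
  by move=> i /=; rewrite mxE; apply: ball_sym; exact: Hq.
rewrite bigcup_mkcond; apply: countable_bigcupT_measurable => [|qk]; last case: ifP => _ //.
  exact: countableP.
apply: (@measurable_rV_box _ (fun i => ball (ratr (qk.1 ord0 i) : R) _)) => i.
by apply: open_measurable; exact: ball_open.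
Qed.

Lemma continuous_measurable_rV n (f : 'rV[R]_n -> R) :
  continuous f -> measurable_fun setT f.
Proof.
move=> /continuousP cf; apply: (measurability _ (RGenOpens.measurableE R)).
move=> _ [_ [a [b ->] <-]]; rewrite setTI; apply: open_measurable_rV.
exact/cf/interval_open.
Qed.

Local Notation leb := (@lebesgue_measure R).

Lemma ge0_integral_rV_cons n (f : 'rV[R]_n.+1 -> \bar R) :
  measurable_fun setT f -> (forall x, 0 <= f x)%E ->
  (\int[lebesgue_rV n.+1]_x f x =
   \int[leb]_t \int[lebesgue_rV n]_x f (rV_cons (t, x)))%E.
Proof.
move=> mf f0; rewrite /= /lebesgue_rV_step.
rewrite ge0_integral_pushforward//; last exact: measurable_rV_cons.
rewrite preimage_setT fubini_tonelli1//; last by move=> z; exact: f0.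
exact: (measurableT_comp mf (@measurable_rV_cons R n)).
Qed.

Lemma lebesgue_measure_affine (a b : R) A : a != 0 -> measurable A ->
  (`|a|%:E * leb ((fun t => b + a * t)%R @^-1` A) = leb A)%E.
Proof.
move=> a0 mA.
pose phi (t : measurableTypeR R) : measurableTypeR R := b + a * t.
have mphi : measurable_fun setT phi.
  by apply: measurable_funD => //; exact: measurable_funM.
pose m : {measure set (measurableTypeR R) -> \bar R} :=
  mscale (NngNum (normr_ge0 a)) (pushforward leb phi).
rewrite -[LHS]/(m mphi A); apply/esym/lebesgue_measure_unique => // _ [[c d]] _ <-.
rewrite -[RHS]/(`|a|%:E * leb (phi @^-1` `]c, d]%classic))%E.
have [a_gt0|a_le0] := ltP 0 a.
  rewrite (_ : _ @^-1` _ = `](c - b) / a, (d - b) / a]%classic); last first.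
    apply/seteqP; split => t /=; rewrite !in_itv/= ltr_pdivrMr// ler_pdivlMr//;
    by rewrite ltrBlDl lerBrDl (mulrC t).
  rewrite !lebesgue_measure_itv/= !lte_fin ltr_pM2r ?invr_gt0// ltrD2r.
  case: ifPn => _; last by rewrite mule0.
  rewrite -!EFinD -EFinM; congr EFin.
  by rewrite gtr0_norm//; field.
have {a_le0} a_lt0 : a < 0 by rewrite lt_neqAle a0.
rewrite (_ : _ @^-1` _ = `[(d - b) / a, (c - b) / a[%classic); last first.
  apply/seteqP; split => t /=; rewrite !in_itv/= ltr_ndivlMr// ler_ndivrMr//;
  by rewrite ltrBlDl lerBrDl (mulrC t) andbC.
rewrite !lebesgue_measure_itv/= !lte_fin ltr_nM2r ?invr_lt0// ltrD2r.
case: ifPn => _; last by rewrite mule0.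
rewrite -!EFinD -EFinM; congr EFin.
by rewrite ltr0_norm//; field.
Qed.

Lemma ge0_integral_affine (a b : R) (f : R -> \bar R) : a != 0 ->
  measurable_fun setT f -> (forall x, 0 <= f x)%E ->
  (\int[leb]_t f (b + a * t)%R = (`|a|^-1)%:E * \int[leb]_t f t)%E.
Proof.
move=> a0 mf f0.
pose phi (t : measurableTypeR R) : measurableTypeR R := b + a * t.
have mphi : measurable_fun setT phi.
  by apply: measurable_funD => //; exact: measurable_funM.
transitivity (\int[pushforward leb phi]_t f t)%E.
  by rewrite ge0_integral_pushforward.
rewrite (eq_measure_integral (mscale (NngNum (normr_ge0 a^-1)) leb)).
  by rewrite ge0_integral_mscale//= normfV.
move=> A mA _; transitivity (leb (phi @^-1` A)) => //.
transitivity (`|a^-1|%:E * leb A)%E => //.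
rewrite -(lebesgue_measure_affine b a0 mA) muleA -EFinM normfV.
by rewrite mulVf ?normr_eq0// mul1e.
Qed.

(** Both translations and dilations are needed, and the induction on the
    dimension treats them at once because [rV_cons] commutes with affine
    maps of the form [y |-> b + a *: y]. *)
Lemma ge0_integral_rV_affine n (a : R) (b : 'rV[R]_n) (f : 'rV[R]_n -> \bar R) :
  a != 0 -> measurable_fun setT f -> (forall x, 0 <= f x)%E ->
  (\int[lebesgue_rV n]_y f (b + a *: y)%R =
   ((`|a| ^+ n)^-1)%:E * \int[lebesgue_rV n]_y f y)%E.
Proof.
move=> a0; elim: n => [|n IHn] in b f *; move=> mf f0.
  rewrite expr0 invr1 mul1e; apply: eq_integral => y _; congr f.
  by apply/rowP => -[].
have mg : measurable_fun [set: 'rV[R]_n.+1] (fun y => b + a *: y)%R.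
  apply: measurable_fun_rV => i.
  under eq_fun do rewrite !mxE.
  by apply: measurable_funD => //; apply: measurable_funM => //; exact: measurable_rV_coord.
have mcons : measurable_fun setT (@rV_cons R n) := @measurable_rV_cons R n.
have mfc t : measurable_fun setT (fun x : 'rV[R]_n => f (rV_cons (t, x))).
  by apply: (measurableT_comp mf); apply: (measurableT_comp mcons);
    exact: measurable_pair1.
rewrite ge0_integral_rV_cons//; last exact: (measurableT_comp mf).
pose b0 := b ord0 ord0; pose b1 := (rV_uncons b).2.
have E t x : b + a *: rV_cons (t, x) = rV_cons (b0 + a * t, b1 + a *: x).
  apply/rowP => i.
    transitivity (b ord0 i + a * rV_cons (t, x) ord0 i).
      by rewrite mxE; congr (_ + _); rewrite mxE.
    case: (unliftP ord0 i) => [j|] ->.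
    rewrite !rV_consS/= !mxE; congr (b _ _ + _).
    by apply/val_inj.
  by rewrite !rV_cons0.
under eq_integral => t _.
  under eq_integral => x _ do rewrite E.
  rewrite (IHn b1 (fun x => f (rV_cons (b0 + a * t, x)))%R)//.
  over.
have mF : measurable_fun setT (fun t => \int[lebesgue_rV n]_x f (rV_cons (t, x)))%E.
  apply: (measurable_fun_fubini_tonelli_F (fun z => f (rV_cons z))) => //.
  exact: (measurableT_comp mf).
have F0 t : (0 <= \int[lebesgue_rV n]_x f (rV_cons (t, x)))%E.
  by apply: integral_ge0.
rewrite ge0_integralZl//; last first.
  apply: (measurableT_comp mF).
  by apply: measurable_funD => //; exact: measurable_funM.
rewrite (@ge0_integral_affine a b0 (fun t => \int[lebesgue_rV n]_x f (rV_cons (t, x)))%E)//.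
rewrite muleA -EFinM ge0_integral_rV_cons//; congr (_%:E * _)%E.
by rewrite exprS invfM mulrC.
Qed.

(** The closed ball of the sup norm. *)
Definition cball n (c : 'rV[R]_n) (r : R) : set 'rV[R]_n :=
  [set x | forall i, `|x ord0 i - c ord0 i| <= r].

Lemma measurable_cube n (a : 'rV[R]_n) l : measurable (cube a l).
Proof.
apply: (@measurable_rV_box _ (fun i => `[a ord0 i, a ord0 i + l]%classic)) => i.
exact: measurable_itv.
Qed.

Lemma lebesgue_cube n (a : 'rV[R]_n) l : 0 <= l ->
  lebesgue_rV n (cube a l) = (l ^+ n)%:E.
Proof.
move=> l0.
have -> : cube a l = [set x | forall i, `[a ord0 i, a ord0 i + l]%classic (x ord0 i)].
  by apply/seteqP; split => x /= H i; have := H i; rewrite in_itv.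
rewrite (lebesgue_rV_box (A := fun i => `[a ord0 i, a ord0 i + l]%classic))//.
under eq_bigr do rewrite lebesgue_measure_itv/= lte_fin ltrDl.
have [l_gt0|] := ltP 0 l.
  under eq_bigr do rewrite -EFinD addrAC subrr add0r.
  by rewrite prodEFin prodr_const card_ord.
move=> l_le0; have -> : l = 0 by apply/eqP; rewrite eq_le l0 l_le0.
by rewrite -[0%E]/(0%:E) prodEFin prodr_const card_ord.
Qed.

Lemma cballE n (c : 'rV[R]_n) r : cball c r = cube (c - const_mx r) (r *+ 2).
Proof.
apply/seteqP; split => x /= H i; have := H i;
  by rewrite !mxE ler_distl mulr2n addrA subrK.
Qed.

Lemma measurable_cball n (c : 'rV[R]_n) r : measurable (cball c r).
Proof. by rewrite cballE; exact: measurable_cube. Qed.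

Lemma lebesgue_cball n (c : 'rV[R]_n) r : 0 <= r ->
  lebesgue_rV n (cball c r) = ((r *+ 2) ^+ n)%:E.
Proof. by move=> r0; rewrite cballE lebesgue_cube// mulrn_wge0. Qed.

End rV_measure.

(** * The maximal theorem for doubling measures *)

Section indicator_integrals.
Context d (T : measurableType d) (R : realType) (mu : {measure set T -> \bar R}).

Lemma integral_in_indic (A : set T) (f : T -> R) :
  (\int[mu]_(x in A) (f x)%:E = \int[mu]_x (f x * \1_A x)%:E)%E.
Proof.
rewrite integral_mkcond; apply: eq_integral => x _.
by rewrite patchE indicE; case: ifPn => _; rewrite ?mulr1 ?mulr0.
Qed.

Lemma ge0_le_integralE (f g : T -> R) :
  (forall x, 0 <= f x) -> measurable_fun setT f -> measurable_fun setT g ->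
  (forall x, f x <= g x) ->
  (\int[mu]_x (f x)%:E <= \int[mu]_x (g x)%:E)%E.
Proof.
move=> f0 mf mg fg; apply: ge0_le_integral => //.
- by move=> x _; rewrite lee_fin.
- exact/measurable_EFinP.
- exact/measurable_EFinP.
- by move=> x _; rewrite lee_fin.
Qed.

Lemma ge0_integralZlE (k : R) (f : T -> R) : 0 <= k ->
  (forall x, 0 <= f x) -> measurable_fun setT f ->
  (\int[mu]_x (k * f x)%:E = k%:E * \int[mu]_x (f x)%:E)%E.
Proof.
move=> k0 f0 mf; under eq_integral do rewrite EFinM.
apply: ge0_integralZl => //; first exact/measurable_EFinP.
by move=> x _; rewrite lee_fin.
Qed.

Lemma ge0_integral_sumE (I : Type) (s : seq I) (f : I -> T -> R) :
  (forall i x, 0 <= f i x) -> (forall i, measurable_fun setT (f i)) ->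
  (\int[mu]_x (\sum_(i <- s) f i x)%:E = \sum_(i <- s) \int[mu]_x (f i x)%:E)%E.
Proof.
move=> f0 mf; under eq_integral do rewrite -sumEFin.
rewrite (@ge0_integral_sum _ _ _ mu setT measurableT I (fun i x => (f i x)%:E))//.
- by move=> i; exact/measurable_EFinP.
- by move=> i x _; rewrite lee_fin.
Qed.

Lemma measurable_superlevel (f : T -> R) (l : R) :
  measurable_fun setT f -> measurable [set x | l < f x].
Proof.
move=> mf; rewrite (_ : mkset _ = setT `&` f @^-1` `]l, +oo[%classic).
  by apply: mf.
by rewrite setTI; apply/seteqP; split => x /=; rewrite in_itv/= andbT.
Qed.

End indicator_integrals.

Section dyadic_levels.
Context (R : realType).

Lemma sum_geometric_le (q : R) (L : nat) (theta : nat -> R) :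
  1 < q -> (forall j, 0 <= theta j) ->
  (forall j, theta j.+1 = q * theta j) ->
  \sum_(j < L.+1) theta j <= q / (q - 1) * theta L.
Proof.
move=> q1 t0 tS; have q1' : 0 < q - 1 by rewrite subr_gt0.
elim: L => [|L IH].
  rewrite big_ord1 ler_peMl// ler_pdivlMr// mul1r; lra.
rewrite big_ord_recr/=; apply: le_trans (lerD IH (lexx _)) _.
rewrite tS; rewrite le_eqVlt; apply/orP; left; apply/eqP.
by field; rewrite gt_eqF.
Qed.

Lemma sum_dyadic_levels_le (e h z : R) (L : nat) : 0 < e -> 0 < h -> 0 <= z ->
  \sum_(j < L) (h * 2 ^+ j) `^ e * (h * 2 ^+ j < z)%R%:R <=
  2 `^ e / (2 `^ e - 1) * z `^ e.
Proof.
move=> e0 h0 z0.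
have q1 : 1 < 2 `^ e :> R.
  have : 1 `^ e < 2 `^ e :> R by apply: gt0_ltr_powR; rewrite ?nnegrE// ltr1n.
  by rewrite powR1.
have q1' : 0 < 2 `^ e - 1 by rewrite subr_gt0.
have K0 : 0 <= 2 `^ e / (2 `^ e - 1) by rewrite divr_ge0 ?powR_ge0// ltW.
elim: L => [|L IH].
  by rewrite big_ord0 mulr_ge0// powR_ge0.
have [lt_z|le_z] := ltP (h * 2 ^+ L) z; last first.
  by rewrite big_ord_recr/= ltNge le_z/= mulr0 addr0.
apply: (@le_trans _ _ (\sum_(j < L.+1) (h * 2 ^+ j) `^ e)).
  apply: ler_sum => j _; rewrite ler_piMr ?powR_ge0//.
  by case: (_ < _)%R.
apply: le_trans (@sum_geometric_le (2 `^ e) L (fun j => (h * 2 ^+ j) `^ e) q1 _ _) _ => //.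
- by move=> j; exact: powR_ge0.
- move=> j; rewrite -powRM//; last by rewrite mulr_ge0 ?exprn_ge0// ltW.
  by rewrite exprS mulrCA.
apply: ler_wpM2l => //; apply: ge0_ler_powR; rewrite ?nnegrE ?(ltW e0)//.
- by rewrite mulr_ge0 ?exprn_ge0// ltW.
- exact: ltW.
Qed.

Lemma powR_le_sum_dyadic_levels (r h z : R) (L : nat) : 0 < r -> 0 < h ->
  h < z -> z <= h * 2 ^+ L ->
  z `^ r <= \sum_(j < L) (2 * (h * 2 ^+ j)) `^ r * (h * 2 ^+ j < z)%R%:R.
Proof.
move=> r0 h0 hz; elim: L => [|L IH].
  by rewrite expr0 mulr1 leNgt hz.
move=> zL; rewrite big_ord_recr/=.
have [lt_z|le_z] := ltP (h * 2 ^+ L) z.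
  rewrite mulr1 -[leLHS]add0r lerD//.
    by apply: sumr_ge0 => j _; rewrite mulr_ge0 ?powR_ge0.
  apply: ge0_ler_powR; rewrite ?nnegrE ?(ltW r0)//.
  - by rewrite ltW// (lt_trans h0).
  - by rewrite !mulr_ge0 ?exprn_ge0// ltW.
  - by rewrite mulrCA -exprS.
by rewrite mulr0 addr0; exact: IH.
Qed.

End dyadic_levels.

(** Greedy selection in order of decreasing radius: a set is kept when it misses
    the sets kept so far; otherwise it meets one of at least its own radius and
    is engulfed by the enlargement of that set. *)
Lemma vitali_selection (R : realType) (T : Type) (I : eqType)
    (B Bs : I -> set T) (rad : I -> R) :
  (forall i, B i !=set0) ->
  (forall i j, rad i <= rad j -> B i `&` B j !=set0 -> B i `<=` Bs j) ->
  forall s : seq I, exists D : seq I,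
    [/\ uniq D, {subset D <= s}, trivIset [set` D] B &
     forall i, i \in s -> exists2 j, j \in D & B i `<=` Bs j].
Proof.
move=> B0 engulf s.
(* Sorted by increasing radius, so that the induction adds the smallest set last. *)
pose LE x y := rad x <= rad y.
have LE_trans : transitive LE by move=> x y z; exact: le_trans.
wlog : s / sorted LE s.
  have : sorted LE (sort LE s) by apply: sort_sorted => x y; exact: le_total.
  move=> /[swap] /[apply] -[D [uD Ds tD H]]; exists D; split => //.
    by move=> x /Ds; rewrite mem_sort.
  by move=> i; rewrite -(mem_sort LE) => /H.
elim: s => [_|i s IH].
  by exists [::]; split => //; rewrite set_nil; exact: trivIset_set0.
move=> /= srt; have [D [uD Ds tD H]] := IH (path_sorted srt).
have irad j : j \in s -> rad i <= rad j.
  by move=> js; have /allP := order_path_min LE_trans srt; apply.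
have [[k kD ik]|nk] := pselect (exists2 k, k \in D & B i `&` B k !=set0).
  exists D; split => //.
    by move=> x /Ds; rewrite inE orbC => ->.
  move=> j; rewrite inE => /predU1P[->|/H//]; exists k => //.
  by apply: engulf ik; apply: irad; exact: Ds.
have Bii : B i `<=` Bs i by apply: engulf; rewrite ?setIid.
exists (i :: D); split => /=.
- rewrite uD andbT; apply/negP => iD; apply: nk; exists i => //.
  by rewrite setIid.
- by move=> x; rewrite !inE => /predU1P[->|/Ds ->]; rewrite ?eqxx ?orbT.
- move=> k l /=; rewrite !inE => /predU1P[->|kD] /predU1P[->|lD] //.
  + by move=> kl; exfalso; apply: nk; exists l.
  + by rewrite setIC => kl; exfalso; apply: nk; exists k.
  + exact: tD.
- move=> j; rewrite inE => /predU1P[->|/H[k kD jk]].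
    by exists i => //; rewrite inE eqxx.
  by exists k => //; rewrite inE kD orbT.
Qed.

Section maximal.
Context d (T : measurableType d) (R : realType) (mu : {measure set T -> \bar R}).
Context (I : eqType) (B Bs : I -> set T) (rad : I -> R).
Context (m : T -> R) (D : R).
Hypothesis mB : forall i, measurable (B i).
Hypothesis mBs : forall i, measurable (Bs i).
Hypothesis B0 : forall i, B i !=set0.
Hypothesis engulf :
  forall i j, rad i <= rad j -> B i `&` B j !=set0 -> B i `<=` Bs j.
Hypothesis mm : measurable_fun setT m.
Hypothesis m0 : forall x, 0 <= m x.

Let w (A : set T) : \bar R := (\int[mu]_(x in A) (m x)%:E)%E.

Hypothesis wB : forall i, (0 < w (B i) < +oo)%E.
Hypothesis D0 : 0 <= D.
Hypothesis wBs : forall i, (w (Bs i) <= D%:E * w (B i))%E.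

Definition wavg (G : T -> R) (i : I) : R :=
  fine (\int[mu]_(x in B i) (G x * m x)%:E)%E / fine (w (B i)).

(** The maximal function of a finite family; for finitely many sets it is a
    maximum, hence measurable and attained. *)
Definition maxop (s : seq I) (G : T -> R) (x : T) : R :=
  \big[Num.max/0]_(i <- s) (wavg G i * \1_(B i) x).

Lemma maxop_ge0 s G x : 0 <= maxop s G x.
Proof.
rewrite /maxop; elim: s => [|i s IH]; first by rewrite big_nil.
by rewrite big_cons le_max IH orbT.
Qed.

Lemma measurable_maxop s G : measurable_fun setT (maxop s G).
Proof.
rewrite /maxop; elim: s => [|i s IH].
  by under eq_fun do rewrite big_nil; exact: measurable_cst.
under eq_fun do rewrite big_cons.
apply: measurable_maxr => //; exact: measurable_funM.
Qed.

Lemma wavg_le_maxop s G i x : i \in s -> B i x -> wavg G i <= maxop s G x.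
Proof.
move=> + Bx; rewrite /maxop; elim: s => [//|j s IH]; rewrite inE => /predU1P[<-|js].
  by rewrite big_cons le_max indicE mem_set// mulr1 lexx.
by rewrite big_cons le_max IH// orbT.
Qed.

Lemma maxop_gt s G l x : 0 <= l -> l < maxop s G x ->
  exists i, [/\ i \in s, B i x & l < wavg G i].
Proof.
move=> l0; rewrite /maxop; elim: s => [|j s IH].
  by rewrite big_nil ltNge l0.
rewrite big_cons lt_max => /orP[|/IH[i [si Bx li]]]; last first.
  by exists i; rewrite inE si orbT.
rewrite indicE; case: (boolP (x \in B j)) => [|_]; last first.
  by rewrite mulr0 ltNge l0.
by rewrite inE => Bx; rewrite mulr1 => lj; exists j; rewrite inE eqxx.
Qed.

Lemma maxop_le s G l x : 0 <= l -> (forall i, i \in s -> wavg G i <= l) ->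
  maxop s G x <= l.
Proof.
move=> l0 H; rewrite leNgt; apply/negP => /(maxop_gt l0)[i [si _]].
by rewrite ltNge H.
Qed.

(** Weak type bound. On a set of the family whose average exceeds [l], the part
    of [G] below [l/2] contributes at most half of the average, so only the
    values of [G] above [l/2] enter on the right; this truncation is what makes
    the levels summable in [maxop_strong]. *)
Lemma w_weak s (G : T -> R) (l : R) : 0 < l -> (forall x, 0 <= G x) -> measurable_fun setT G ->
  (forall i, \int[mu]_(x in B i) (G x * m x)%:E < +oo)%E ->
  ((l / 2)%:E * \int[mu]_x (m x * \1_[set x | (l < maxop s G x)%R] x)%:E <=
   D%:E * \int[mu]_x (G x * m x * \1_[set x | (l < 2 * G x)%R] x)%:E)%E.
Proof.
move=> l0 G0 mG foo.
have mind (A : set T) : measurable A -> measurable_fun setT (\1_A : T -> R).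
  by move=> mA; exact: measurable_indic.
have mS : measurable [set x | l < maxop s G x].
  by apply: measurable_superlevel; exact: measurable_maxop.
have mG2 : measurable [set x | l < 2 * G x].
  by apply: measurable_superlevel; exact: measurable_funM.
set G' := fun x => G x * m x * \1_[set x | (l < 2 * G x)%R] x.
have mG' : measurable_fun setT G'.
  by apply: measurable_funM; [exact: measurable_funM|exact: mind].
have G'0 x : 0 <= G' x by rewrite !mulr_ge0.
have [DD [uD Ds tD cD]] := vitali_selection B0 engulf [seq i <- s | l < wavg G i].
have good i : i \in DD -> ((l / 2)%:E * w (B i) <= \int[mu]_(x in B i) (G' x)%:E)%E.
  move=> /Ds; rewrite mem_filter => /andP[li _].
  have /andP[wi0 wioo] := wB i.
  have wfin : w (B i) \is a fin_num by rewrite ge0_fin_numE// ltW.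
  have Gfin : (\int[mu]_(x in B i) (G x * m x)%:E)%E \is a fin_num.
    rewrite ge0_fin_numE//; apply: integral_ge0 => x _.
    by rewrite lee_fin mulr_ge0.
  have : (\int[mu]_(x in B i) (G x * m x)%:E <=
      \int[mu]_(x in B i) (G' x)%:E + (l / 2)%:E * w (B i))%E.
    rewrite /w -ge0_integralZl//; first last.
    - by rewrite lee_fin divr_ge0// ltW.
    - by move=> x _; rewrite lee_fin.
    - by apply/measurable_EFinP; exact: measurable_funTS.
    rewrite -ge0_integralD//; first last.
    - by apply/measurable_EFinP; apply: measurable_funTS; exact: measurable_funM.
    - by move=> x _; rewrite -EFinM lee_fin mulr_ge0// divr_ge0// ltW.
    - by apply/measurable_EFinP; exact: measurable_funTS.
    - by move=> x _; rewrite lee_fin.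
    apply: ge0_le_integral => //.
    - by move=> x _; rewrite lee_fin mulr_ge0.
    - by apply/measurable_EFinP; apply: measurable_funTS; exact: measurable_funM.
    - by apply/measurable_EFinP; apply: measurable_funTS; apply: measurable_funD => //; exact: measurable_funM.
    move=> x _; rewrite -EFinM -EFinD lee_fin /G' indicE.
    have [xl|xl] := boolP (x \in _).
      by rewrite mulr1 lerDl mulr_ge0// divr_ge0// ltW.
    rewrite mulr0 add0r ler_wpM2r//.
    by move: xl; rewrite notin_setE/= => /negP; rewrite -leNgt; lra.
  move: li; rewrite /wavg ltr_pdivlMr; last by rewrite fine_gt0// wi0.
  rewrite -lte_fin EFinM !fineK// => li /(lt_le_trans li).
  rewrite -(fineK wfin).
  move: (\int[mu]_(x in B i) (G' x)%:E)%E => [g| |]; last 2 first.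
  - by rewrite leey.
  - by rewrite ltNge leNye.
  rewrite -!EFinM -EFinD lte_fin lee_fin; lra.
apply: (@le_trans _ _ ((l / 2)%:E * \sum_(i <- DD) w (Bs i))%E).
  apply: lee_wpmul2l; first by rewrite lee_fin divr_ge0// ltW.
  under [leRHS]eq_bigr do rewrite /w integral_in_indic.
  rewrite -ge0_integral_sumE; first last.
  - by move=> i; apply: measurable_funM; [exact: mm|exact: mind].
  - by move=> i x; rewrite mulr_ge0.
  apply: ge0_le_integralE.
  - by move=> x; rewrite mulr_ge0.
  - by apply: measurable_funM; [exact: mm|exact: mind].
  - by apply: measurable_sum => i; apply: measurable_funM; [exact: mm|exact: mind].
  move=> x; rewrite -mulr_sumr ler_wpM2l// indicE.
  case: (boolP (x \in _)) => [|_]; last exact: sumr_ge0.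
  rewrite inE/= => /(maxop_gt (ltW l0))[i [si Bx li]].
  have [|j jD Bij] := cD i; first by rewrite mem_filter li.
  rewrite (big_rem j)//= indicE mem_set; last exact: Bij.
  by rewrite lerDl; apply: sumr_ge0.
apply: (@le_trans _ _ (D%:E * \sum_(i <- DD) ((l / 2)%:E * w (B i)))%E).
  rewrite -ge0_sume_distrr; last by move=> i _; apply: integral_ge0 => x _; rewrite lee_fin.
  rewrite muleCA; apply: lee_wpmul2l; first by rewrite lee_fin divr_ge0// ltW.
  rewrite ge0_sume_distrr; last by move=> i _; apply: integral_ge0 => x _; rewrite lee_fin.
  exact: lee_sum.
apply: lee_wpmul2l => //.
apply: (@le_trans _ _ (\sum_(i <- DD) \int[mu]_(x in B i) (G' x)%:E)%E).
  by rewrite big_seq [leRHS]big_seq; apply: lee_sum => i; exact: good.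
rewrite -ge0_integral_bigsetU//; first last.
- by move=> x _; rewrite lee_fin.
- by apply/measurable_EFinP; exact: measurable_funTS.
apply: ge0_subset_integral => //.
- by apply: bigsetU_measurable => i _.
- exact/measurable_EFinP.
- by move=> x _; rewrite lee_fin.
Qed.

(** A finite family takes finitely many averages, so the values of its maximal
    function that are not zero lie between two fixed bounds and finitely many
    dyadic levels describe it. *)
Lemma maxop_range s (G : T -> R) : exists h (L : nat), 0 < h /\
  forall x, maxop s G x = 0 \/ (h < maxop s G x /\ maxop s G x <= h * 2 ^+ L).
Proof.
have [h h0 hs] : exists2 h, 0 < h & forall i, i \in s -> 0 < wavg G i -> h < wavg G i.
  elim: s => [|i s [h h0 H]]; first by exists 1.
  have [i0|i0] := ltP 0 (wavg G i); last first.
    exists h => // j; rewrite inE => /predU1P[->|/H//].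
    by rewrite ltNge i0.
  (* halved, so that the lower bound is strict *)
  exists (Num.min h (wavg G i / 2)).
    by rewrite lt_min h0 divr_gt0.
  move=> j; rewrite inE gt_min => /predU1P[->|/H js] j0; last by rewrite js.
  by apply/orP; right; lra.
have [M M0 Ms] : exists2 M, 0 <= M & forall i, i \in s -> wavg G i <= M.
  elim: {hs} s => [|i s [M M0 H]]; first by exists 0.
  exists (Num.max M (wavg G i)); first by rewrite le_max M0.
  move=> j; rewrite inE le_max => /predU1P[->|/H ->//]; by rewrite lexx orbT.
have [L LM] : exists L : nat, M <= h * 2 ^+ L.
  exists (Num.truncn (M / h)).+1; rewrite mulrC -ler_pdivrMr//.
  apply: (@le_trans _ _ (Num.truncn (M / h)).+1%:R).
    by rewrite ltW// truncnS_gt.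
  by rewrite -natrX ler_nat ltnW// ltn_expl.
exists h, L; split => // x.
have := maxop_ge0 s G x; rewrite le_eqVlt => /predU1P[<-|pos]; first by left.
right; split.
  have [i [si Bx i0]] := maxop_gt (lexx 0) pos.
  exact: lt_le_trans (hs _ si i0) (wavg_le_maxop _ si Bx).
apply: le_trans LM; exact: maxop_le.
Qed.

Definition maximal_const (r : R) : R :=
  4 `^ r * (2 `^ (r - 1) / (2 `^ (r - 1) - 1)) * D.

(** The integral of the [r]-th power is a sum over dyadic levels; inserting the
    weak type bound at each level and exchanging the sum with the integral leaves
    a geometric sum with ratio [2^(r - 1)], which is where [1 < r] is needed. *)
Lemma maxop_strong s (G : T -> R) (r : R) : 1 < r ->
  (forall x, 0 <= G x) -> measurable_fun setT G ->
  (forall i, \int[mu]_(x in B i) (G x * m x)%:E < +oo)%E ->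
  (\int[mu]_x (maxop s G x `^ r * m x)%:E <=
   (maximal_const r)%:E * \int[mu]_x (G x `^ r * m x)%:E)%E.
Proof.
move=> r1 G0 mG foo.
have r0 : 0 < r by rewrite (lt_trans ltr01).
have r10 : 0 < r - 1 by rewrite subr_gt0.
have [h [L [h0 range]]] := maxop_range s G.
have mind (A : set T) : measurable A -> measurable_fun setT (\1_A : T -> R).
  by move=> mA; exact: measurable_indic.
pose th (j : nat) := h * 2 ^+ j.
have th0 j : 0 < th j by rewrite mulr_gt0// exprn_gt0.
pose E j := [set x | th j < maxop s G x].
pose E' j := [set x | th j < 2 * G x].
have mE j : measurable (E j) by apply: measurable_superlevel; exact: measurable_maxop.
have mE' j : measurable (E' j) by apply: measurable_superlevel; exact: measurable_funM.
have indE (b : bool) (A : set T) x : (A x <-> b) -> \1_A x = b%:R :> R.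
  move=> Ab; rewrite indicE; case: b Ab => Ab.
    by rewrite mem_set//; exact/Ab.
  by rewrite memNset// => /Ab.
pose I1 j := (\int[mu]_x (m x * \1_(E j) x)%:E)%E.
pose I2 j := (\int[mu]_x (G x * m x * \1_(E' j) x)%:E)%E.
have mGm : measurable_fun setT (fun x => G x * m x) by exact: measurable_funM.
have mterm j : measurable_fun setT (fun x => m x * \1_(E j) x).
  by apply: measurable_funM; [exact: mm|exact: mind].
have mterm' j : measurable_fun setT (fun x => G x * m x * \1_(E' j) x).
  by apply: measurable_funM; [exact: mGm|exact: mind].
have t0 j x : 0 <= m x * \1_(E j) x by rewrite mulr_ge0.
have t'0 j x : 0 <= G x * m x * \1_(E' j) x by rewrite !mulr_ge0.
apply: (@le_trans _ _ (\sum_(j < L) ((2 * th j) `^ r)%:E * I1 j)%E).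
  rewrite -(big_mkord xpredT (fun j => ((2 * th j) `^ r)%:E * I1 j)%E).
  under [leRHS]eq_bigr do rewrite /I1 -ge0_integralZlE ?powR_ge0//.
  rewrite -ge0_integral_sumE; first last.
  - by move=> j; apply: measurable_funM => //; exact: mterm.
  - by move=> j x; rewrite mulr_ge0 ?powR_ge0.
  apply: ge0_le_integralE.
  - by move=> x; rewrite mulr_ge0 ?powR_ge0.
  - apply: measurable_funM => //; apply: measurableT_comp (measurable_powR _) _.
    exact: measurable_maxop.
  - by apply: measurable_sum => j; apply: measurable_funM => //; exact: mterm.
  move=> x; have [->|[hx xL]] := range x.
    rewrite powR0 ?gt_eqF// mul0r; apply: sumr_ge0 => j _.
    by rewrite mulr_ge0 ?powR_ge0.
  apply: le_trans (ler_wpM2r (m0 x) (powR_le_sum_dyadic_levels r0 h0 hx xL)) _.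
  rewrite big_mkord mulr_suml; apply: ler_sum => j _.
  by rewrite (indE (th j < maxop s G x))// mulrAC -mulrA.
apply: (@le_trans _ _ (\sum_(j < L) (2 * 2 `^ r * D * th j `^ (r - 1))%:E * I2 j)%E).
  apply: lee_sum => j _.
  have := w_weak s (th0 j) G0 mG foo; rewrite -/(I1 j) -/(I2 j) => H.
  have c0 : (0 <= (2 * 2 `^ r * th j `^ (r - 1))%:E :> \bar R)%E.
    by rewrite lee_fin !mulr_ge0 ?powR_ge0.
  have := lee_wpmul2l c0 H.
  rewrite !muleA -!EFinM.
  rewrite (_ : 2 * 2 `^ r * th j `^ (r - 1) * (th j / 2) = (2 * th j) `^ r); last first.
    rewrite (powRM _ _ (ltW (th0 j)))// -(mulr_powRB1 (ltW (th0 j)) r0); by field.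
  by rewrite (mulrAC (2 * 2 `^ r)).
rewrite -(big_mkord xpredT (fun j => (2 * 2 `^ r * D * th j `^ (r - 1))%:E * I2 j)%E).
have k0 j : 0 <= 2 * 2 `^ r * D * th j `^ (r - 1) by rewrite !mulr_ge0 ?powR_ge0.
under eq_bigr do rewrite /I2 -ge0_integralZlE//.
have C0 : 0 <= maximal_const r.
  rewrite !mulr_ge0 ?powR_ge0// invr_ge0 subr_ge0.
  have : 1 `^ (r - 1) <= 2 `^ (r - 1) :> R.
    by apply: ge0_ler_powR; rewrite ?nnegrE ?(ltW r10)// ler1n.
  by rewrite powR1.
rewrite -ge0_integral_sumE; first last.
- by move=> j; apply: measurable_funM => //; exact: mterm'.
- by move=> j x; rewrite mulr_ge0.
rewrite -ge0_integralZlE//; first last.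
- apply: measurable_funM => //; exact: measurableT_comp (measurable_powR _) _.
- by move=> x; rewrite mulr_ge0 ?powR_ge0.
apply: ge0_le_integralE.
- by move=> x; apply: sumr_ge0 => j _; rewrite mulr_ge0.
- by apply: measurable_sum => j; apply: measurable_funM => //; exact: mterm'.
- apply: measurable_funM => //; apply: measurable_funM => //.
  exact: measurableT_comp (measurable_powR _) _.
move=> x.
have Gx2 : 0 <= 2 * G x by rewrite mulr_ge0.
have := sum_dyadic_levels_le L r10 h0 Gx2.
rewrite big_mkord => H.
have K0 : 0 <= 2 * 2 `^ r * D * (G x * m x) by rewrite !mulr_ge0 ?powR_ge0.
have := ler_wpM2l K0 H.
set S := (X in X <= _ -> _); set S' := (X in _ -> X <= _).
have -> : S = S'.
  rewrite /S /S' mulr_sumr; apply: eq_bigr => j _.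
  rewrite (indE (th j < 2 * G x))// -/(th j); ring.
move=> /le_trans; apply.
rewrite le_eqVlt; apply/orP; left; apply/eqP.
rewrite /maximal_const powRM//.
rewrite -(mulr_powRB1 (G0 x) r0).
rewrite (_ : 4 = 2 * 2 :> R); last by ring.
have p2 : 0 <= 2 :> R by [].
set k := 2 `^ (r - 1) / _; rewrite (powRM r p2 p2) -(mulr_powRB1 p2 r0).
ring.
Qed.

End maximal.

(** * Hoelder's inequality and geometric sums *)

Section hoelder_ge0.
Context d (T : measurableType d) (R : realType) (mu : {measure set T -> \bar R}).

Lemma Lnorm_powR_inv (c : R) (u : T -> R) : 0 < c -> (forall x, 0 <= u x) ->
  ('N[mu]_(c^-1)%:E[EFin \o (fun x => u x `^ c)%R] =
   (\int[mu]_x (u x)%:E) `^ c)%E.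
Proof.
move=> c0 u0; rewrite unlock invrK; congr (_ `^ _)%E.
apply: eq_integral => x _ /=.
rewrite ger0_norm ?powR_ge0// -powRrM mulfV ?gt_eqF//.
by rewrite powRr1.
Qed.

Lemma hoelder_ge0 (t : R) (u v : T -> R) : 0 < t < 1 ->
  measurable_fun setT u -> measurable_fun setT v ->
  (forall x, 0 <= u x) -> (forall x, 0 <= v x) ->
  (\int[mu]_x (u x `^ (1 - t) * v x `^ t)%:E <=
   (\int[mu]_x (u x)%:E) `^ (1 - t) * (\int[mu]_x (v x)%:E) `^ t)%E.
Proof.
move=> /andP[t0 t1] mu_ mv u0 v0; have t1' : 0 < 1 - t by rewrite subr_gt0.
rewrite -!Lnorm_powR_inv//.
have := @hoelder _ T R mu (fun x => u x `^ (1 - t)) (fun x => v x `^ t)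
  (1 - t)^-1 t^-1 _ _ _ _ _.
rewrite Lnorm1 => H.
under eq_integral => x _.
  rewrite -[_%:E]gee0_abs; last by rewrite lee_fin mulr_ge0 ?powR_ge0.
  over.
apply: H; rewrite ?invr_gt0 ?invrK ?subrK//.
- exact: measurableT_comp (measurable_powR _) _.
- exact: measurableT_comp (measurable_powR _) _.
Qed.

End hoelder_ge0.

Section telescoping.
Context (R : realType).

Let psi (y : R) := y / (1 + y).

Let psi_step (y y' dl : R) : 0 < y -> 1 < dl -> dl * y <= y' ->
  Num.min y y^-1 <= 4 * dl / (dl - 1) * (psi y' - psi y).
Proof.
move=> y0 d1 yy'; have d0 : 0 < dl by lra.
have d10 : 0 < dl - 1 by lra.
have dy0 : 0 < dl * y by rewrite mulr_gt0.
have y'0 : 0 < y' by lra.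
have psi_le : psi (dl * y) <= psi y'.
  rewrite /psi ler_pdivrMr ?addr_gt0// mulrAC ler_pdivlMr ?addr_gt0//.
  by rewrite !mulrDr !mulr1 (mulrC y') lerD2r.
apply: (@le_trans _ _ (4 * dl / (dl - 1) * (psi (dl * y) - psi y))); last first.
  by rewrite ler_wpM2l// ?lerD2r// divr_ge0 ?(ltW d10)// mulr_ge0// ltW.
have -> : 4 * dl / (dl - 1) * (psi (dl * y) - psi y) =
    4 * dl * y / ((1 + dl * y) * (1 + y)).
  by rewrite /psi; field; rewrite !gt_eqF// addr_gt0.
have den0 : 0 < (1 + dl * y) * (1 + y) by rewrite mulr_gt0// addr_gt0.
rewrite ge_min; apply/orP; have [y1|y1] := leP y 1; [left|right].
  rewrite ler_pdivlMr// (mulrC (4 * dl)) ler_pM2l//.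
  apply: (@le_trans _ _ ((1 + dl) * 2)); last by lra.
  apply: ler_pM; [lra|lra| |lra].
  by rewrite lerD2l ler_piMr// ltW.
rewrite -(ler_pM2l y0) mulfV ?gt_eqF// mulrA ler_pdivlMr// mul1r.
apply: (@le_trans _ _ ((2 * (dl * y)) * (2 * y))); last by lra.
apply: ler_pM; [lra|lra| |lra].
have := ler_wpM2l (ltW d0) (ltW y1); lra.
Qed.

(** After rescaling, the [k]-th term is at most [c * min(y_k, 1/y_k)] for a
    sequence [y_k] with [d^e * y_k <= y_(k+1)]. Such a minimum is at most a
    constant times the increment of the bounded function [psi(y) = y / (1 + y)]
    ([psi_step]), so the sum telescopes and the bound does not depend on the
    number of terms. *)
Lemma sum_min_le (d u v : R) : 1 < d -> 0 < u -> 0 < v ->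
  exists2 K : R, 0 <= K & forall (Phi Y : R) (mk b : nat -> R) (L : nat),
    0 < Phi -> 0 < Y -> (forall k, 0 < mk k) ->
    (forall k, d * mk k <= mk k.+1) ->
    (forall k, (k < L)%N -> 0 <= b k /\
       (b k <= Phi * mk k `^ (- u) /\ b k <= Y * mk k `^ v)) ->
    \sum_(k < L) b k <= K * (Phi `^ (v / (u + v)) * Y `^ (u / (u + v))).
Proof.
move=> d1 u0 v0; pose e := Num.min u v; have e0 : 0 < e by rewrite lt_min u0.
have uv0 : 0 < u + v by rewrite addr_gt0.
have d0 : 0 < d by lra.
have de1 : 1 < d `^ e.
  have : 1 `^ e < d `^ e by apply: gt0_ltr_powR; rewrite ?nnegrE// ltW.
  by rewrite powR1.
exists (4 * d `^ e / (d `^ e - 1)).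
  by rewrite divr_ge0 ?mulr_ge0 ?powR_ge0// subr_ge0 ltW.
move=> Phi Y mk b L Phi0 Y0 mk0 mkd bP.
set c := _ * _ `^ (u / _).
have c0 : 0 < c by rewrite mulr_gt0 ?powR_gt0.
pose h := (Y / Phi) `^ (u + v)^-1.
have h0 : 0 < h by rewrite powR_gt0 ?divr_gt0.
pose z k := mk k * h; have z0 k : 0 < z k by rewrite mulr_gt0.
pose y k := z k `^ e; have y0 k : 0 < y k by rewrite powR_gt0.
have PhiE k : Phi * mk k `^ (- u) = c * z k `^ (- u).
  rewrite /z /h /c powRM ?powR_ge0 ?(ltW (mk0 k))// -powRrM.
  rewrite powRM ?invr_ge0 ?(ltW Phi0) ?(ltW Y0)//.
  rewrite -[Phi^-1]powR_inv1 ?(ltW Phi0)// -powRrM.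
  rewrite (_ : Phi `^ _ * Y `^ (u / (u + v)) * _ =
    (Phi `^ (v / (u + v)) * Phi `^ (- 1 * ((u + v)^-1 * - u))) *
    (Y `^ (u / (u + v)) * Y `^ ((u + v)^-1 * - u)) * mk k `^ (- u)); last by ring.
  rewrite -!powRD ?(gt_eqF Phi0) ?(gt_eqF Y0) ?implybT//.
  rewrite (_ : v / _ + _ = 1); last by field; rewrite gt_eqF.
  rewrite (_ : u / _ + _ = 0); last by field; rewrite gt_eqF.
  by rewrite powRr0 powRr1 ?mulr1// ltW.
have YE k : Y * mk k `^ v = c * z k `^ v.
  rewrite /z /h /c powRM ?powR_ge0 ?(ltW (mk0 k))// -powRrM.
  rewrite powRM ?invr_ge0 ?(ltW Phi0) ?(ltW Y0)//.
  rewrite -[Phi^-1]powR_inv1 ?(ltW Phi0)// -powRrM.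
  rewrite (_ : Phi `^ _ * Y `^ (u / (u + v)) * _ =
    (Phi `^ (v / (u + v)) * Phi `^ (- 1 * ((u + v)^-1 * v))) *
    (Y `^ (u / (u + v)) * Y `^ ((u + v)^-1 * v)) * mk k `^ v); last by ring.
  rewrite -!powRD ?(gt_eqF Phi0) ?(gt_eqF Y0) ?implybT//.
  rewrite (_ : v / _ + _ = 0); last by field; rewrite gt_eqF.
  rewrite (_ : u / _ + _ = 1); last by field; rewrite gt_eqF.
  by rewrite powRr0 mul1r powRr1// ltW.
have bmin k : (k < L)%N -> b k <= c * Num.min (y k) (y k)^-1.
  move=> /bP[_ []]; rewrite PhiE YE => b1 b2.
  have eu : e <= u by rewrite ge_min lexx.
  have ev : e <= v by rewrite ge_min lexx orbT.
  have [z1|z1] := leP (z k) 1.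
    have y1 : y k <= 1.
      have : z k `^ e <= 1 `^ e.
        by apply: ge0_ler_powR => //; rewrite ?nnegrE// ltW.
      by rewrite powR1.
    rewrite min_l; last by rewrite (le_trans y1)// invf_ge1.
    apply: le_trans b2 _; rewrite ler_pM2l//; apply: ger_powR => //.
    by rewrite z0.
  have y1 : 1 <= y k.
    have : 1 `^ e <= z k `^ e.
      by apply: ge0_ler_powR => //; rewrite ?nnegrE// ltW.
    by rewrite powR1.
  rewrite min_r; last by rewrite (le_trans _ y1)// invf_le1.
  apply: le_trans b1 _; rewrite ler_pM2l// /y -powRN.
  by apply: ler_powR; [exact: ltW|rewrite lerN2].
have yd k : d `^ e * y k <= y k.+1.
  rewrite /y -powRM ?(ltW d0) ?(ltW (z0 k))//.
  apply: ge0_ler_powR; rewrite ?nnegrE ?(ltW e0) ?(ltW (z0 _))//.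
    by rewrite mulr_ge0// ltW.
  by rewrite /z mulrA ler_pM2r.
apply: (@le_trans _ _ (\sum_(k < L) c * (4 * d `^ e / (d `^ e - 1) * (psi (y k.+1) - psi (y k))))).
  apply: ler_sum => k _; apply: le_trans (bmin k (ltn_ord k)) _.
  by rewrite ler_pM2l//; apply: psi_step.
rewrite -mulr_sumr -mulr_sumr mulrC ler_pM2r//.
rewrite -(big_mkord xpredT (fun k => psi (y k.+1) - psi (y k))) telescope_sumr//.
rewrite ler_piMr//.
  by rewrite divr_ge0 ?mulr_ge0 ?powR_ge0// subr_ge0 ltW.
have ps k : 0 <= psi (y k) <= 1.
  have yk := y0 k; rewrite /psi divr_ge0 ?addr_ge0 ?(ltW yk)//=.
  by rewrite ler_pdivrMr ?addr_gt0// mul1r lerDr.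
have /andP[? ?] := ps L; have /andP[? ?] := ps 0; lra.
Qed.

End telescoping.

(** * Muckenhoupt pairs *)

(** Locked so that masses of different sets are never compared by unfolding. *)
HB.lock Definition mass (R : realType) (n : nat) (u : 'rV[R]_n -> R)
    (E : set 'rV[R]_n) : R :=
  fine (\int[lebesgue_rV n]_(x in E) (u x)%:E)%E.

Lemma powR_root (R : realType) (c y : R) : 0 < c -> 0 <= y ->
  y = (y `^ c) `^ c^-1.
Proof. by move=> c0 y0; rewrite -powRrM mulfV ?gt_eqF// powRr1. Qed.

Section muckenhoupt.
Context (R : realType) (n : nat).
Local Notation leb := (@lebesgue_rV R n).
Implicit Types (m tau u : 'rV[R]_n -> R) (c : 'rV[R]_n) (r : R).

(** For [m = w^Q], [tau = w^(- P')] and [t = (1/P') / (1/Q + 1/P')] this is the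
    [A_(P,Q)] condition raised to the power [1 / (1/Q + 1/P')]; in this form it
    is symmetric under exchanging [m] with [tau] and [t] with [1 - t]. *)
Definition muckenhoupt_pair (t A : R) m tau : Prop :=
  [/\ measurable_fun setT m, measurable_fun setT tau,
      forall x, 0 < m x /\ 0 < tau x,
      forall x, m x `^ (1 - t) * tau x `^ t = 1 &
      forall c r, 0 < r ->
        [/\ (\int[leb]_(x in cball c r) (m x)%:E < +oo)%E,
            (\int[leb]_(x in cball c r) (tau x)%:E < +oo)%E &
            mass m (cball c r) `^ (1 - t) * mass tau (cball c r) `^ t <=
            A * (r *+ 2) ^+ n]].

Lemma muckenhoupt_pairC t A m tau :
  muckenhoupt_pair t A m tau -> muckenhoupt_pair (1 - t) A tau m.
Proof.
move=> [mm mt pos one B]; split => //.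
- by move=> x; have [] := pos x.
- by move=> x; rewrite opprB addrC subrK mulrC.
- by move=> c r r0; have [? ? ?] := B c r r0; split; [by []|by []|]; rewrite opprB addrC subrK mulrC.
Qed.

Lemma mass_ge0 u E : (forall x, 0 <= u x) -> 0 <= mass u E.
Proof. by move=> u0; rewrite mass.unlock fine_ge0// integral_ge0// => x _; rewrite lee_fin. Qed.

Lemma ge0_integral_subset_lty u (E B : set 'rV[R]_n) :
  (forall x, 0 <= u x) -> measurable_fun setT u ->
  measurable E -> measurable B -> E `<=` B ->
  (\int[leb]_(x in B) (u x)%:E < +oo)%E -> (\int[leb]_(x in E) (u x)%:E < +oo)%E.
Proof.
move=> u0 mu_ mE mB EB; apply: le_lt_trans; apply: ge0_subset_integral => //.
- by apply/measurable_EFinP; exact: measurable_funTS.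
- by move=> x _; rewrite lee_fin.
Qed.

Lemma massK u (E : set 'rV[R]_n) : (forall x, 0 <= u x) ->
  (\int[leb]_(x in E) (u x)%:E < +oo)%E ->
  (\int[leb]_(x in E) (u x)%:E = (mass u E)%:E)%E.
Proof.
move=> u0 foo; rewrite mass.unlock fineK// ge0_fin_numE// integral_ge0// => x _.
by rewrite lee_fin.
Qed.

Lemma le_mass u (E B : set 'rV[R]_n) :
  (forall x, 0 <= u x) -> measurable_fun setT u ->
  measurable E -> measurable B -> E `<=` B ->
  (\int[leb]_(x in B) (u x)%:E < +oo)%E -> mass u E <= mass u B.
Proof.
move=> u0 mu_ mE mB EB foo; rewrite -lee_fin -!massK//; last first.
  exact: ge0_integral_subset_lty foo.
apply: ge0_subset_integral => //.
- by apply/measurable_EFinP; exact: measurable_funTS.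
- by move=> x _; rewrite lee_fin.
Qed.

Lemma massD u (E B : set 'rV[R]_n) :
  (forall x, 0 <= u x) -> measurable_fun setT u ->
  measurable E -> measurable B -> E `<=` B ->
  (\int[leb]_(x in B) (u x)%:E < +oo)%E ->
  mass u (B `\` E) = mass u B - mass u E.
Proof.
move=> u0 mu_ mE mB EB foo.
have mD : measurable (B `\` E) by exact: measurableD.
have foo1 := ge0_integral_subset_lty u0 mu_ mE mB EB foo.
have foo2 := ge0_integral_subset_lty u0 mu_ mD mB (@subDsetl _ _ _) foo.
apply/eqP; rewrite eq_sym subr_eq -eqe EFinD -!massK//.
apply/eqP; rewrite addeC -ge0_integral_setU//.
- by rewrite setDUK.
- by apply/measurable_EFinP; exact: measurable_funTS.
- by move=> x _; rewrite lee_fin.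
- by apply/disj_setPS => x [Ex [_]].
Qed.

Section pair.
Variables (t A : R) (m tau : 'rV[R]_n -> R).
Hypotheses (t01 : 0 < t < 1) (mt : muckenhoupt_pair t A m tau).

Let t0 : 0 < t. Proof. by case/andP: t01. Qed.
Let t1 : 0 < 1 - t. Proof. by rewrite subr_gt0; case/andP: t01. Qed.
Let mm : measurable_fun setT m. Proof. by case: mt. Qed.
Let mtau : measurable_fun setT tau. Proof. by case: mt. Qed.
Let m0 x : 0 <= m x. Proof. by case: mt => _ _ /(_ x)[/ltW]. Qed.
Let tau0 x : 0 <= tau x. Proof. by case: mt => _ _ /(_ x)[_ /ltW]. Qed.

(** Hoelder's inequality, since [m^(1 - t) * tau^t = 1]. *)
Lemma lebesgue_le_mass c r (E : set 'rV[R]_n) (v : R) : 0 < r ->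
  measurable E -> E `<=` cball c r -> leb E = v%:E ->
  v <= mass m E `^ (1 - t) * mass tau E `^ t.
Proof.
move=> r0 mE Er vE; have [_ _ _ one /(_ c r r0)[foom foot _]] := mt.
have mB : measurable (cball c r) by exact: measurable_cball.
have foo1 := ge0_integral_subset_lty m0 mm mE mB Er foom.
have foo2 := ge0_integral_subset_lty tau0 mtau mE mB Er foot.
rewrite -lee_fin EFinM.
rewrite -[X in (_ <= X * _)%E]poweR_EFin -[X in (_ <= _ * X)%E]poweR_EFin.
rewrite -(massK m0 foo1).
rewrite -(massK tau0 foo2).
rewrite (integral_in_indic _ E m).
rewrite (integral_in_indic _ E tau).
have mi : measurable_fun setT (\1_E : 'rV[R]_n -> R) by exact: measurable_indic.
apply: le_trans (hoelder_ge0 _ _ _ _ _ _) => //; first last.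
- by move=> x; rewrite mulr_ge0.
- by move=> x; rewrite mulr_ge0.
- by apply: measurable_funM.
- by apply: measurable_funM.
under eq_integral => x _.
  rewrite (_ : _ * _ = \1_E x); last first.
    rewrite indicE; case: (_ \in _); last first.
      by rewrite !mulr0 powR0 ?mul0r// gt_eqF.
    by rewrite !mulr1 one.
  over.
by rewrite integral_indic// setIT -[X in (_ <= X)%E]/(leb E) vE.
Qed.

Lemma mass_gt0 c r : 0 < r -> 0 < mass m (cball c r).
Proof.
move=> r0; rewrite lt_neqAle mass_ge0// andbT eq_sym; apply/negP => /eqP w0.
have := lebesgue_le_mass r0 (measurable_cball c r) (@subset_refl _ _)
  (lebesgue_cball c (ltW r0)).
rewrite w0 powR0 ?gt_eqF// mul0r leNgt => /negP; apply.
by rewrite exprn_gt0// mulrn_wgt0.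
Qed.

(** The upper bound of the pair on the cube against the lower bound
    [lebesgue_le_mass] on the subset: a subset of comparable volume has
    comparable mass. *)
Lemma mass_comparison c r (E : set 'rV[R]_n) (v : R) : 0 < r ->
  measurable E -> E `<=` cball c r -> leb E = v%:E ->
  v * mass m (cball c r) `^ (1 - t) <= A * (r *+ 2) ^+ n * mass m E `^ (1 - t).
Proof.
move=> r0 mE Er vE; have [_ _ _ _ /(_ c r r0)[foom foot AB]] := mt.
have mB : measurable (cball c r) by exact: measurable_cball.
have := lebesgue_le_mass r0 mE Er vE.
have : mass tau E `^ t <= mass tau (cball c r) `^ t.
  apply: ge0_ler_powR; rewrite ?nnegrE ?(ltW t0) ?mass_ge0//.
  exact: le_mass foot.
move=> h1 h2.
apply: (@le_trans _ _ (mass m E `^ (1 - t) * mass tau (cball c r) `^ t *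
    mass m (cball c r) `^ (1 - t))).
  rewrite ler_wpM2r ?powR_ge0// (le_trans h2)// ler_wpM2l ?powR_ge0//.
by rewrite -mulrA mulrC ler_wpM2r ?powR_ge0// mulrC.
Qed.

Lemma muckenhoupt_const_gt0 : 0 < A.
Proof.
have [_ _ _ _ /(_ 0 1 ltr01)[_ _]] := mt.
have t0' : 0 < mass tau (cball 0 1).
  rewrite lt_neqAle mass_ge0// andbT eq_sym; apply/negP => /eqP w0.
  have := lebesgue_le_mass ltr01 (measurable_cball 0 1) (@subset_refl _ _)
    (lebesgue_cball 0 ler01).
  rewrite w0 powR0 ?gt_eqF// mulr0 leNgt => /negP; apply.
  by rewrite exprn_gt0// mulrn_wgt0.
move=> H; have : 0 < A * (1 *+ 2) ^+ n.
  by apply: lt_le_trans H; rewrite mulr_gt0// powR_gt0// mass_gt0.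
by rewrite pmulr_lgt0// exprn_gt0.
Qed.

Lemma mass_doubling c c' r : 0 < r -> cball c' r `<=` cball c (3 * r) ->
  mass m (cball c (3 * r)) <= (A * 3 ^+ n) `^ (1 - t)^-1 * mass m (cball c' r).
Proof.
move=> r0 sub; have r30 : 0 < 3 * r by rewrite mulr_gt0.
have := mass_comparison r30 (measurable_cball c' r) sub (lebesgue_cball c' (ltW r0)).
have v0 : 0 < (r *+ 2) ^+ n by rewrite exprn_gt0// mulrn_wgt0.
have A0 := muckenhoupt_const_gt0.
rewrite -mulrnAr exprMn mulrA -mulrA (mulrCA _ ((r *+ 2) ^+ n)) ler_pM2l// => H.
rewrite [leLHS](powR_root t1) ?mass_ge0// [X in _ <= _ * X](powR_root t1) ?mass_ge0//.
rewrite -powRM ?powR_ge0 ?mulr_ge0 ?(ltW A0) ?exprn_ge0//.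
apply: ge0_ler_powR; rewrite ?invr_ge0 ?(ltW t1) ?nnegrE ?powR_ge0//.
by rewrite !mulr_ge0 ?powR_ge0 ?(ltW A0) ?exprn_ge0.
Qed.

(** The difference of the two cubes fills at least half of the larger one, so by
    [mass_comparison] it carries a fixed fraction of its mass. *)
Lemma mass_reverse_doubling c c' r : (0 < n)%N -> 0 < r ->
  cball c' r `<=` cball c (2 * r) ->
  (1 + ((2 * A) `^ (1 - t)^-1)^-1) * mass m (cball c' r) <= mass m (cball c (2 * r)).
Proof.
move=> n0 r0 sub; have r20 : 0 < 2 * r by rewrite mulr_gt0.
have [_ _ _ _ /(_ c _ r20)[foom foot AB]] := mt.
have mB : measurable (cball c (2 * r)) by exact: measurable_cball.
have mB' : measurable (cball c' r) by exact: measurable_cball.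
set E := cball c (2 * r) `\` cball c' r.
have mE : measurable E by exact: measurableD.
have A0 := muckenhoupt_const_gt0.
pose V := (2 * r *+ 2) ^+ n; pose V' := (r *+ 2) ^+ n.
have V0 : 0 < V by rewrite exprn_gt0// mulrn_wgt0.
have V'0 : 0 < V' by rewrite exprn_gt0// mulrn_wgt0.
have VV' : 2 * V' <= V.
  rewrite /V -mulrnAr exprMn ler_pM2r// -[n]prednK// exprS ler_peMr//.
  by rewrite exprn_ege1// ler1n.
have vE : leb E = (V - V')%:E.
  transitivity (leb (cball c (2 * r)) - leb (cball c (2 * r) `&` cball c' r))%E.
    by apply: measureD => //; rewrite -[X in (X < _)%E]/(leb _) lebesgue_cball ?ltry// ltW.
  by rewrite setIidr// !lebesgue_cball// ltW.
have EB : E `<=` cball c (2 * r) by exact: subDsetl.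
have := mass_comparison r20 mE EB vE; rewrite -/V massD// => H.
set M := mass m (cball c (2 * r)) in H *; set M' := mass m (cball c' r) in H *.
have M0 : 0 < M by exact: mass_gt0.
have M'0 : 0 < M' by exact: mass_gt0.
have MM' : M' <= M by exact: le_mass foom.
have {}H : M `^ (1 - t) <= 2 * A * (M - M') `^ (1 - t).
  rewrite -(ler_pM2l V0); apply: (@le_trans _ _ (2 * ((V - V') * M `^ (1 - t)))).
    rewrite mulrA ler_wpM2r ?powR_ge0//; lra.
  apply: le_trans (ler_wpM2l _ H) _ => //.
  by rewrite le_eqVlt; apply/orP; left; apply/eqP; ring.
set K := (2 * A) `^ _; have K0 : 0 < K by rewrite powR_gt0// mulr_gt0.
have : M <= K * (M - M').
  rewrite [leLHS](powR_root t1) ?(ltW M0)// [X in _ <= _ * X](powR_root t1) ?subr_ge0//.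
  rewrite /K -powRM ?powR_ge0 ?mulr_ge0 ?(ltW A0)//.
  apply: ge0_ler_powR; rewrite ?invr_ge0 ?(ltW t1) ?nnegrE ?powR_ge0//.
  by rewrite !mulr_ge0 ?powR_ge0 ?(ltW A0).
move=> H2; rewrite mulrDl mul1r -lerBrDl ler_pdivrMl//.
exact: le_trans MM' H2.
Qed.

End pair.
End muckenhoupt.

(** * A countable lattice of cubes *)

Section fatou_bound.
Context d (T : measurableType d) (R : realType) (mu : {measure set T -> \bar R}).

(** Packages Fatou's lemma: the lower limit [Z] of functions with uniformly
    bounded integrals. It removes the restriction to finite families of cubes. *)
Lemma fatou_bound (h : nat -> T -> R) (C : \bar R) :
  (forall N x, 0 <= h N x) -> (forall N, measurable_fun setT (h N)) ->
  (forall N, \int[mu]_x (h N x)%:E <= C)%E ->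
  exists Z : T -> \bar R, [/\ measurable_fun setT Z, forall x, (0 <= Z x)%E,
    (\int[mu]_x Z x <= C)%E &
    forall x v N0, (forall N, (N0 <= N)%N -> v <= h N x) -> (v%:E <= Z x)%E].
Proof.
move=> h0 mh hC; pose f N x := (h N x)%:E.
have mf N : measurable_fun setT (f N) by apply/measurable_EFinP.
have einfs_le (u : nat -> \bar R) n : (einfs u n <= limn_einf u)%E.
  rewrite limn_einf_lim (cvg_lim _ (@cvg_einfs_sup _ u))//.
  by apply: ereal_sup_ubound; exists n.
have low x v N0 : (forall N, (N0 <= N)%N -> (v <= f N x)%E) ->
    (v <= limn_einf (f^~ x))%E.
  move=> H; apply: le_trans (einfs_le _ N0).
  by apply: le_ereal_inf_tmp => _ [p /= pN <-]; exact: H.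
exists (fun x => limn_einf (f^~ x)); split.
- rewrite /limn_einf; apply: measurableT_comp => //.
  by apply: measurable_fun_limn_esup => N; exact: measurableT_comp.
- by move=> x; apply: (low x _ 0%N) => N _; rewrite lee_fin.
- apply: le_trans (fatou mu measurableT mf _) _.
    by move=> N x _; rewrite lee_fin.
  rewrite limn_einf_lim (cvg_lim _ (@cvg_einfs_sup _ _))//.
  apply: ge_ereal_sup => _ [p _ <-].
  by apply: le_trans (hC p); apply: ereal_inf_lbound; exists p => /=.
- by move=> x v N0 H; apply: (low x _ N0) => N /H; rewrite lee_fin.
Qed.

End fatou_bound.

Section lattice.
Context (R : realType) (n : nat).
Implicit Types (x : 'rV[R]_n) (k : int).

(** The pair [(k, j)] stands for the cube of radius [3 * 2^k] around the point
    [2^k * j]. Countability allows a function defined by a supremum over cubes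
    to be exhausted by finite families. *)
Definition lattice_index : countType := (int * 'rV[int]_n)%type.

Definition lcenter (i : lattice_index) : 'rV[R]_n :=
  (2 : R) ^ i.1 *: map_mx (fun z : int => z%:~R : R) i.2.

Definition lradius (i : lattice_index) : R := 3 * 2 ^ i.1.

Definition lcube (i : lattice_index) : set 'rV[R]_n := cball (lcenter i) (lradius i).

Definition lcube3 (i : lattice_index) : set 'rV[R]_n :=
  cball (lcenter i) (3 * lradius i).

Definition lindex k x : lattice_index :=
  (k, \row_i Num.floor ((2 : R) ^ (- k) * x ord0 i)).

Lemma pow2_gt0 k : 0 < (2 : R) ^ k.
Proof. exact: exprz_gt0. Qed.

Lemma pow2S k : (2 : R) ^ (k + 1) = 2 * 2 ^ k.
Proof. by rewrite expfzDr// expr1z mulrC. Qed.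

Lemma lradius_gt0 i : 0 < lradius i.
Proof. by rewrite mulr_gt0// pow2_gt0. Qed.

Lemma lcube_neq0 i : lcube i !=set0.
Proof.
exists (lcenter i) => j; rewrite subrr normr0; exact: ltW (lradius_gt0 i).
Qed.

Lemma measurable_lcube i : measurable (lcube i).
Proof. exact: measurable_cball. Qed.

Lemma measurable_lcube3 i : measurable (lcube3 i).
Proof. exact: measurable_cball. Qed.

Lemma lcube_engulf i j : lradius i <= lradius j ->
  lcube i `&` lcube j !=set0 -> lcube i `<=` lcube3 j.
Proof.
move=> rij [y [yi yj]] x xi a.
have := ler_distD (y ord0 a) (x ord0 a) (lcenter j ord0 a).
have := ler_distD (lcenter i ord0 a) (x ord0 a) (y ord0 a).
rewrite (distrC (lcenter i ord0 a)); have := xi a; have := yi a; have := yj a.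
lra.
Qed.

(** The lattice point below [x] is within [2^k] of it, whence the radius
    [3 * 2^k] for a cube to contain the ball of radius [2 * 2^k] around [x]. *)
Lemma lindex_dist k x a : `|x ord0 a - lcenter (lindex k x) ord0 a| <= 2 ^ k.
Proof.
rewrite /lcenter /lindex/= !mxE.
set y := 2 ^ (- k) * _; have yE : x ord0 a = 2 ^ k * y.
  by rewrite /y mulrA -expfzDr// subrr expr0z mul1r.
have k0 := pow2_gt0 k.
rewrite yE -mulrBr normrM gtr0_norm// -[leRHS]mulr1 ler_pM2l//.
have := floor_le y; have := floorD1_gt y; rewrite intrD => h1 h2.
rewrite ger0_norm ?subr_ge0//; lra.
Qed.

Lemma cball_sub_lcube k x : cball x (2 * 2 ^ k) `<=` lcube (lindex k x).
Proof.
move=> y yx a; have := yx a; have := lindex_dist k x a.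
have := ler_distD (x ord0 a) (y ord0 a) (lcenter (lindex k x) ord0 a).
by rewrite /lradius/=; lra.
Qed.

Lemma lcube_sub_cball k x : lcube (lindex k x) `<=` cball x (4 * 2 ^ k).
Proof.
move=> y yx a; have := yx a; have := lindex_dist k x a.
have := ler_distD (lcenter (lindex k x) ord0 a) (y ord0 a) (x ord0 a).
rewrite (distrC (lcenter (lindex k x) ord0 a)) /lradius/=; lra.
Qed.

Lemma lindex_in k x : lcube (lindex k x) x.
Proof.
apply: cball_sub_lcube => a; rewrite subrr normr0.
by rewrite mulr_ge0// ltW// pow2_gt0.
Qed.

Lemma lcube_nested k x :
  lcube (lindex k x) `<=` lcube (lindex (k + 1) x).
Proof.
move=> y yx a; have := yx a; have := lindex_dist k x a.
have := lindex_dist (k + 1) x a; rewrite pow2S.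
have := ler_distD (x ord0 a) (y ord0 a) (lcenter (lindex (k + 1) x) ord0 a).
have := ler_distD (lcenter (lindex k x) ord0 a) (y ord0 a) (x ord0 a).
rewrite (distrC (lcenter (lindex k x) ord0 a)) /lradius/= pow2S; lra.
Qed.

Lemma lradiusS k x : lradius (lindex (k + 1) x) = 2 * lradius (lindex k x).
Proof. by rewrite /lradius/= pow2S; ring. Qed.

Definition lvol (i : lattice_index) : R := (lradius i *+ 2) ^+ n.

Lemma lvol_gt0 i : 0 < lvol i.
Proof. by rewrite exprn_gt0// mulrn_wgt0// lradius_gt0. Qed.

End lattice.

#[local] Opaque integral powR poweR.

(** * Two-weight bound for sums of fractional averages *)

Section lattice_maximal.
Context (R : realType) (n : nat) (t A : R) (m tau : 'rV[R]_n -> R).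
Hypotheses (t01 : 0 < t < 1) (mt : muckenhoupt_pair t A m tau).
Local Notation leb := (@lebesgue_rV R n).

Let mm : measurable_fun setT m. Proof. by case: mt. Qed.
Let m0 x : 0 <= m x. Proof. by case: mt => _ _ /(_ x)[/ltW]. Qed.

(** The bound does not depend on the finite family [J], which is why the maximal
    theorem is only needed for finite families. *)
Lemma lattice_maximal (J : seq (lattice_index n)) (G : 'rV[R]_n -> R) (r : R) :
  1 < r -> (forall x, 0 <= G x) -> measurable_fun setT G ->
  (forall i : lattice_index n, \int[leb]_(x in lcube (R := R) i) (G x * m x)%:E < +oo)%E ->
  (\int[leb]_x (maxop leb (@lcube R n) m J G x `^ r * m x)%:E <=
   (maximal_const ((A * 3 ^+ n) `^ (1 - t)^-1) r)%:E *
   \int[leb]_x (G x `^ r * m x)%:E)%E.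
Proof.
move=> r1 G0 mG foo.
have fin c s : 0 < s -> (\int[leb]_(x in cball c s) (m x)%:E < +oo)%E.
  by move=> s0; have [_ _ _ _ /(_ c s s0)[]] := mt.
apply: (@maxop_strong _ _ R leb _ (@lcube R n) (@lcube3 R n) (@lradius R n)) => //.
- exact: measurable_lcube.
- exact: measurable_lcube3.
- exact: lcube_neq0.
- exact: lcube_engulf.
- move=> i; have r0 := lradius_gt0 R i.
  rewrite fin// andbT massK//; last exact: fin.
  by rewrite lte_fin; exact: (mass_gt0 t01 mt).
- exact: powR_ge0.
- move=> i; have r0 := lradius_gt0 R i.
  rewrite massK//; last by apply: fin; rewrite mulr_gt0.
  rewrite massK//; last exact: fin.
  rewrite -EFinM lee_fin; apply: (mass_doubling t01 mt) => //.
  move=> x xi a; apply: le_trans (xi a) _.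
  by apply: ler_peMl; [exact: ltW|rewrite ler1n].
Qed.

End lattice_maximal.

Section fractional.
Context (R : realType) (n : nat).
Local Notation leb := (@lebesgue_rV R n).
Variables (P Q A : R).
Hypotheses (n0 : (0 < n)%N) (P1 : 1 < P) (PQ : P < Q).

Let a : R := Q^-1 + 1 - P^-1.
Let t : R := (1 - P^-1) / a.

(** The average of [F] over the cube times the power [1/P - 1/Q] of the volume,
    as in a fractional integral. *)
Definition frac_avg (F : 'rV[R]_n -> R) (i : lattice_index n) : R :=
  lvol R i `^ (- a) * mass F (lcube i).

Let P0 : 0 < P. Proof. exact: lt_trans ltr01 P1. Qed.
Let Q0 : 0 < Q. Proof. exact: lt_trans P0 PQ. Qed.
Let iP1 : 0 < 1 - P^-1. Proof. by rewrite subr_gt0 invf_lt1. Qed.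
Let a0 : 0 < a. Proof. by rewrite /a -addrA addr_gt0 ?invr_gt0. Qed.
Let t0 : 0 < t. Proof. by rewrite divr_gt0. Qed.
Let t1E : 1 - t = Q^-1 / a.
Proof.
rewrite /t -[X in X - _](divff (lt0r_neq0 a0)) -mulrBl; congr (_ / _).
by rewrite /a; ring.
Qed.
Let tE : t * a = 1 - P^-1. Proof. by rewrite divfK// gt_eqF. Qed.
Let t1E' : (1 - t) * a = Q^-1. Proof. by rewrite t1E divfK// gt_eqF. Qed.
Let t1 : 0 < 1 - t. Proof. by rewrite t1E divr_gt0 ?invr_gt0. Qed.
Let t01 : 0 < t < 1. Proof. by rewrite t0 -subr_gt0 t1. Qed.

Section pair.
Variables (m tau F : 'rV[R]_n -> R).
Hypotheses (mt : muckenhoupt_pair t A m tau).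
Hypotheses (F0 : forall x, 0 <= F x) (mF : measurable_fun setT F).
Hypothesis Foo : (\int[leb]_x (F x `^ P * tau x `^ (1 - P))%:E < +oo)%E.

Let Phi : R := fine (\int[leb]_x (F x `^ P * tau x `^ (1 - P))%:E)%E.

Let mm : measurable_fun setT m. Proof. by case: mt. Qed.
Let mtau : measurable_fun setT tau. Proof. by case: mt. Qed.
Let m_gt0 x : 0 < m x. Proof. by case: mt => _ _ /(_ x)[]. Qed.
Let tau_gt0 x : 0 < tau x. Proof. by case: mt => _ _ /(_ x)[]. Qed.
Let m0 x : 0 <= m x. Proof. exact: ltW. Qed.
Let tau0 x : 0 <= tau x. Proof. exact: ltW. Qed.
Let A0 : 0 < A. Proof. exact: (muckenhoupt_const_gt0 t01 mt). Qed.

Let FP0 x : 0 <= F x `^ P * tau x `^ (1 - P).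
Proof. by rewrite mulr_ge0 ?powR_ge0. Qed.

Let mFP : measurable_fun setT (fun x => F x `^ P * tau x `^ (1 - P)).
Proof.
by apply: measurable_funM; exact: measurableT_comp (measurable_powR _) _.
Qed.

Let Phi0 : 0 <= Phi.
Proof. by apply: fine_ge0; apply: integral_ge0 => x _; rewrite lee_fin. Qed.

Let PhiK : (\int[leb]_x (F x `^ P * tau x `^ (1 - P))%:E = Phi%:E)%E.
Proof.
by rewrite fineK// ge0_fin_numE//; apply: integral_ge0 => x _; rewrite lee_fin.
Qed.

Let mass_powR (u : 'rV[R]_n -> R) (E : set 'rV[R]_n) (c : R) :
  (forall x, 0 <= u x) -> (\int[leb]_(x in E) (u x)%:E < +oo)%E ->
  ((\int[leb]_(x in E) (u x)%:E) `^ c = (mass u E `^ c)%:E)%E.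
Proof. by move=> u0 /(massK u0) ->. Qed.

Let mass_le_Phi c r : 0 < r ->
  (\int[leb]_(x in cball c r) (F x)%:E < +oo)%E /\
  mass F (cball c r) <= Phi `^ P^-1 * mass tau (cball c r) `^ (1 - P^-1).
Proof.
move=> r0; have [_ _ _ _ /(_ c r r0)[_ foot _]] := mt.
have mB : measurable (cball c r) by exact: measurable_cball.
have mi : measurable_fun setT (\1_(cball c r) : 'rV[R]_n -> R).
  exact: measurable_indic.
have iP : 0 < 1 - P^-1 < 1 by rewrite iP1 ltrBlDr ltrDl invr_gt0.
have : (\int[leb]_(x in cball c r) (F x)%:E <=
    (Phi `^ P^-1 * mass tau (cball c r) `^ (1 - P^-1))%:E)%E.
  rewrite EFinM -(mass_powR _ tau0 foot) -[X in (_ <= X * _)%E]poweR_EFin -PhiK.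
  rewrite [X in (_ <= _ * X `^ _)%E]integral_in_indic integral_in_indic.
  have := hoelder_ge0 leb iP mFP (measurable_funM mtau mi) FP0 _.
  have -> : 1 - (1 - P^-1) = P^-1 by ring.
  move=> H; apply: le_trans (H _); last first.
    by move=> x; rewrite mulr_ge0.
  rewrite le_eqVlt; apply/orP; left; apply/eqP; apply: eq_integral => x _.
  congr (_%:E); rewrite /= indicE; case: (_ \in _); last first.
    by rewrite !mulr0 powR0 ?mulr0// gt_eqF.
  rewrite !mulr1 powRM ?powR_ge0// -!powRrM mulfV ?gt_eqF// powRr1// -mulrA -powRD.
    rewrite (_ : _ + _ = 0); first by rewrite powRr0 mulr1.
    by field; rewrite gt_eqF.
  by rewrite (gt_eqF (tau_gt0 x)) implybT.
move=> H; have foo := le_lt_trans H (ltry _); split => //.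
by rewrite -lee_fin -massK.
Qed.

Let mass_rel (i : lattice_index n) :
  mass m (lcube i) `^ Q^-1 * mass tau (lcube i) `^ (1 - P^-1) <=
  A `^ a * lvol R i `^ a.
Proof.
have r0 := lradius_gt0 R i.
have [_ _ _ _ /(_ (lcenter R i) _ r0)[_ _ H]] := mt.
rewrite -powRM ?(ltW A0) ?(ltW (lvol_gt0 _ _))//.
rewrite -t1E' -tE (powRrM _ t a) (powRrM _ (1 - t) a) -powRM ?powR_ge0//.
apply: ge0_ler_powR; rewrite ?(ltW a0) ?nnegrE//.
  by rewrite mulr_ge0 ?powR_ge0.
by rewrite mulr_ge0 ?(ltW A0) ?(ltW (lvol_gt0 _ _)).
Qed.

Let mi_gt0 (i : lattice_index n) : 0 < mass m (lcube (R := R) i).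
Proof. exact: (mass_gt0 t01 mt _ (lradius_gt0 R i)). Qed.

Let taui_gt0 (i : lattice_index n) : 0 < mass tau (lcube (R := R) i).
Proof.
have t01' : 0 < 1 - t < 1 by rewrite t1 ltrBlDr ltrDl.
exact: (mass_gt0 t01' (muckenhoupt_pairC mt) _ (lradius_gt0 R i)).
Qed.

(** Hoelder's inequality bounds the integral of [F] by [Phi^(1/P)] and the mass
    of [tau]; the pair condition trades the latter for the mass of [m]. *)
Lemma frac_avg_le_Phi (i : lattice_index n) :
  frac_avg F i <= A `^ a * Phi `^ P^-1 * mass m (lcube i) `^ (- Q^-1).
Proof.
have r0 := lradius_gt0 R i; have [_ H] := mass_le_Phi (lcenter R i) r0.
have V0 := lvol_gt0 R i.
rewrite powRN ler_pdivlMr ?powR_gt0// /frac_avg powRN.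
rewrite -mulrA ler_pdivrMl ?powR_gt0//.
apply: (@le_trans _ _ (Phi `^ P^-1 * (mass m (lcube i) `^ Q^-1 *
   mass tau (lcube i) `^ (1 - P^-1)))).
  by rewrite mulrCA mulrC ler_pM2l ?powR_gt0//; exact: H.
apply: le_trans (ler_wpM2l (powR_ge0 _ _) (mass_rel i)) _.
by rewrite le_eqVlt; apply/orP; left; apply/eqP; ring.
Qed.

Section finite_family.
Variable J : seq (lattice_index n).

Definition tau_maximal : 'rV[R]_n -> R :=
  maxop leb (@lcube R n) tau J (fun x => F x / tau x).

(** The density whose [m]-average over a cube recovers the power [t * P] of
    [tau_maximal] relative to the mass of [m]. *)
Definition dual_density (x : 'rV[R]_n) : R := tau_maximal x `^ (t * P) / m x.

Definition m_maximal : 'rV[R]_n -> R :=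
  maxop leb (@lcube R n) m J dual_density.

Let G0 x : 0 <= tau_maximal x. Proof. exact: maxop_ge0. Qed.
Let mG : measurable_fun setT tau_maximal.
Proof. by apply: measurable_maxop; exact: measurable_lcube. Qed.
Let D0 x : 0 <= dual_density x.
Proof. by rewrite divr_ge0 ?powR_ge0. Qed.

Let minv (u : 'rV[R]_n -> R) : (forall x, 0 < u x) -> measurable_fun setT u ->
  measurable_fun setT (fun x => (u x)^-1).
Proof.
move=> u0 mu_; under eq_fun do rewrite -powR_inv1 ?(ltW (u0 _))//.
exact: measurableT_comp (measurable_powR _) _.
Qed.

Let mD : measurable_fun setT dual_density.
Proof.
apply: measurable_funM; last exact: minv.
exact: measurableT_comp (measurable_powR _) _.
Qed.

Lemma measurable_m_maximal : measurable_fun setT m_maximal.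
Proof. by apply: measurable_maxop; exact: measurable_lcube. Qed.

Lemma m_maximal_ge0 x : 0 <= m_maximal x.
Proof. exact: maxop_ge0. Qed.

Let mFt : measurable_fun setT (fun x => F x / tau x).
Proof. by apply: measurable_funM => //; exact: minv. Qed.

Let int_Ft (E : set 'rV[R]_n) :
  (\int[leb]_(x in E) (F x / tau x * tau x)%:E = \int[leb]_(x in E) (F x)%:E)%E.
Proof. by apply: eq_integral => x _; rewrite divfK ?gt_eqF. Qed.

Let int_D (E : set 'rV[R]_n) :
  (\int[leb]_(x in E) (dual_density x * m x)%:E =
   \int[leb]_(x in E) (tau_maximal x `^ (t * P))%:E)%E.
Proof. by apply: eq_integral => x _; rewrite /dual_density divfK ?gt_eqF. Qed.

Let tP0 : 0 < t * P. Proof. by rewrite mulr_gt0. Qed.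

Let D_foo (i : lattice_index n) :
  (\int[leb]_(x in lcube (R := R) i) (tau_maximal x `^ (t * P))%:E < +oo)%E.
Proof.
have [h [L [h0 range]]] := maxop_range leb (@lcube R n) tau J (fun x => F x / tau x).
have GK x : tau_maximal x <= h * 2 ^+ L.
  rewrite /tau_maximal; case: (range x) => [->|[]//].
  by rewrite mulr_ge0 ?exprn_ge0// ltW.
have ml : measurable (lcube (R := R) i) by exact: measurable_lcube.
apply: (@le_lt_trans _ _ (\int[leb]_(x in lcube (R := R) i) ((h * 2 ^+ L) `^ (t * P))%:E)%E).
  apply: ge0_le_integral => //.
  - by move=> x _; rewrite lee_fin powR_ge0.
  - apply/measurable_EFinP; apply: measurable_funTS.
    exact: measurableT_comp (measurable_powR _) _.
  - move=> x _; rewrite lee_fin; apply: ge0_ler_powR; rewrite ?nnegrE ?(ltW tP0)//.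
    by rewrite mulr_ge0 ?exprn_ge0// ltW.
rewrite integral_cst// -[X in (_ * X)%E]/(leb _) lebesgue_cball; last first.
  exact: ltW (lradius_gt0 R i).
by rewrite -EFinM ltry.
Qed.

(** The exponents match: [(dual_density)^(1/t) * m = tau_maximal^P * tau] by
    [m^(1 - t) * tau^t = 1], so the maximal theorem for [m] with exponent [1/t]
    can be followed by the one for [tau] with exponent [P]. *)
Lemma m_maximal_bound :
  (\int[leb]_x (m_maximal x `^ t^-1 * m x)%:E <=
   (maximal_const ((A * 3 ^+ n) `^ (1 - t)^-1) t^-1 *
    maximal_const ((A * 3 ^+ n) `^ t^-1) P * Phi)%:E)%E.
Proof.
have t01' : 0 < 1 - t < 1 by rewrite t1 ltrBlDr ltrDl.
have C0 r D : 1 < r -> 0 <= D -> 0 <= maximal_const D r :> R.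
  move=> r1 D0'; rewrite !mulr_ge0 ?powR_ge0// invr_ge0 subr_ge0.
  have : 1 `^ (r - 1) <= 2 `^ (r - 1) :> R.
    by apply: ge0_ler_powR; rewrite ?nnegrE ?subr_ge0 ?(ltW r1)// ler1n.
  by rewrite powR1.
have t_1 : 1 < t^-1 by rewrite invf_gt1// -subr_gt0.
apply: le_trans (lattice_maximal t01 mt J t_1 D0 mD _) _.
  by move=> i; rewrite int_D; exact: D_foo.
rewrite -mulrA [X in (_ <= X)%E]EFinM; apply: lee_wpmul2l.
  by rewrite lee_fin; apply: C0 => //; exact: powR_ge0.
have -> : (\int[leb]_x (dual_density x `^ t^-1 * m x)%:E =
    \int[leb]_x (tau_maximal x `^ P * tau x)%:E)%E.
  apply: eq_integral => x _; congr (_%:E).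
  have mx := m_gt0 x; have one : m x `^ (1 - t) * tau x `^ t = 1 by case: mt.
  have tauE : tau x = m x `^ (1 - t^-1).
    have : (m x `^ (1 - t) * tau x `^ t) `^ t^-1 = 1 by rewrite one powR1.
    rewrite powRM ?powR_ge0// -!powRrM mulfV ?gt_eqF// powRr1// => H.
    rewrite -[LHS](mulKf (x := m x `^ ((1 - t) / t))); last first.
      by rewrite gt_eqF ?powR_gt0.
    rewrite H mulr1 -powRN; congr (_ `^ _).
    by field; rewrite gt_eqF.
  rewrite /dual_density powRM ?powR_ge0 ?invr_ge0// -powRrM.
  rewrite (_ : t * P / t = P); last by field; rewrite gt_eqF.
  rewrite -mulrA; congr (_ * _); rewrite tauE.
  rewrite -[(m x)^-1]powR_inv1// -powRrM -[X in _ * X]powRr1// -powRD.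
    by congr (_ `^ _); ring.
  by rewrite (gt_eqF mx) implybT.
have := lattice_maximal t01' (muckenhoupt_pairC mt) J P1 _ mFt _.
rewrite subKr; have -> : (\int[leb]_x ((F x / tau x) `^ P * tau x)%:E = Phi%:E)%E.
  rewrite -PhiK; apply: eq_integral => x _; congr (_%:E).
  rewrite powRM ?invr_ge0// -mulrA; congr (_ * _).
  rewrite -[(tau x)^-1]powR_inv1// -powRrM -[X in _ * X]powRr1// -powRD.
    by congr (_ `^ _); ring.
  by rewrite (gt_eqF (tau_gt0 x)) implybT.
rewrite -EFinM; apply; first by move=> x; rewrite divr_ge0.
move=> i; rewrite int_Ft.
by have [] := mass_le_Phi (lcenter R i) (lradius_gt0 R i).
Qed.

(** The [tau]-average of [F / tau] over the cube is a lower bound for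
    [tau_maximal] on the whole cube, so its power, integrated over the cube, is
    dominated by the [m]-mass of [dual_density], hence by [m_maximal] at any point
    of the cube. *)
Lemma frac_avg_le_m_maximal (i : lattice_index n) x : i \in J -> lcube i x ->
  frac_avg F i <= A `^ a * (A * m_maximal x) `^ (t * P)^-1 *
                  mass m (lcube i) `^ (P^-1 - Q^-1).
Proof.
move=> iJ ix.
have V0 := lvol_gt0 R i.
have ml : measurable (lcube (R := R) i) by exact: measurable_lcube.
set M := mass m (lcube i); set T := mass tau (lcube i).
have M0 : 0 < M by exact: mi_gt0.
have T0 : 0 < T by exact: taui_gt0.
have F_ge0 : 0 <= mass F (lcube i) by exact: mass_ge0.
pose w := mass F (lcube i) / T.
have w0 : 0 <= w by rewrite divr_ge0// ltW.
have wE : wavg leb (@lcube R n) tau (fun x => F x / tau x) i = w.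
  by rewrite /wavg int_Ft /w /T mass.unlock.
have wG y : lcube i y -> w <= tau_maximal y.
  by rewrite -wE => iy; exact: wavg_le_maxop.
have wD : w `^ (t * P) * lvol R i <= mass (fun x => dual_density x * m x) (lcube i).
  rewrite -lee_fin -massK ?int_D//; first last.
  - by move=> y; rewrite mulr_ge0.
  apply: (@le_trans _ _ (\int[leb]_(x in lcube (R := R) i) (w `^ (t * P))%:E)%E).
    rewrite integral_cst// -[X in (_ <= _ * X)%E]/(leb _) lebesgue_cball//.
    exact: ltW (lradius_gt0 R i).
  apply: ge0_le_integral => //.
  - by move=> y _; rewrite lee_fin powR_ge0.
  - apply/measurable_EFinP; apply: measurable_funTS.
    exact: measurableT_comp (measurable_powR _) _.
  - move=> y iy; rewrite lee_fin; apply: ge0_ler_powR; rewrite ?nnegrE ?(ltW tP0)//.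
    exact: wG.
have AT : M `^ (1 - t) * T `^ t <= A * lvol R i.
  by have [_ _ _ _ /(_ (lcenter R i) _ (lradius_gt0 R i))[]] := mt.
have key : (T / M) `^ t * w `^ (t * P) <= A * m_maximal x.
  apply: (@le_trans _ _ (A * wavg leb (@lcube R n) m dual_density i)); last first.
    by rewrite ler_wpM2l ?(ltW A0)//; exact: wavg_le_maxop.
  rewrite (_ : wavg _ _ _ _ _ = mass (fun x => dual_density x * m x) (lcube i) / M);
    last by rewrite /wavg /M mass.unlock.
  rewrite mulrA ler_pdivlMr//.
  apply: (@le_trans _ _ (A * (w `^ (t * P) * lvol R i))); last first.
    by rewrite ler_wpM2l ?(ltW A0).
  rewrite powRM ?invr_ge0 ?(ltW T0) ?(ltW M0)//.
  rewrite -[M^-1]powR_inv1 ?(ltW M0)// -powRrM mulN1r.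
  rewrite (_ : T `^ t * M `^ (- t) * w `^ (t * P) * M =
    (M `^ (- t) * M) * T `^ t * w `^ (t * P)); last by ring.
  rewrite -[X in _ * X * _ * _]powRr1 ?(ltW M0)// -powRD ?(gt_eqF M0) ?implybT//.
  rewrite (addrC (- t)); apply: le_trans (ler_wpM2r (powR_ge0 _ _) AT) _.
  by rewrite le_eqVlt; apply/orP; left; apply/eqP; ring.
have key2 : T `^ P^-1 * w <= M `^ P^-1 * (A * m_maximal x) `^ (t * P)^-1.
  rewrite [leLHS](_ : _ = M `^ P^-1 * ((T / M) `^ t * w `^ (t * P)) `^ (t * P)^-1).
    rewrite ler_wpM2l ?powR_ge0//.
    apply: ge0_ler_powR; rewrite ?nnegrE ?invr_ge0 ?(ltW tP0)//.
      by rewrite mulr_ge0 ?powR_ge0.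
    by rewrite mulr_ge0 ?(ltW A0)// m_maximal_ge0.
  rewrite powRM ?powR_ge0// -!powRrM mulfV ?gt_eqF// powRr1// mulrA.
  rewrite (_ : t / (t * P) = P^-1); last first.
    by rewrite invfM mulrA divff ?mul1r ?gt_eqF.
  rewrite -powRM ?divr_ge0 ?(ltW T0) ?(ltW M0)//.
  by rewrite (_ : M * (T / M) = T)// mulrC divfK ?gt_eqF.
have MT0 : 0 < M `^ Q^-1 * T `^ (1 - P^-1) by rewrite mulr_gt0 ?powR_gt0.
have iV : lvol R i `^ (- a) <= A `^ a / (M `^ Q^-1 * T `^ (1 - P^-1)).
  rewrite ler_pdivlMr// powRN mulrC ler_pdivrMr ?powR_gt0//.
  exact: mass_rel.
have FE : mass F (lcube i) = T `^ (1 - P^-1) * (T `^ P^-1 * w).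
  rewrite mulrA -powRD ?(gt_eqF T0) ?implybT// subrK powRr1 ?(ltW T0)//.
  by rewrite /w mulrC divfK// gt_eqF.
rewrite /frac_avg; apply: le_trans (ler_wpM2r F_ge0 iV) _.
have -> : A `^ a / (M `^ Q^-1 * T `^ (1 - P^-1)) * mass F (lcube i) =
    A `^ a * M `^ (- Q^-1) * (T `^ P^-1 * w).
  by rewrite FE powRN; field; rewrite !gt_eqF ?powR_gt0.
apply: le_trans (ler_wpM2l _ key2) _; first by rewrite mulr_ge0 ?powR_ge0.
rewrite (addrC P^-1) [X in _ <= _ * X]powRD ?(gt_eqF M0) ?implybT//.
by rewrite le_eqVlt; apply/orP; left; apply/eqP; ring.
Qed.

End finite_family.
Lemma Phi_ge0 : 0 <= Phi. Proof. exact: Phi0. Qed.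

End pair.

Variable kap : R.
Hypothesis kap0 : 0 < kap.

(** Along the cubes [lindex (k + j) x] the masses of [m] grow geometrically, and
    the two bounds on [frac_avg] have the shape required by [sum_min_le]. *)
Lemma sum_frac_avg_le : exists2 K : R, 0 <= K &
  forall (m tau F : 'rV[R]_n -> R), muckenhoupt_pair t A m tau ->
  (forall x, 0 <= F x) -> measurable_fun setT F ->
  (\int[leb]_x (F x `^ P * tau x `^ (1 - P))%:E < +oo)%E ->
  forall (J : seq (lattice_index n)) (x : 'rV[R]_n) (k : int) (L : nat),
  (forall j : nat, (j < L)%N -> lindex (k + j%:Z) x \in J) ->
  \sum_(j < L) frac_avg F (lindex (k + j%:Z) x) `^ kap <=
  K * (fine (\int[leb]_x (F x `^ P * tau x `^ (1 - P))%:E)%E `^ (kap * (P^-1 - Q^-1)) *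
       m_maximal m tau F J x `^ (kap / (t * Q))).
Proof.
pose d : R := 1 + ((2 * A) `^ (1 - t)^-1)^-1.
have [A0|A0] := leP A 0.
  exists 0 => // m tau F mt; exfalso.
  by have := muckenhoupt_const_gt0 t01 mt; rewrite ltNge A0.
have d1 : 1 < d by rewrite ltrDl invr_gt0 powR_gt0// mulr_gt0.
have u0 : 0 < kap / Q by rewrite divr_gt0.
have v0 : 0 < kap * (P^-1 - Q^-1).
  by rewrite mulr_gt0// subr_gt0 ltf_pV2.
have [K K0 HK] := sum_min_le d1 u0 v0.
have tP0 : 0 < t * P by rewrite mulr_gt0.
exists (K * A `^ (a * kap + kap / (t * Q))); first by rewrite mulr_ge0 ?powR_ge0.
move=> m tau F mt F0 mF Foo J x k L inJ.
set Phi := fine _; have Phi0 : 0 <= Phi by exact: Phi_ge0.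
set W := m_maximal m tau F J x.
have W0 : 0 <= W by exact: m_maximal_ge0.
have b0 i : 0 <= frac_avg F i by rewrite mulr_ge0 ?powR_ge0 ?mass_ge0.
pose mk (j : nat) := mass m (lcube (lindex (k + j%:Z) x)).
have mk0 j : 0 < mk j by exact: (mass_gt0 t01 mt _ (lradius_gt0 R _)).
have bound1 (j : nat) : frac_avg F (lindex (k + j%:Z) x) `^ kap <=
    (A `^ a * Phi `^ P^-1) `^ kap * mk j `^ (- (kap / Q)).
  have H := frac_avg_le_Phi mt F0 mF Foo (lindex (k + j%:Z) x).
  apply: (@le_trans _ _ ((A `^ a * Phi `^ P^-1 * mk j `^ (- Q^-1)) `^ kap)).
    apply: ge0_ler_powR => //; rewrite ?nnegrE ?(ltW kap0)//.
    by rewrite !mulr_ge0 ?powR_ge0.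
  rewrite powRM ?powR_ge0 ?mulr_ge0 ?powR_ge0// -[X in _ * X <= _]powRrM.
  by rewrite mulNr (mulrC Q^-1).
have bound2 (j : nat) : (j < L)%N -> frac_avg F (lindex (k + j%:Z) x) `^ kap <=
    (A `^ a * (A * W) `^ (t * P)^-1) `^ kap * mk j `^ (kap * (P^-1 - Q^-1)).
  move=> jL.
  have H := frac_avg_le_m_maximal mt F0 (inJ _ jL) (lindex_in _ _).
  apply: (@le_trans _ _ ((A `^ a * (A * W) `^ (t * P)^-1 * mk j `^ (P^-1 - Q^-1)) `^ kap)).
    apply: ge0_ler_powR => //; rewrite ?nnegrE ?(ltW kap0)//.
    by rewrite !mulr_ge0 ?powR_ge0.
  rewrite powRM ?powR_ge0 ?mulr_ge0 ?powR_ge0// -[X in _ * X <= _]powRrM.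
  by rewrite (mulrC kap).
have rhs0 : 0 <= K * A `^ (a * kap + kap / (t * Q)) *
    (Phi `^ (kap * (P^-1 - Q^-1)) * W `^ (kap / (t * Q))).
  by rewrite !mulr_ge0 ?powR_ge0.
have [Phi_0|Phi_gt0] := leP Phi 0.
  have PhiE : Phi = 0 by apply/eqP; rewrite eq_le Phi_0.
  rewrite big1// => j _; apply/eqP; rewrite eq_le powR_ge0 andbT.
  apply: le_trans (bound1 j) _.
  by rewrite PhiE powR0 ?invr_neq0 ?(gt_eqF P0)// mulr0 powR0 ?(gt_eqF kap0)// mul0r.
have [W_0|W_gt0] := leP W 0.
  have WE : W = 0 by apply/eqP; rewrite eq_le W_0.
  rewrite big1// => j _; apply/eqP; rewrite eq_le powR_ge0 andbT.
  apply: le_trans (bound2 j (ltn_ord j)) _.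
  by rewrite WE mulr0 powR0 ?invr_neq0 ?(gt_eqF tP0)// mulr0 powR0 ?(gt_eqF kap0)// mul0r.
have AW0 : 0 < A * W by rewrite mulr_gt0.
have := HK ((A `^ a * Phi `^ P^-1) `^ kap) ((A `^ a * (A * W) `^ (t * P)^-1) `^ kap)
  mk (fun j => frac_avg F (lindex (k + j%:Z) x) `^ kap) L _ _ mk0 _ _.
move=> H; apply: le_trans (H _ _ _ _) _.
- by rewrite powR_gt0// mulr_gt0 ?powR_gt0.
- by rewrite powR_gt0// mulr_gt0 ?powR_gt0.
- move=> j; rewrite /mk /d.
  have jS : k + j.+1%:Z = k + j%:Z + 1 by rewrite -addrA -PoszD addn1.
  rewrite jS {2}/lcube lradiusS.
  apply: (mass_reverse_doubling t01 mt) => //; first exact: lradius_gt0.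
  by rewrite -lradiusS; exact: lcube_nested.
- move=> j jL; split; first exact: powR_ge0.
  by split; [exact: bound1|exact: bound2].
clear H HK bound1 bound2.
rewrite -[leRHS]mulrA; apply: ler_wpM2l => //.
rewrite le_eqVlt; apply/orP; left; apply/eqP.
have uv : kap / Q + kap * (P^-1 - Q^-1) = kap / P by ring.
rewrite uv.
have e1 : kap * (P^-1 - Q^-1) / (kap / P) = 1 - P / Q.
  by field; rewrite !gt_eqF.
have e2 : kap / Q / (kap / P) = P / Q by field; rewrite !gt_eqF.
rewrite e1 e2 -[X in X * _ = _]powRrM -[X in _ * X = _]powRrM.
rewrite !powRM ?powR_ge0 ?mulr_ge0 ?powR_ge0 ?(ltW A0)//.
rewrite -!powRrM.
rewrite (_ : (P^-1 * (kap * (1 - P / Q))) = kap * (P^-1 - Q^-1)); last first.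
  by field; rewrite !gt_eqF.
rewrite (_ : ((t * P)^-1 * (kap * (P / Q))) = kap / (t * Q)); last first.
  by field; rewrite !gt_eqF.
rewrite powRD ?(gt_eqF A0) ?implybT//.
rewrite (_ : a * kap = a * (kap * (1 - P / Q)) + a * (kap * (P / Q))); last by ring.
rewrite powRD ?(gt_eqF A0) ?implybT//; ring.
Qed.

(** The exponents satisfy [kap * (1/P - 1/Q) * Q / kap = Q/P - 1] and
    [kap / (t * Q) * Q / kap = 1/t], so after raising [sum_frac_avg_le] to the
    power [Q / kap] the bound [m_maximal_bound] applies for each finite family;
    [fatou_bound] then covers the whole lattice at once. *)
Theorem fractional_bound : exists2 C : R, 0 <= C &
  forall (m tau F : 'rV[R]_n -> R), muckenhoupt_pair t A m tau ->
  (forall x, 0 <= F x) -> measurable_fun setT F ->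
  (\int[leb]_x (F x `^ P * tau x `^ (1 - P))%:E < +oo)%E ->
  exists Z : 'rV[R]_n -> \bar R, [/\ measurable_fun setT Z, forall x, (0 <= Z x)%E,
    (\int[leb]_x Z x <=
     (C * fine (\int[leb]_x (F x `^ P * tau x `^ (1 - P))%:E)%E `^ (Q / P))%:E)%E &
    forall (x : 'rV[R]_n) (k : int) (L : nat),
    (((\sum_(j < L) frac_avg F (lindex (k + j%:Z) x) `^ kap) `^ (Q / kap) * m x)%:E
       <= Z x)%E].
Proof.
have [K K0 HK] := sum_frac_avg_le.
pose Cm : R := maximal_const ((A * 3 ^+ n) `^ (1 - t)^-1) t^-1.
pose Ct : R := maximal_const ((A * 3 ^+ n) `^ t^-1) P.
exists (K `^ (Q / kap) * `|Cm * Ct|); first by rewrite mulr_ge0 ?powR_ge0.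
move=> m tau F mt F0 mF Foo; set Phi := fine _.
have Phi0 : 0 <= Phi by exact: Phi_ge0.
have mm : measurable_fun setT m by case: mt.
have m0 x : 0 <= m x by case: mt => _ _ /(_ x)[/ltW].
have Qk0 : 0 < Q / kap by rewrite divr_gt0.
(* an exhaustion of the lattice by finite families *)
pose J (N : nat) : seq (lattice_index n) := pmap unpickle (iota 0 N).
have inJ (i : lattice_index n) (N : nat) : (pickle i < N)%N -> i \in J N.
  move=> iN; rewrite mem_pmap; apply/mapP; exists (pickle i); last by rewrite pickleK.
  by rewrite mem_iota.
pose h N x := (K * (Phi `^ (kap * (P^-1 - Q^-1)) *
  m_maximal m tau F (J N) x `^ (kap / (t * Q)))) `^ (Q / kap) * m x.
have mh N : measurable_fun setT (h N).
  apply: measurable_funM => //; apply: measurableT_comp (measurable_powR _) _.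
  apply: measurable_funM => //; apply: measurable_funM => //.
  apply: measurableT_comp (measurable_powR _) _; exact: measurable_m_maximal.
have h0 N x : 0 <= h N x by rewrite mulr_ge0 ?powR_ge0.
have hE N x : h N x = K `^ (Q / kap) * Phi `^ (Q / P - 1) *
    (m_maximal m tau F (J N) x `^ t^-1 * m x).
  rewrite /h powRM ?mulr_ge0 ?powR_ge0// powRM ?powR_ge0// -!powRrM !mulrA.
  rewrite (_ : kap * (P^-1 - Q^-1) * Q / kap = Q / P - 1); last first.
    by field; rewrite !gt_eqF.
  rewrite (_ : kap / (t * Q) * Q / kap = t^-1)//.
  by field; rewrite !gt_eqF.
have hC N : (\int[leb]_x (h N x)%:E <=
    (K `^ (Q / kap) * `|Cm * Ct| * Phi `^ (Q / P))%:E)%E.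
  under eq_integral do rewrite hE.
  rewrite ge0_integralZlE; first last.
  - apply: measurable_funM => //; apply: measurableT_comp (measurable_powR _) _.
    exact: measurable_m_maximal.
  - by move=> x; rewrite mulr_ge0 ?powR_ge0.
  - by rewrite mulr_ge0 ?powR_ge0.
  have c0 : (0 <= (K `^ (Q / kap) * Phi `^ (Q / P - 1))%:E :> \bar R)%E.
    by rewrite lee_fin mulr_ge0 ?powR_ge0.
  apply: le_trans (lee_wpmul2l c0 (m_maximal_bound mt F0 mF Foo (J N))) _.
  rewrite -/Phi -/Cm -/Ct -EFinM lee_fin.
  have [->|Phi_neq0] := eqVneq Phi 0.
    by rewrite !mulr0 mulr_ge0 ?mulr_ge0 ?powR_ge0.
  have Phi_gt0 : 0 < Phi by rewrite lt_neqAle eq_sym Phi_neq0.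
  have e : Phi `^ (Q / P - 1) * Phi = Phi `^ (Q / P).
    rewrite -[X in _ * X](powRr1 Phi0) -powRD ?Phi_neq0 ?implybT//.
    by rewrite subrK.
  move: (Cm * Ct) => c.
  rewrite (_ : _ * (c * Phi) = K `^ (Q / kap) * c * (Phi `^ (Q / P - 1) * Phi));
    last by ring.
  by rewrite e ler_wpM2r ?powR_ge0// ler_wpM2l ?powR_ge0// ler_norm.
have [Z [mZ Z0 ZC Zlow]] := fatou_bound h0 mh hC.
exists Z; split => // x k L.
apply: (Zlow x _ (\max_(j < L) (pickle (lindex (k + j%:Z) x)).+1)%N) => N NL.
rewrite /h ler_wpM2r//; apply: ge0_ler_powR; rewrite ?nnegrE ?(ltW Qk0)//.
- by apply: sumr_ge0 => j _; rewrite powR_ge0.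
- by rewrite !mulr_ge0 ?powR_ge0.
apply: HK => // j jL; apply: inJ; apply: leq_trans NL.
exact: (leq_bigmax (F := fun j : 'I_L => (pickle (lindex (k + j%:Z) x)).+1) (Ordinal jL)).
Qed.

End fractional.

(** * Averages of continuously differentiable functions *)

Section directional_derivative.
Context (R : realType) (n : nat).
Implicit Types (f : 'rV[R]_n -> R) (p q v x : 'rV[R]_n).

Definition C1 f : Prop :=
  [/\ continuous f,
      forall i x, derivable f x (basis_vector R i) &
      forall i, continuous (fun x => 'D_(basis_vector R i) f x)].

Lemma smooth_C1 f : smooth f -> C1 f.
Proof.
move=> sf; have [cf df] := sf [::]; split => // i.
by have [] := sf [:: i].
Qed.

Lemma norm_basis_vector_le1 (i : 'I_n) : `|basis_vector R i| <= 1.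
Proof.
rewrite /Num.norm/= mx_normrE; apply: bigmax_le => // j _.
by rewrite mxE; case: (_ && _); rewrite ?normr0 ?normr1.
Qed.

Lemma coord_le_norm x (i : 'I_n) : `|x ord0 i| <= `|x|.
Proof.
rewrite [leRHS]/Num.norm/= mx_normrE.
by apply: (le_bigmax _ (fun j : 'I_1 * 'I_n => `|x j.1 j.2|) (ord0, i)).
Qed.

Lemma norm_le_coord x (r : R) : 0 <= r ->
  (forall i, `|x ord0 i| <= r) -> `|x| <= r.
Proof.
move=> r0 H; rewrite [leLHS]/Num.norm/= mx_normrE; apply: bigmax_le => // -[i j] _ /=.
by rewrite ord1.
Qed.

Lemma line_continuous p v : continuous (fun s : R => p + s *: v).
Proof.
move=> s; apply: cvgD; first exact: cvg_cst.
by apply: cvgZr_tmp.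
Qed.

(** The mean value theorem along a coordinate line, where differentiability is
    directly available. *)
Lemma partial_mean_value f i q (b : R) : C1 f ->
  exists2 th : R, `|th| <= `|b| &
    f (q + b *: basis_vector R i) - f q =
    b * 'D_(basis_vector R i) f (q + th *: basis_vector R i).
Proof.
move=> [cf df _]; set e := basis_vector R i.
pose g (s : R) := f (q + s *: e).
have g' (s : R) : is_derive s 1 g ('D_e f (q + s *: e)).
  have E : (fun h => h^-1 *: ((g \o shift s) (h *: 1) - g s)) =
           (fun h => h^-1 *: ((f \o shift (q + s *: e)) (h *: e) - f (q + s *: e))).
    apply/funext => h; rewrite /g /=; congr (_ *: (f _ - _)).
    by rewrite [h *: 1]mulr1 scalerDl addrCA.
  by apply: DeriveDef; rewrite /derivable /derive E //; exact: df.
have cg : continuous g.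
  by move=> s; apply: continuous_comp; [exact: line_continuous|exact: cf].
have gE : f q = g 0 by rewrite /g scale0r addr0.
rewrite gE -/(g b); have [b0|b0] := leP 0 b.
  have [th] := @MVT_segment R g _ 0 b b0 (fun s _ => g' s)
    (continuous_subspaceT cg).
  rewrite in_itv/= subr0 => /andP[th0 thb] ->.
  by exists th; rewrite 1?mulrC// !ger0_norm.
have [th] := @MVT_segment R g _ b 0 (ltW b0) (fun s _ => g' s)
  (continuous_subspaceT cg).
rewrite in_itv/= sub0r => /andP[thb th0] E.
exists th; first by rewrite ler0_norm// ltr0_norm// lerN2.
by rewrite -opprB E mulrN opprK mulrC.
Qed.

(** Strict differentiability in one direction: the base point [q] may move
    together with [h], which is what changing one coordinate at a time needs. *)
Lemma strict_partial f p i (w : R) : C1 f -> forall e : R, 0 < e ->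
  exists2 d : R, 0 < d & forall q (h : R), `|q - p| < d -> `|h| < d ->
  `|f (q + (h * w) *: basis_vector R i) - f q - h * (w * 'D_(basis_vector R i) f p)|
    <= e * `|h|.
Proof.
move=> C1f e e0; have [_ _ /(_ i p) cD] := C1f.
have w1 : 0 < `|w| + 1 by rewrite ltr_wpDl.
have /cvgrPdist_le/(_ (e / (`|w| + 1)) (divr_gt0 e0 w1)) := cD.
move=> /nbhs_ballP[d0 /= d00 Hd].
exists (d0 / (`|w| + 1)); first by rewrite divr_gt0.
move=> q h qp hd; have [th thb ->] := partial_mean_value i q (h * w) C1f.
rewrite mulrA -mulrBr normrM normrM.
set xi := q + _; have : ball p d0 xi.
  rewrite -ball_normE/= distrC /xi addrAC.
  apply: le_lt_trans (ler_normD _ _) _.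
  rewrite (_ : d0 = d0 / (`|w| + 1) + d0 / (`|w| + 1) * `|w|); last first.
    by field; rewrite gt_eqF.
  rewrite ltr_leD// normrZ; apply: le_trans (ler_wpM2l _ (norm_basis_vector_le1 i)) _ => //.
  rewrite mulr1 (le_trans thb)// normrM ler_wpM2r// ltW//.
move=> /Hd/=; rewrite distrC => H.
apply: (@le_trans _ _ (`|h| * `|w| * (e / (`|w| + 1)))).
  by rewrite ler_wpM2l// mulr_ge0.
rewrite -mulrA mulrC ler_wpM2r// mulrCA ler_piMr ?(ltW e0)//.
by rewrite ler_pdivrMr// mul1r lerDl.
Qed.

(** Induction over the coordinates: each step moves the base point by an amount
    controlled by [h]. *)
Lemma strict_directional f p v (s : seq 'I_n) : C1 f -> forall e : R, 0 < e ->
  exists2 d : R, 0 < d & forall q (h : R), `|q - p| < d -> `|h| < d ->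
  `|f (q + h *: \sum_(i <- s) v ord0 i *: basis_vector R i) - f q -
    h * \sum_(i <- s) v ord0 i * 'D_(basis_vector R i) f p| <= e * `|h|.
Proof.
move=> C1f; elim: s => [|i s IH] e e0.
  exists 1 => // q h _ _; rewrite !big_nil scaler0 addr0 subrr mulr0 subr0 normr0.
  by rewrite mulr_ge0// ltW.
have e20 : 0 < e / 2 by rewrite divr_gt0.
have [d1 d10 H1] := IH _ e20.
have [d2 d20 H2] := strict_partial p i (v ord0 i) C1f e20.
have w1 : 0 < `|v ord0 i| + 1 by rewrite ltr_wpDl.
exists (Num.min d2 (d1 / (`|v ord0 i| + 1))); first by rewrite lt_min d20 divr_gt0.
move=> q h; rewrite !lt_min => /andP[qd2 qd1] /andP[hd2 hd1].
have dd : d1 / (`|v ord0 i| + 1) <= d1.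
  by rewrite ler_pdivrMr// mulrDr mulr1 lerDr mulr_ge0// ltW.
pose q' := q + (h * v ord0 i) *: basis_vector R i.
have q'p : `|q' - p| < d1.
  rewrite /q' addrAC; apply: le_lt_trans (ler_normD _ _) _.
  rewrite (_ : d1 = d1 / (`|v ord0 i| + 1) + d1 / (`|v ord0 i| + 1) * `|v ord0 i|); last first.
    by field; rewrite gt_eqF.
  rewrite ltr_leD// normrZ.
  apply: le_trans (ler_wpM2l _ (norm_basis_vector_le1 i)) _ => //.
  by rewrite mulr1 normrM ler_wpM2r// ltW.
have {}H1 := H1 q' h q'p (lt_le_trans hd1 dd).
have {}H2 := H2 q h qd2 hd2.
rewrite !big_cons (splitr e) mulrDl.
apply: le_trans (lerD H1 H2); apply: le_trans (ler_normD _ _).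
rewrite le_eqVlt; apply/orP; left; apply/eqP; congr (`|_|).
rewrite (_ : q + h *: (v ord0 i *: basis_vector R i + \sum_(j <- s) v ord0 j *: basis_vector R j) =
   q' + h *: \sum_(j <- s) v ord0 j *: basis_vector R j); last first.
  by rewrite scalerDr addrA /q' scalerA.
rewrite -/q'; ring.
Qed.

Lemma is_derive_line f p v (s : R) : C1 f ->
  is_derive s 1 (fun s : R => f (p + s *: v))
    (\sum_i v ord0 i * 'D_(basis_vector R i) f (p + s *: v)).
Proof.
move=> C1f; set D := \sum_i _; pose g (s : R) := f (p + s *: v).
have vE : v = \sum_(i <- index_enum 'I_n) v ord0 i *: basis_vector R i.
  by rewrite [LHS]row_sum_delta; apply: eq_bigr => i _; rewrite /basis_vector.
have H : (fun h => h^-1 *: ((g \o shift s) (h *: 1) - g s)) @ 0^' --> D.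
  apply/cvgrPdist_le => e e0.
  have [d d0 Hd] := strict_directional (p + s *: v) v (index_enum 'I_n) C1f e0.
  near=> h.
  have h0 : h != 0 by near: h; exact: nbhs_dnbhs_neq.
  have hd : `|h| < d.
    near: h; apply: dnbhs0_lt; exact: d0.
  have := Hd (p + s *: v) h; rewrite subrr normr0 => /(_ d0 hd).
  rewrite -vE -/D /g /= [h *: 1]mulr1 scalerDl (addrC (h *: v)) addrA => H.
  have hn : 0 < `|h| by rewrite normr_gt0.
  set X := f _ - f _ in H *.
  rewrite (_ : D - _ = - (h^-1 * (X - h * D))); last first.
    by rewrite mulrBr mulKf// opprB.
  by rewrite normrN normrM normfV ler_pdivrMl// (mulrC `|h|).
apply: DeriveDef; first by apply/cvg_ex; exists D.
by apply/cvg_lim.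
Unshelve. all: by end_near. Qed.

End directional_derivative.

Section cball_averages.
Context (R : realType) (n : nat).
Local Notation leb := (@lebesgue_rV R n).
Local Notation leb1 := (@lebesgue_measure R).
Implicit Types (f : 'rV[R]_n -> R) (c p v x z : 'rV[R]_n) (r : R).

Lemma compact_cball c r : compact (cball c r).
Proof.
rewrite (_ : cball c r =
    [set v | forall i, `[c ord0 i - r, c ord0 i + r]%classic (v ord0 i)]).
  by apply: (@rV_compact R n (fun i => `[c ord0 i - r, c ord0 i + r]%classic)) => i;
    exact: segment_compact.
by apply/seteqP; split => x /= H i; have := H i; rewrite in_itv/= ler_distl.
Qed.

Lemma continuous_bounded_cball f c r : continuous f ->
  exists2 M : R, 0 <= M & forall x, cball c r x -> `|f x| <= M.
Proof.
move=> cf; have [B0|/set0P B0] := eqVneq (cball c r) set0.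
  by exists 0 => // x; rewrite B0.
have cn : continuous (fun x => `|f x|).
  by move=> x; apply: continuous_comp; [exact: cf|exact: norm_continuous].
have [y yB H] := compact_EVT_max B0 (@compact_cball c r) (continuous_subspaceT cn).
by exists `|f y| => // x xB; apply: H; rewrite inE.
Qed.

Lemma lebesgue_cball_lty c r : (leb (cball c r) < +oo)%E.
Proof.
have [r0|r0] := leP 0 r; first by rewrite lebesgue_cball// ltry.
apply: (@le_lt_trans _ _ (leb (cball c 0))); last by rewrite lebesgue_cball// ltry.
apply: le_measure; rewrite ?inE; [exact: measurable_cball|exact: measurable_cball|].
by move=> x H i; rewrite (le_trans (H i))// ltW.
Qed.

Lemma continuous_integrable_cball f c r : continuous f ->
  leb.-integrable (cball c r) (EFin \o f).
Proof.
move=> cf; apply: measurable_bounded_integrable => //.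
- exact: measurable_cball.
- exact: lebesgue_cball_lty.
- by apply: measurable_funTS; exact: continuous_measurable_rV.
have [M M0 HM] := continuous_bounded_cball c r cf.
exists M; split; first exact: num_real.
by move=> N MN x xB; exact: le_trans (HM x xB) (ltW MN).
Qed.

Lemma affine_continuous c r : continuous (fun h : 'rV[R]_n => c + r *: h).
Proof.
by move=> h; apply: continuousD; [exact: cst_continuous|exact: scaler_continuous].
Qed.

Lemma measurable_affine c r : measurable_fun setT (fun h : 'rV[R]_n => c + r *: h).
Proof.
apply: measurable_fun_rV => i; under eq_fun do rewrite !mxE.
by apply: measurable_funD => //; apply: measurable_funM => //; exact: measurable_rV_coord.
Qed.

Definition l1_gradient f x : R := \sum_i `|'D_(basis_vector R i) f x|.

Lemma l1_gradient_ge0 f x : 0 <= l1_gradient f x.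
Proof. exact: sumr_ge0. Qed.

Lemma measurable_l1_gradient f : C1 f -> measurable_fun setT (l1_gradient f).
Proof.
move=> [_ _ cD]; apply: measurable_sum => i; apply: measurableT_comp => //.
by apply: continuous_measurable_rV; exact: cD.
Qed.

Lemma l1_gradient_bounded f c r : C1 f ->
  exists2 M : R, 0 <= M & forall x, cball c r x -> l1_gradient f x <= M.
Proof.
move=> [_ _ cD].
have H i : exists M : R, 0 <= M /\
    forall x, cball c r x -> `|'D_(basis_vector R i) f x| <= M.
  by have [M M0 HM] := continuous_bounded_cball c r (cD i); exists M.
have [M HM] := choice H; exists (\sum_i M i).
  by apply: sumr_ge0 => i _; have [] := HM i.
by move=> x xB; apply: ler_sum => i _; have [_] := HM i; exact.
Qed.

Lemma bounded_cball_lty (u : 'rV[R]_n -> R) c r (M : R) : measurable_fun setT u ->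
  (forall x, 0 <= u x) -> (forall x, cball c r x -> u x <= M) -> 0 <= M ->
  (\int[leb]_(x in cball c r) (u x)%:E < +oo)%E.
Proof.
move=> mu_ u0 uM M0; have mB : measurable (cball c r) by exact: measurable_cball.
apply: (@le_lt_trans _ _ (\int[leb]_(x in cball c r) M%:E)%E).
  apply: ge0_le_integral => //.
  - by move=> x _; rewrite lee_fin.
  - by apply/measurable_EFinP; exact: measurable_funTS.
by rewrite integral_cst// lte_mul_pinfty//; exact: lebesgue_cball_lty.
Qed.

(** The average of [f] over the cube of radius [r] around [c], written over the
    unit cube so that it depends on [c] and [r] through the integrand only. *)
Definition bavg f c r : R :=
  (2 ^+ n)^-1 * fine (\int[leb]_(h in cball 0 1) (f (c + r *: h))%:E)%E.

Lemma C1_increment f p v (V : R) : C1 f -> 0 <= V ->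
  (forall i, `|v ord0 i| <= V) ->
  (`|f (p + v) - f p|%:E <=
   V%:E * \int[leb1]_(s in `[0%R, 1%R]) (l1_gradient f (p + s *: v)%R)%:E)%E.
Proof.
move=> C1f V0 vV; have [cf _ cD] := C1f.
pose D (s : R) := \sum_i v ord0 i * 'D_(basis_vector R i) f (p + s *: v).
pose phi (s : R) := f (p + s *: v).
have dphi (s : R) : is_derive s 1 phi (D s) by exact: is_derive_line.
have cphi : continuous phi.
  by move=> s; apply: continuous_comp; [exact: line_continuous|exact: cf].
have cDi i : continuous (fun s : R => 'D_(basis_vector R i) f (p + s *: v)).
  move=> s; apply: (@continuous_comp _ _ _ (fun s : R => p + s *: v)
    (fun x => 'D_(basis_vector R i) f x)); [exact: line_continuous|exact: cD].
have cDD : continuous D.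
  have -> : D = \sum_i (fun s => v ord0 i * 'D_(basis_vector R i) f (p + s *: v)).
    by apply/funext => s; rewrite fct_sumE.
  elim/big_ind: _ => [|F F' cF cF'|i _]; first exact: cst_continuous.
    by move=> s; apply: continuousD; [exact: cF|exact: cF'].
  by move=> s; apply: cvgM; [exact: cvg_cst|exact: cDi].
have FTC : (\int[leb1]_(s in `[0%R, 1%R]) (D s)%:E = (f (p + v) - f p)%:E)%E.
  rewrite (@continuous_FTC2 _ D phi)//.
  - by rewrite /phi scale1r scale0r addr0.
  - exact: continuous_subspaceT.
  - split; first by move=> s _; exact: ex_derive.
    + by apply: cvg_at_right_filter; exact: cphi.
    + by apply: cvg_at_left_filter; exact: cphi.
  - by move=> s _; rewrite derive1E; exact: derive_val.
have mD : measurable_fun setT D by exact: continuous_measurable_fun.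
have mG : measurable_fun setT (fun s : R => l1_gradient f (p + s *: v)).
  apply: measurable_sum => i; apply: measurableT_comp => //.
  by apply: continuous_measurable_fun; exact: cDi.
rewrite -abse_EFin -FTC; apply: le_trans (le_abse_integral _ _ _) _ => //.
  by apply/measurable_EFinP; exact: measurable_funTS.
rewrite -ge0_integralZl//; first last.
- by move=> s _; rewrite lee_fin l1_gradient_ge0.
- by apply/measurable_EFinP; exact: measurable_funTS.
apply: ge0_le_integral => //.
- by apply: measurableT_comp => //; apply/measurable_EFinP; exact: measurable_funTS.
- by apply/measurable_EFinP; apply: measurable_funM => //; exact: measurable_funTS.
move=> s _; rewrite lee_fin; apply: le_trans (ler_norm_sum _ _ _) _.
by rewrite mulr_sumr; apply: ler_sum => i _; rewrite normrM ler_wpM2r.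
Qed.

(** Write the difference of the averages as an integral over the unit cube of the
    increments of [f] along segments, and each increment as an integral of the
    gradient. After exchanging the integrals, the points at time [s] fill a cube
    of radius at least [rho] inside the large cube, and the change of variables
    costs at most [rho^(-n)]. *)
Lemma bavg_increment f c0 c1 r0 r1 c r (rho V : R) : C1 f -> 0 <= V ->
  0 < rho -> rho <= r0 -> rho <= r1 ->
  cball c0 r0 `<=` cball c r -> cball c1 r1 `<=` cball c r ->
  (forall (h : 'rV[R]_n) i, cball 0 1 h ->
     `|c1 ord0 i - c0 ord0 i + (r1 - r0) * h ord0 i| <= V) ->
  (`|bavg f c1 r1 - bavg f c0 r0|%:E <=
   (V / (2 * rho) ^+ n)%:E * \int[leb]_(x in cball c r) (l1_gradient f x)%:E)%E.
Proof.
move=> C1f V0 rho0 rr0 rr1 B0 B1 HV; have [cf _ _] := C1f.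
pose U : set 'rV[R]_n := cball 0 1; set G := l1_gradient f; set B := cball c r.
have mU : measurable U by exact: measurable_cball.
have mB : measurable B by exact: measurable_cball.
have mG : measurable_fun setT G by exact: measurable_l1_gradient.
have G0 x : 0 <= G x by exact: l1_gradient_ge0.
have ci c' r' : continuous (fun h : 'rV[R]_n => f (c' + r' *: h)).
  by move=> h; apply: continuous_comp; [exact: affine_continuous|exact: cf].
have int_ c' r' : leb.-integrable U (EFin \o (fun h => f (c' + r' *: h))).
  by apply: continuous_integrable_cball; exact: ci.
have fin c' r' : (\int[leb]_(h in U) (f (c' + r' *: h))%:E)%E \is a fin_num.
  exact: integrable_fin_num (int_ c' r').
have n2 : 0 < (2 ^+ n : R)^-1 by rewrite invr_gt0 exprn_gt0.
rewrite /bavg -/U -mulrBr normrM gtr0_norm// -fineB; [|exact: fin|exact: fin].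
rewrite EFinM -abse_EFin fineK; last by rewrite fin_numB !fin.
rewrite -integralB_EFin//.
pose ps s := c0 + s *: (c1 - c0); pose rs s := r0 + s * (r1 - r0).
have psE s h : c0 + r0 *: h + s *: (c1 - c0 + (r1 - r0) *: h) = ps s + rs s *: h.
  by rewrite /ps /rs; apply/rowP => i; rewrite !mxE; ring.
have rsrho s : 0 <= s <= 1 -> rho <= rs s.
  move=> /andP[s0 s1]; rewrite /rs.
  have : (1 - s) * rho <= (1 - s) * r0 by rewrite ler_wpM2l// subr_ge0.
  have : s * rho <= s * r1 by rewrite ler_wpM2l.
  lra.
have Bs s : 0 <= s <= 1 -> cball (ps s) (rs s) `<=` B.
  move=> s01 x xs i; have rs0 : 0 < rs s by rewrite (lt_le_trans rho0)// rsrho.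
  pose h := (rs s)^-1 *: (x - ps s).
  have hU : U h.
    move=> j; rewrite !mxE subr0 normrM normfV (gtr0_norm rs0) ler_pdivrMl// mulr1.
    by have := xs j; rewrite !mxE.
  have xE : x = (1 - s) *: (c0 + r0 *: h) + s *: (c1 + r1 *: h).
    rewrite scalerBl scale1r -addrA (addrC (- _)) -scalerBr.
    rewrite (_ : c1 + r1 *: h - _ = c1 - c0 + (r1 - r0) *: h); last first.
      by rewrite scalerBl opprD addrACA.
    by rewrite psE /h scalerA divff ?gt_eqF// scale1r addrC subrK.
  clearbody h.
  have h0 : `|(c0 + r0 *: h) ord0 i - c ord0 i| <= r.
    apply: B0 => j; rewrite !mxE addrAC subrr add0r normrM.
    have := hU j; rewrite mxE subr0 => hj.
    by rewrite (@ger0_norm _ r0) ?ler_piMr//; lra.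
  have h1 : `|(c1 + r1 *: h) ord0 i - c ord0 i| <= r.
    apply: B1 => j; rewrite !mxE addrAC subrr add0r normrM.
    have := hU j; rewrite mxE subr0 => hj.
    by rewrite (@ger0_norm _ r1) ?ler_piMr//; lra.
  move/andP: s01 => [s0 s1].
  rewrite (_ : x ord0 i - c ord0 i = (1 - s) * ((c0 + r0 *: h) ord0 i - c ord0 i) +
     s * ((c1 + r1 *: h) ord0 i - c ord0 i)); last first.
    by rewrite {1}xE !mxE; ring.
  apply: le_trans (ler_normD _ _) _; rewrite !normrM (ger0_norm s0) ger0_norm ?subr_ge0//.
  have : (1 - s) * `|(c0 + r0 *: h) ord0 i - c ord0 i| <= (1 - s) * r.
    by rewrite ler_wpM2l// subr_ge0.
  have : s * `|(c1 + r1 *: h) ord0 i - c ord0 i| <= s * r by rewrite ler_wpM2l.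
  lra.
(* the integrand along all segments, extended by zero off [[0, 1] * U] *)
pose k (z : R * 'rV[R]_n) : R := G (ps z.1 + rs z.1 *: z.2) *
  (\1_(`[0, 1]%classic : set R) z.1 * \1_U z.2).
have k0 (u : R * 'rV[R]_n) : 0 <= k u by rewrite !mulr_ge0.
have mk : measurable_fun setT k.
  apply: measurable_funM.
    apply: (measurableT_comp mG); apply: measurable_fun_rV => i.
    under eq_fun do rewrite !mxE.
    apply: measurable_funD.
      apply: measurable_funD => //; apply: measurable_funM => //.
    apply: measurable_funM; last first.
      exact: (measurableT_comp (measurable_rV_coord i) measurable_snd).
    by apply: measurable_funD => //; apply: measurable_funM.
  apply: measurable_funM.
    apply: (measurableT_comp _ measurable_fst).
    by apply: measurable_indic; exact: measurable_itv.
  by apply: (measurableT_comp _ measurable_snd); exact: measurable_indic.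
have swap : (\int[leb]_h \int[leb1]_s (k (s, h))%:E =
    \int[leb1]_s \int[leb]_h (k (s, h))%:E)%E.
  have := @fubini_tonelli _ _ _ _ R leb1 leb (fun u => (k u)%:E).
  move=> H; apply/esym; apply: H; first exact/measurable_EFinP.
  by move=> u; rewrite lee_fin.
have inner s : 0 <= s <= 1 -> (\int[leb]_h (k (s, h))%:E <=
    (rho ^+ n)^-1%:E * \int[leb]_(x in B) (G x)%:E)%E.
  move=> s01; have rs0 : 0 < rs s by rewrite (lt_le_trans rho0)// rsrho.
  pose F x : \bar R := (G x * \1_(cball (ps s) (rs s)) x)%:E.
  have mF : measurable_fun setT F.
    apply/measurable_EFinP; apply: measurable_funM => //.
    by apply: measurable_indic; exact: measurable_cball.
  have F0 x : (0 <= F x)%E by rewrite lee_fin mulr_ge0.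
  have -> : (\int[leb]_h (k (s, h))%:E = \int[leb]_h F (ps s + rs s *: h)%R)%E.
    apply: eq_integral => h _; rewrite /k /F/=; congr (_%:E).
    rewrite [\1_(`[0, 1]%classic) s]indicE mem_set ?mul1r; last first.
      by rewrite /= in_itv.
    rewrite !indicE (_ : (h \in U) = (ps s + rs s *: h \in cball (ps s) (rs s)))//.
    have E j : (ps s + rs s *: h) ord0 j - ps s ord0 j = rs s * h ord0 j.
      by rewrite !mxE addrAC subrr add0r.
    apply/idP/idP; rewrite !inE => H j.
      rewrite E normrM (gtr0_norm rs0) ler_piMr ?(ltW rs0)//.
      by have := H j; rewrite mxE subr0.
    have := H j; rewrite E normrM (gtr0_norm rs0) mxE subr0.
    by rewrite -ler_pdivlMl// mulVf// gt_eqF.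
  rewrite ge0_integral_rV_affine ?gt_eqF// (gtr0_norm rs0).
  rewrite -integral_in_indic.
  apply: lee_pmul => //.
  - by rewrite lee_fin invr_ge0 exprn_ge0// ltW.
  - by apply: integral_ge0 => x _; rewrite lee_fin.
  - rewrite lee_fin lef_pV2 ?posrE ?exprn_gt0// lerXn2r// ?nnegrE ?(ltW rho0) ?(ltW rs0)//.
    exact: rsrho.
  apply: ge0_subset_integral => //.
  - exact: measurable_cball.
  - by apply/measurable_EFinP; exact: measurable_funTS.
  - by move=> x _; rewrite lee_fin.
  - exact: Bs.
have mkh h : measurable_fun setT (fun s => k (s, h)).
  by apply: (measurableT_comp mk); exact: measurable_pair2.
have mks s : measurable_fun setT (fun h => k (s, h)).
  by apply: (measurableT_comp mk); exact: measurable_pair1.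
have mK : measurable_fun setT (fun h => (\int[leb1]_s (k (s, h))%:E)%E).
  apply: (@measurable_fun_fubini_tonelli_G _ _ _ _ R leb1 (fun u => (k u)%:E)).
    exact/measurable_EFinP.
  by move=> u; rewrite lee_fin.
have mK' : measurable_fun setT (fun s => (\int[leb]_h (k (s, h))%:E)%E).
  apply: (@measurable_fun_fubini_tonelli_F _ _ _ _ R leb (fun u => (k u)%:E)).
    exact/measurable_EFinP.
  by move=> u; rewrite lee_fin.
have total : (\int[leb]_h \int[leb1]_s (k (s, h))%:E <=
    (rho ^+ n)^-1%:E * \int[leb]_(x in B) (G x)%:E)%E.
  rewrite swap.
  set I := (_ * \int[leb]_(x in B) _)%E.
  have I0 : (0 <= I)%E.
    rewrite mule_ge0 ?lee_fin ?invr_ge0 ?exprn_ge0 ?(ltW rho0)//.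
    by apply: integral_ge0 => x _; rewrite lee_fin.
  apply: (@le_trans _ _ (\int[leb1]_(s in `[0%R, 1%R]) cst I s)%E).
    rewrite [leRHS]integral_mkcond; apply: ge0_le_integral => //.
    - by move=> s _; apply: integral_ge0 => h _; rewrite lee_fin.
    - apply/(measurable_restrictT _ _).1 => //; exact: measurable_cst.
    move=> s _; rewrite patchE; case: ifPn => [|s01].
      by rewrite inE/= in_itv/=; exact: inner.
    rewrite integral0_eq// => h _; rewrite /k/= indicE (negbTE s01).
    by rewrite mul0r mulr0.
  by rewrite integral_cst//= lebesgue_measure_itv/= lte_fin ltr01 oppr0 adde0 mule1.
apply: (@le_trans _ _ ((2 ^+ n)^-1%:E * (V%:E * \int[leb]_h \int[leb1]_s (k (s, h))%:E))%E).
  apply: lee_wpmul2l; first by rewrite lee_fin ltW.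
  apply: le_trans (le_abse_integral _ mU _) _.
    apply: emeasurable_funB; apply/measurable_EFinP; apply: measurable_funTS;
      apply: continuous_measurable_rV; exact: ci.
  rewrite -ge0_integralZl//; last first.
    by move=> h _; apply: integral_ge0 => s _; rewrite lee_fin.
  rewrite integral_mkcond; apply: ge0_le_integral => //.
  - by move=> h _; apply: erestrict_ge0.
  - apply/(measurable_restrictT _ _).1 => //; apply: measurableT_comp => //.
    apply: emeasurable_funB; apply/measurable_EFinP; apply: measurable_funTS;
      apply: continuous_measurable_rV; exact: ci.
  - exact: measurable_funeM.
  move=> h _; rewrite patchE; case: ifPn => [hU|_]; last first.
    by rewrite mule_ge0 ?lee_fin//; apply: integral_ge0 => s _; rewrite lee_fin.
  have hU' : U h by rewrite inE in hU.
  pose v := c1 - c0 + (r1 - r0) *: h.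
  have -> : c1 + r1 *: h = c0 + r0 *: h + v.
    by rewrite /v; apply/rowP => i; rewrite !mxE; ring.
  rewrite -EFinB abse_EFin.
  apply: le_trans (C1_increment (c0 + r0 *: h) C1f V0 _) _.
    by move=> i; rewrite !mxE; exact: HV.
  apply: lee_wpmul2l; first by rewrite lee_fin.
  rewrite integral_in_indic le_eqVlt; apply/orP; left; apply/eqP.
  apply: eq_integral => s _; congr (_%:E); rewrite /k/= psE; congr (_ * _).
  by rewrite [\1_U h]indicE hU mulr1.
rewrite muleA -EFinM.
apply: le_trans (lee_wpmul2l _ total) _.
  by rewrite lee_fin mulr_ge0// ltW.
rewrite muleA -EFinM le_eqVlt; apply/orP; left; apply/eqP; congr (_%:E * _)%E.
by rewrite exprMn invfM; ring.
Qed.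

Lemma bavg_cvg f z : continuous f -> forall e : R, 0 < e ->
  exists2 d : R, 0 < d & forall r : R, 0 < r -> r < d -> `|f z - bavg f z r| <= e.
Proof.
move=> cf e e0; have /cvgrPdist_le/(_ e e0) := cf z.
move=> /nbhs_ballP[d /= d0 Hd]; exists d => // r r0 rd.
pose U : set 'rV[R]_n := cball 0 1; have mU : measurable U by exact: measurable_cball.
have ci : continuous (fun h : 'rV[R]_n => f (z + r *: h)).
  by move=> h; apply: continuous_comp; [exact: affine_continuous|exact: cf].
have int_ : leb.-integrable U (EFin \o (fun h => f (z + r *: h))).
  by apply: continuous_integrable_cball; exact: ci.
have intc : leb.-integrable U (EFin \o (fun=> f z)).
  by apply: continuous_integrable_cball; exact: cst_continuous.
have fin : (\int[leb]_(h in U) (f (z + r *: h))%:E)%E \is a fin_num.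
  exact: integrable_fin_num int_.
have n2 : 0 < (2 ^+ n : R) by rewrite exprn_gt0.
have lebU : leb U = (2 ^+ n)%:E by rewrite lebesgue_cball.
have cE : (\int[leb]_(h in U) (f z)%:E = (f z * 2 ^+ n)%:E)%E.
  by rewrite integral_cst// -[X in (_ * X)%E]/(leb U) lebU.
rewrite -(ler_pM2l n2) -(gtr0_norm n2) -normrM (gtr0_norm n2) mulrBr.
rewrite /bavg -/U mulVKf ?gt_eqF// -lee_fin -abse_EFin EFinB fineK// mulrC -cE.
rewrite -(integralB_EFin mU intc int_).
apply: le_trans (le_abse_integral _ mU _) _.
  apply: emeasurable_funB; first exact: measurable_cst.
  by apply/measurable_EFinP; apply: measurable_funTS; exact: continuous_measurable_rV.
apply: (@le_trans _ _ (\int[leb]_(h in U) (e%:E))%E); last first.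
  by rewrite integral_cst// -[X in (_ * X)%E]/(leb U) lebU -EFinM mulrC.
apply: ge0_le_integral => //.
- apply: measurableT_comp => //; apply: emeasurable_funB; first exact: measurable_cst.
  by apply/measurable_EFinP; apply: measurable_funTS; exact: continuous_measurable_rV.
move=> h hU; rewrite -EFinB abse_EFin lee_fin; apply: Hd.
rewrite -ball_normE/= opprD addrA subrr add0r normrN normrZ gtr0_norm//.
apply: le_lt_trans rd; rewrite ler_piMr ?(ltW r0)//.
apply: norm_le_coord => // i; by have := hU i; rewrite mxE subr0.
Qed.

End cball_averages.

(** * The Sobolev-Poincare inequality *)

Section sobolev_poincare.
Context (R : realType) (n : nat).
Local Notation leb := (@lebesgue_rV R n).
Hypothesis n0 : (0 < n)%N.

Lemma mass_cball_cst1 (c : 'rV[R]_n) (r : R) : 0 <= r ->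
  mass (fun=> 1) (cball c r) = (r *+ 2) ^+ n.
Proof.
move=> r0; rewrite mass.unlock integral_cst; last exact: measurable_cball.
by rewrite mul1e -[X in fine X]/(leb _) lebesgue_cball.
Qed.

Lemma muckenhoupt_pair_cst1 (t : R) : muckenhoupt_pair t 1 (fun _ : 'rV[R]_n => 1) (fun=> 1).
Proof.
split => //.
  by move=> x; rewrite !powR1 mulr1.
move=> c r r0; have r0' := ltW r0.
have lty : (\int[leb]_(x in cball c r) (1%R)%:E < +oo)%E.
  rewrite integral_cst; last exact: measurable_cball.
  by rewrite mul1e; exact: lebesgue_cball_lty.
split => //; rewrite mass_cball_cst1// mul1r -powRD; last first.
  by rewrite subrK oner_eq0.
by rewrite subrK powRr1// exprn_ge0// mulrn_wge0.
Qed.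

Lemma lvol_powR (i : lattice_index n) :
  lvol R i `^ (- (1 - n%:R^-1)) = (lradius R i *+ 2) / lvol R i.
Proof.
have r0 := lradius_gt0 R i; have r20 : 0 < lradius R i *+ 2 by rewrite mulrn_wgt0.
have V0 := lvol_gt0 R i; have nn0 : n%:R != 0 :> R by rewrite pnatr_eq0 -lt0n.
rewrite opprB powRD ?(gt_eqF V0) ?implybT// powR_inv1 ?(ltW V0)//; congr (_ * _).
by rewrite /lvol -powR_mulrn ?(ltW r20)// -powRrM mulfV// powRr1// ltW.
Qed.

Section chain.
Variable f : 'rV[R]_n -> R.
Hypothesis C1f : C1 f.
Let G := l1_gradient f.

Let G0 x : 0 <= G x. Proof. exact: l1_gradient_ge0. Qed.
Let mG : measurable_fun setT G. Proof. exact: measurable_l1_gradient. Qed.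
Let Goo c r : (\int[leb]_(x in cball c r) (G x)%:E < +oo)%E.
Proof.
by have [M M0 HM] := l1_gradient_bounded c r C1f; exact: bounded_cball_lty HM M0.
Qed.

Lemma bavg_increment_mass c0 c1 r0 r1 c r (rho V : R) : 0 <= V ->
  0 < rho -> rho <= r0 -> rho <= r1 ->
  cball c0 r0 `<=` cball c r -> cball c1 r1 `<=` cball c r ->
  (forall (h : 'rV[R]_n) i, cball 0 1 h ->
     `|c1 ord0 i - c0 ord0 i + (r1 - r0) * h ord0 i| <= V) ->
  `|bavg f c1 r1 - bavg f c0 r0| <= V / (2 * rho) ^+ n * mass G (cball c r).
Proof.
move=> V0 rho0 rr0 rr1 B0 B1 HV; rewrite -lee_fin EFinM -massK//.
exact: bavg_increment.
Qed.

Lemma bavg_dyadic_increment z (k : int) :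
  `|bavg f z (2 * 2 ^ k) - bavg f z (2 ^ k)| <=
  3 ^+ n / 6 * (lvol R (lindex k z) `^ (- (1 - n%:R^-1)) * mass G (lcube (lindex k z))).
Proof.
have p0 := pow2_gt0 R k.
have sub := @cball_sub_lcube R n k z.
apply: le_trans (@bavg_increment_mass z z (2 ^ k) (2 * 2 ^ k)
  (lcenter R (lindex k z)) (lradius R (lindex k z)) (2 ^ k) (2 ^ k) _ _ _ _ _ _ _) _.
- exact: ltW.
- exact: p0.
- exact: lexx.
- by lra.
- apply: subset_trans sub => y H i; apply: le_trans (H i) _; lra.
- exact: sub.
- move=> h i /(_ i); rewrite subrr add0r mxE subr0 => hi.
  rewrite (_ : 2 * 2 ^ k - 2 ^ k = 2 ^ k); last by ring.
  by rewrite normrM (gtr0_norm p0) ler_piMr// ltW.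
rewrite mulrA ler_wpM2r ?mass_ge0// lvol_powR /lvol /lradius/=.
rewrite (_ : 3 * 2 ^ k *+ 2 = 3 * (2 * 2 ^ k)); last by ring.
rewrite (exprMn _ 3) le_eqVlt; apply/orP; left; apply/eqP.
have q0 : (2 * 2 ^ k : R) ^+ n != 0 by rewrite expf_neq0// mulf_neq0// gt_eqF.
have t0 : (3 : R) ^+ n != 0 by rewrite expf_neq0.
by field; rewrite q0 t0.
Qed.

Section local.
Variables (P Q : R).
Hypotheses (P1 : 1 < P) (PQ : P < Q) (PQn : P^-1 - Q^-1 = n%:R^-1).
Variables (x : 'rV[R]_n) (K : int).

Let L : lattice_index n := lindex (K + 1) x.
Let F z : R := G z * \1_(lcube (R := R) L) z.

Let F0 z : 0 <= F z. Proof. by rewrite mulr_ge0. Qed.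
Let mF : measurable_fun setT F.
Proof. by apply: measurable_funM => //; apply: measurable_indic; exact: measurable_lcube. Qed.

Let aE : Q^-1 + 1 - P^-1 = 1 - n%:R^-1.
Proof. by rewrite -PQn; ring. Qed.

Let P0 : 0 < P. Proof. exact: lt_trans P1. Qed.

Let FP z : F z `^ P * 1 `^ (1 - P) = G z `^ P * \1_(lcube (R := R) L) z.
Proof.
rewrite powR1 mulr1 /F indicE; case: (_ \in _); rewrite ?mulr1//.
by rewrite !mulr0 powR0// gt_eqF.
Qed.

Lemma restricted_gradient_integral : (\int[leb]_z (F z `^ P * 1 `^ (1 - P))%:E =
  \int[leb]_(z in lcube (R := R) L) (G z `^ P)%:E)%E.
Proof. by rewrite [RHS]integral_in_indic; apply: eq_integral => z _; rewrite FP. Qed.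

Lemma l1_gradient_powR_lty (i : lattice_index n) :
  (\int[leb]_(z in lcube (R := R) i) (G z `^ P)%:E < +oo)%E.
Proof.
have [M M0 HM] := l1_gradient_bounded (lcenter R i) (lradius R i) C1f.
apply: (@bounded_cball_lty _ _ _ _ _ (M `^ P)).
- exact: measurableT_comp (measurable_powR _) _.
- by move=> z; exact: powR_ge0.
- move=> z zB; apply: ge0_ler_powR; rewrite ?nnegrE ?(ltW P0)//.
  exact: HM.
- exact: powR_ge0.
Qed.

Let Phi := mass (fun z => G z `^ P) (lcube (R := R) L).

Lemma PhiE : fine (\int[leb]_z (F z `^ P * 1 `^ (1 - P))%:E)%E = Phi.
Proof. by rewrite restricted_gradient_integral /Phi mass.unlock. Qed.

Let massF (i : lattice_index n) : lcube (R := R) i `<=` lcube L ->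
  mass G (lcube (R := R) i) = mass F (lcube i).
Proof.
move=> iL; rewrite mass.unlock; congr fine; apply: eq_integral => z.
by rewrite inE => zi; rewrite /F indicE mem_set ?mulr1//; exact: iL.
Qed.

Let pK : 0 < (2 : R) ^ K := pow2_gt0 R K.

Let sub_L : cball x (4 * 2 ^ K) `<=` lcube (R := R) L.
Proof.
apply: subset_trans (@cball_sub_lcube R n (K + 1) x) => y H i.
by apply: le_trans (H i) _; rewrite pow2S; lra.
Qed.

Let lcube_sub_L z (k : int) : cball x (2 * 2 ^ K) z -> k < K ->
  lcube (R := R) (lindex k z) `<=` lcube L.
Proof.
move=> zx kK; apply: subset_trans sub_L => y /(@lcube_sub_cball R n k z) H i.
have := ler_distD (z ord0 i) (y ord0 i) (x ord0 i).
have := zx i; have := H i.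
have : (2 : R) ^ (k + 1) <= 2 ^ K by rewrite ler_weXz2l ?ler1n// lezD1.
rewrite pow2S; lra.
Qed.

Lemma chain_telescope z (k : int) (J : nat) :
  `|bavg f z (2 ^ (k + J%:Z)) - bavg f z (2 ^ k)| <=
  \sum_(j < J) `|bavg f z (2 * 2 ^ (k + j%:Z)) - bavg f z (2 ^ (k + j%:Z))|.
Proof.
elim: J => [|J IH]; first by rewrite addr0 subrr normr0 big_ord0.
rewrite big_ord_recr/= -pow2S.
have -> : k + J.+1%:Z = k + J%:Z + 1 by rewrite -addrA -PoszD addn1.
rewrite addrC; apply: le_trans (lerD (lexx _) IH).
by apply: le_trans (ler_normD _ _); rewrite subrKA.
Qed.

(** Continuity makes the average over a small enough cube as close to [f z] as
    desired; the remaining steps are dyadic and each is controlled by a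
    fractional average of the gradient. Only scales below [K] occur, so the
    gradient may be restricted to the large cube [L]. *)
Lemma chain_le z (e : R) : cball x (2 * 2 ^ K) z -> 0 < e -> exists (J : nat),
  `|f z - bavg f z (2 ^ K)| <= e + 3 ^+ n / 6 *
    \sum_(j < J) frac_avg P Q F (lindex (K - J%:Z + j%:Z) z).
Proof.
move=> zx e0; have [cf _ _] := C1f.
have [d d0 Hd] := bavg_cvg z cf e0.
have [J HJ] : exists J : nat, (2 : R) ^ (K - J%:Z) < d.
  pose J := (Num.truncn (2 ^ K / d)).+1; exists J.
  have J1 : 2 ^ K / d < 2 ^+ J.
    apply: lt_le_trans (truncnS_gt _) _.
    by rewrite -natrX ler_nat ltnW// ltn_expl.
  rewrite expfzDr// -exprnN ltr_pdivrMr ?exprn_gt0// mulrC -ltr_pdivrMr//.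
exists J.
have pJ := pow2_gt0 R (K - J%:Z).
have H1 := Hd _ pJ HJ.
have := chain_telescope z (K - J%:Z) J; rewrite subrK => H2.
have H3 : \sum_(j < J) `|bavg f z (2 * 2 ^ (K - J%:Z + j%:Z)) -
      bavg f z (2 ^ (K - J%:Z + j%:Z))| <=
    3 ^+ n / 6 * \sum_(j < J) frac_avg P Q F (lindex (K - J%:Z + j%:Z) z).
  rewrite mulr_sumr; apply: ler_sum => j _.
  apply: le_trans (bavg_dyadic_increment z _) _.
  rewrite /frac_avg aE massF//; apply: lcube_sub_L => //.
  by rewrite -addrA gtrDl addrC subr_lt0 ltz_nat.
have := ler_distD (bavg f z (2 ^ (K - J%:Z))) (f z) (bavg f z (2 ^ K)).
rewrite (distrC (bavg f z (2 ^ (K - J%:Z)))); lra.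
Qed.

(** Passing from the average around [z] to the one around [x] costs a single
    average of the gradient over [L], which the norm over [L] dominates. *)
Lemma center_change z : cball x (2 * 2 ^ K) z ->
  `|bavg f z (2 ^ K) - bavg f x (2 * 2 ^ K)| <=
  6 ^+ n / 4 * (Phi `^ P^-1 * lvol R L `^ (- Q^-1)).
Proof.
move=> zx; rewrite distrC; have pK' := pK.
apply: le_trans (@bavg_increment_mass z x (2 ^ K) (2 * 2 ^ K)
  (lcenter R L) (lradius R L) (2 ^ K) (3 * 2 ^ K) _ _ _ _ _ _ _) _.
- by rewrite mulr_ge0// ltW.
- exact: pK.
- exact: lexx.
- by lra.
- apply: subset_trans sub_L => y H i.
  have := ler_distD (z ord0 i) (y ord0 i) (x ord0 i); have := zx i; have := H i.
  lra.
- apply: subset_trans sub_L => y H i; apply: le_trans (H i) _; lra.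
- move=> h i /(_ i); rewrite mxE subr0 => hi.
  apply: le_trans (ler_normD _ _) _; rewrite normrM distrC.
  rewrite (_ : 2 * 2 ^ K - 2 ^ K = 2 ^ K); last by ring.
  have : `|2 ^ K : R| * `|h ord0 i| <= 2 ^ K by rewrite (gtr0_norm pK) ler_piMr// ltW.
  by have := zx i; lra.
have Foo : (\int[leb]_z (F z `^ P * 1 `^ (1 - P))%:E < +oo)%E.
  by rewrite restricted_gradient_integral; exact: l1_gradient_powR_lty.
have := frac_avg_le_Phi P1 PQ (muckenhoupt_pair_cst1 _) F0 mF Foo L.
rewrite PhiE powR1 mul1r {1}/lcube mass_cball_cst1 ?(ltW (lradius_gt0 _ _))//.
rewrite -/(lvol R L) /frac_avg aE -massF// => H.
have c0 : 0 <= 6 ^+ n / 4 :> R by rewrite divr_ge0// exprn_ge0.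
apply: le_trans (ler_wpM2l c0 H); rewrite mulrA ler_wpM2r ?mass_ge0//.
rewrite lvol_powR /lvol /lradius/= pow2S.
rewrite (_ : 3 * (2 * 2 ^ K) *+ 2 = 6 * (2 * 2 ^ K)); last by ring.
rewrite (exprMn _ 6) le_eqVlt; apply/orP; left; apply/eqP.
have q0 : (2 * 2 ^ K : R) ^+ n != 0 by rewrite expf_neq0// mulf_neq0// gt_eqF.
have t0 : (6 : R) ^+ n != 0 by rewrite expf_neq0.
by field; rewrite q0 t0.
Qed.

Lemma restricted_gradient_lty : (\int[leb]_z (F z `^ P * 1 `^ (1 - P))%:E < +oo)%E.
Proof. by rewrite restricted_gradient_integral; exact: l1_gradient_powR_lty. Qed.

(** The telescoping chain of averages down to the point [z] is dominated by the
    pointwise function of the fractional bound, the change of centre by the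
    mass of the gradient over the largest cube. *)
Lemma oscillation_le (C : R) (Z : 'rV[R]_n -> \bar R) : 0 <= C ->
  (forall z (k : int) (J : nat),
    (((\sum_(j < J) frac_avg P Q F (lindex (k + j%:Z) z) `^ 1) `^ (Q / 1) * 1)%:E
      <= Z z)%E) ->
  (\int[leb]_z Z z <= (C * Phi `^ (Q / P))%:E)%E ->
  measurable_fun setT Z -> (forall z, (0 <= Z z)%E) ->
  (\int[leb]_(z in cball x (2 * 2 ^ K))
      (`|f z - bavg f x (2 * 2 ^ K)| `^ Q)%:E <=
    ((2 `^ Q * (6 ^+ n / 4) `^ Q + (4 * (3 ^+ n / 6)) `^ Q * C) * Phi `^ (Q / P))%:E)%E.
Proof.
move=> C0 HZ intZ mZ Z0; have [cf _ _] := C1f.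
have Q0 : 0 < Q by exact: lt_trans PQ.
have fa0 i : 0 <= frac_avg P Q F i by rewrite mulr_ge0 ?powR_ge0// mass_ge0.
set c := bavg f x (2 * 2 ^ K).
set T := 6 ^+ n / 4 * (Phi `^ P^-1 * lvol R L `^ (- Q^-1)).
have V0 := lvol_gt0 R L.
have c0 : 0 < 6 ^+ n / 4 :> R by rewrite divr_gt0// exprn_gt0.
have T0 : 0 <= T by rewrite mulr_ge0 ?(ltW c0)// mulr_ge0// powR_ge0.
set c1 : R := 3 ^+ n / 6.
have c10 : 0 < c1 by rewrite divr_gt0// exprn_gt0.
have ptw z : cball x (2 * 2 ^ K) z ->
    ((`|f z - c| `^ Q)%:E <= (2 `^ Q * T `^ Q)%:E + ((4 * c1) `^ Q)%:E * Z z)%E.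
  move=> zx; have := center_change zx; rewrite -/T -/c => HT.
  have [fT|fT] := lerP `|f z - c| (2 * T).
    rewrite -[leLHS]adde0 leeD//; last by rewrite mule_ge0// lee_fin powR_ge0.
    rewrite lee_fin -powRM// ge0_ler_powR ?nnegrE ?(ltW Q0)// mulr_ge0//.
  (* The tolerance is a quarter of the oscillation, so that it is absorbed on the
     left together with [T], which is at most half of it. *)
  have e0 : 0 < `|f z - c| / 4 by rewrite divr_gt0//; lra.
  have [J HJ] := chain_le zx e0.
  have := HZ z (K - J%:Z) J; rewrite divr1 mulr1.
  under eq_bigr do rewrite powRr1 ?fa0//.
  move=> HZz; set S := \sum_(j < J) _ in HZz HJ.
  have S0 : 0 <= S by apply: sumr_ge0 => j _; exact: fa0.
  have fS : `|f z - c| <= 4 * c1 * S.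
    have := ler_distD (bavg f z (2 ^ K)) (f z) c.
    have := T0; rewrite -/c1 in HJ; lra.
  rewrite -[leLHS]add0e leeD//; first by rewrite lee_fin mulr_ge0// powR_ge0.
  apply: le_trans (lee_pmul _ _ (lexx _) HZz); rewrite ?lee_fin ?powR_ge0//.
  rewrite -powRM//; last by rewrite mulr_ge0// ltW.
  by rewrite ge0_ler_powR ?nnegrE ?(ltW Q0)// mulr_ge0// mulr_ge0// ltW.
have mB := measurable_cball x (2 * 2 ^ K : R).
have mZB : measurable_fun (cball x (2 * 2 ^ K)) Z by exact: measurable_funTS.
apply: le_trans (ge0_le_integral _ mB _ _ _ ptw) _.
- by move=> z _; rewrite lee_fin powR_ge0.
- apply: measurable_funTS; apply: measurableT_comp => //.
  apply: measurableT_comp (measurable_powR _) _.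
  apply: measurableT_comp => //; apply: measurable_funB => //.
  exact: continuous_measurable_rV.
- apply: emeasurable_funD; first exact: measurable_cst.
  by apply: measurable_funeM.
rewrite ge0_integralD//; first last.
- by apply: measurable_funeM.
- by move=> z _; rewrite mule_ge0// lee_fin powR_ge0.
- by move=> z _; rewrite lee_fin mulr_ge0// powR_ge0.
rewrite ge0_integralZl//; last by rewrite lee_fin powR_ge0.
rewrite integral_cst// [X in (_ <= X%:E)%E]mulrDl EFinD; apply: leeD.
  have r0 : 0 <= 2 * 2 ^ K :> R by rewrite mulr_ge0// ltW.
  rewrite -[X in (_ * X)%E]/(leb _) lebesgue_cball// -EFinM lee_fin -!mulrA.
  rewrite ler_wpM2l ?powR_ge0//.
  have VK : (2 * 2 ^ K *+ 2) ^+ n <= lvol R L.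
    rewrite /lvol /lradius/= pow2S lerXn2r ?nnegrE ?mulrn_wge0//; have := pK; lra.
  apply: le_trans (ler_wpM2l (powR_ge0 _ _) VK) _.
  rewrite /T powRM ?(ltW c0)//; last by rewrite mulr_ge0 ?powR_ge0.
  rewrite powRM ?powR_ge0// -!powRrM mulNr mulVf ?gt_eqF// -mulrA -mulrA.
  rewrite powRN powRr1 ?(ltW V0)// mulVf ?gt_eqF// mulr1.
  by rewrite [P^-1 * _]mulrC.
rewrite -mulrA EFinM lee_pmul2l ?lte_fin ?powR_gt0 ?mulr_gt0//.
apply: le_trans intZ; exact: ge0_subset_integral.
Qed.

End local.
End chain.

(** Both sides scale alike because the exponents differ by exactly [1/n], so
    the fractional bound for the constant weight applies with equal weights. *)
Lemma sobolev_poincare (P Q : R) : 1 < P -> P < Q ->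
  P^-1 - Q^-1 = n%:R^-1 ->
  exists2 C : R, 0 <= C & forall f, C1 f -> forall x (K : int), exists c : R,
    (\int[leb]_(z in cball x (2 * 2 ^ K)) (`|f z - c| `^ Q)%:E <=
     (C * mass (fun z => l1_gradient f z `^ P) (lcube (R := R) (lindex (K + 1) x)) `^ (Q / P))%:E)%E.
Proof.
move=> P1 PQ PQn.
have [C C0 HC] := fractional_bound 1 n0 P1 PQ (ltr01 : 0 < 1 :> R).
exists (2 `^ Q * (6 ^+ n / 4) `^ Q + (4 * (3 ^+ n / 6)) `^ Q * C).
  by rewrite addr_ge0// mulr_ge0// powR_ge0.
move=> f C1f x K; exists (bavg f x (2 * 2 ^ K)).
pose F z : R := l1_gradient f z * \1_(lcube (R := R) (lindex (K + 1) x)) z.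
have F0 z : 0 <= F z by rewrite mulr_ge0// l1_gradient_ge0.
have mF : measurable_fun setT F.
  apply: measurable_funM; first exact: measurable_l1_gradient.
  by apply: measurable_indic; exact: measurable_lcube.
have [Z [mZ Z0 iZ HZ]] := HC _ _ F (muckenhoupt_pair_cst1 _) F0 mF
  (restricted_gradient_lty C1f P1 x K).
apply: oscillation_le C0 HZ _ mZ Z0 => //.
apply: le_trans iZ _; by rewrite restricted_gradient_integral// mass.unlock.
Qed.

End sobolev_poincare.

(** * Integrals of functions that need not be measurable *)

Section nonmeasurable_integrands.
Context d (T : measurableType d) (R : realType) (mu : {measure set T -> \bar R}).
Implicit Types f g : T -> \bar R.
Import HBNNSimple.

(** The integral of a nonnegative function is a supremum over simple functions
    below it, so it is monotone without any measurability: a simple function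
    below [f] is cut off on a null set. *)
Lemma nonneg_integral_le f g : (forall x, (0 <= f x)%E) -> (forall x, (0 <= g x)%E) ->
  {ae mu, forall x, (f x <= g x)%E} -> (\int[mu]_x f x <= \int[mu]_x g x)%E.
Proof.
move=> f0 g0 [N [mN N0 HN]]; rewrite !ge0_integralTE//.
apply: ge_ereal_sup => _ [h /= hf <-].
have mC : measurable (~` N) by exact: measurableC.
pose h' := proj_nnsfun h mC.
apply: (@le_trans _ _ (sintegral mu h')).
  rewrite -!integralT_nnsfun le_eqVlt; apply/orP; left; apply/eqP.
  apply: ge0_ae_eq_integral => //.
  - by apply/measurable_EFinP.
  - by apply/measurable_EFinP.
  - by move=> x _; rewrite lee_fin.
  - by move=> x _; rewrite lee_fin.
  exists N; split => // x /= H; apply: contrapT => Nx; apply: H => _.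
  by rewrite /h' /= mindicE mem_set//= mulr1.
apply: ereal_sup_ubound => /=; exists h' => // x.
rewrite /h' /= mindicE; have [xN|xN] := boolP (x \in ~` N); last first.
  by rewrite mulr0.
rewrite mulr1; apply: le_trans (hf x) _; apply: contrapT => H.
by move: xN; rewrite inE; apply; apply: HN.
Qed.

Lemma eq_integral_ae f g : {ae mu, forall x, f x = g x} ->
  (\int[mu]_x f x = \int[mu]_x g x)%E.
Proof.
move=> fg.
have H (u v : T -> \bar R) : (forall x, (0 <= u x)%E) -> (forall x, (0 <= v x)%E) ->
    {ae mu, forall x, u x = v x} -> (\int[mu]_x u x = \int[mu]_x v x)%E.
  move=> u0 v0 uv; apply/eqP; rewrite eq_le; apply/andP; split.
    by apply: nonneg_integral_le => //; apply: filterS uv => x ->.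
  by apply: nonneg_integral_le => //; apply: filterS uv => x ->.
rewrite integralE [RHS]integralE; congr (_ - _)%E; apply: H => //.
- by apply: filterS fg => x E; rewrite !funeposE E.
- by apply: filterS fg => x E; rewrite !funenegE E.
Qed.

Lemma eq_integral_in_ae (D : set T) f g : {ae mu, forall x, f x = g x} ->
  (\int[mu]_(x in D) f x = \int[mu]_(x in D) g x)%E.
Proof.
move=> fg; rewrite integral_mkcond [RHS]integral_mkcond.
apply: eq_integral_ae; apply: filterS fg => x E.
by rewrite /patch E.
Qed.

End nonmeasurable_integrands.

(** * Polar coordinates and cancellation of the kernel *)

Section polar.
Context (R : realType) (n : nat).
Local Notation leb := (@lebesgue_rV R n).
Local Notation sigma := (@sphere_measure R n).
Hypothesis n0 : (0 < n)%N.
Implicit Types (Phi : 'rV[R]_n -> R) (y : 'rV[R]_n).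

Definition annulus (a b : R) := [set y : 'rV[R]_n | a < enorm y <= b].

Lemma measurable_annulus a b : measurable (annulus a b).
Proof.
rewrite (_ : annulus a b = setT `&` (@enorm R n) @^-1` `]a, b]%classic).
  by apply: measurable_enorm => //; exact: measurable_itv.
by rewrite setTI; apply/seteqP; split => x /=; rewrite in_itv.
Qed.

Lemma coord_le_enorm y i : `|y ord0 i| <= enorm y.
Proof.
rewrite -sqrtr_sqr /enorm ler_wsqrtr// (bigD1 i)//= lerDl.
by apply: sumr_ge0 => j _; exact: sqr_ge0.
Qed.

Lemma direction_scale (b : R) y : 0 < b -> direction (b *: y) = direction y.
Proof.
move=> b0; rewrite /direction enormZ ?(ltW b0)// invfM scalerA.
by rewrite mulrAC mulVf ?gt_eqF// mul1r.
Qed.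

Lemma measurable_comp_direction Phi : measurable_fun setT Phi ->
  measurable_fun setT (Phi \o @direction R n).
Proof. by move=> mPhi; apply: measurableT_comp mPhi (@measurable_direction R n). Qed.

(** The cone over a spherical set meets the punctured ball in its preimage by
    the radial retraction, extended by [0] outside the ball; the value [0] lies
    off the sphere, so the surface measure is [n] times the image measure. *)
Lemma ge0_integral_sphere Phi : (forall t, 0 <= Phi t) -> measurable_fun setT Phi ->
  (\int[sigma]_t (Phi t)%:E =
   n%:R%:E * \int[leb]_(y in annulus 0 1) (Phi (direction y))%:E)%E.
Proof.
move=> P0 mP.
pose S := [set t : 'rV[R]_n | enorm t = 1].
pose phi y : 'rV[R]_n := (\1_(annulus 0 1) y : R) *: direction y.
have mphi : measurable_fun setT phi.
  apply: measurable_fun_rV => i; rewrite /phi.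
  under eq_fun do rewrite mxE.
  apply: measurable_funM; first by apply: measurable_indic; exact: measurable_annulus.
  exact: measurableT_comp (measurable_rV_coord i) (@measurable_direction R n).
have mS : measurable S.
  rewrite (_ : S = setT `&` (@enorm R n) @^-1` [set 1]).
    by apply: measurable_enorm => //; exact: measurable_set1.
  by rewrite setTI.
have e00 : enorm (0 : 'rV[R]_n) = 0.
  by rewrite /enorm big1 ?sqrtr0// => i _; rewrite mxE expr0n.
have phiE y : S (phi y) <-> annulus 0 1 y.
  rewrite /S /phi /= indicE; have [yA|yA] := boolP (y \in annulus 0 1).
    have Ay : annulus 0 1 y by rewrite inE in yA.
    by rewrite scale1r enorm_direction//; case/andP: Ay.
  rewrite scale0r e00; split => [/eqP|Ay]; first by rewrite eq_sym oner_eq0.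
  by rewrite mem_set in yA.
have nn0 : 0 <= n%:R :> R by [].
have mEP : measurable_fun setT (EFin \o Phi) by exact/measurable_EFinP.
transitivity (\int[sigma]_(t in S) (Phi t)%:E)%E.
  rewrite [RHS]integral_mkcond; apply: eq_integral_ae.
  exists (~` S); split; first exact: measurableC.
    rewrite -[RHS](@sphere_measureC R n); congr (_ _).
    by apply/seteqP; split => x /= /eqP.
  by move=> t /= H St; apply: H; rewrite patchE mem_set.
rewrite (@eq_measure_integral _ _ _ S (mscale (NngNum nn0) (pushforward leb phi))); last first.
  move=> A mA AS; rewrite /= /mscale /= /sphere_measure.
  congr (_ * leb _)%E; apply/seteqP; split => y /=.
    move=> [Ay Dy]; rewrite /phi indicE mem_set ?scale1r//.
  move=> Ay; have /phiE Hy := AS _ Ay; split => //.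
  by move: Ay; rewrite /phi indicE mem_set ?scale1r.
rewrite ge0_integral_mscale//; first last.
- by move=> t _; rewrite lee_fin.
- exact: measurable_funTS.
congr (_ * _)%E; rewrite ge0_integral_pushforward//; first last.
- by move=> t _; rewrite lee_fin.
- exact: measurable_funTS.
rewrite (_ : phi @^-1` S = annulus 0 1); last first.
  by apply/seteqP; split => y /phiE.
apply: eq_integral => y yA /=; rewrite /phi indicE yA scale1r//.
Qed.

(** Dilation by [b] maps the unit punctured ball onto that of radius [b] and
    preserves directions. *)
Lemma integral_cone Phi (b : R) : 0 < b ->
  (forall t, 0 <= Phi t) -> measurable_fun setT Phi ->
  (\int[leb]_(y in annulus 0 b) (Phi (direction y))%:E =
   (b ^+ n / n%:R)%:E * \int[sigma]_t (Phi t)%:E)%E.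
Proof.
move=> b0 P0 mP; rewrite ge0_integral_sphere// muleA -EFinM.
have nn0 : n%:R != 0 :> R by rewrite pnatr_eq0 -lt0n.
rewrite mulfVK//.
rewrite integral_in_indic (integral_in_indic _ (annulus 0 1)).
have := @ge0_integral_rV_affine R n b 0
  (fun y => (Phi (direction y) * \1_(annulus 0 b) y)%:E).
rewrite gt_eqF//= => H.
under [in RHS]eq_integral => y _.
  rewrite (_ : _ * _ = Phi (direction (0 + b *: y)) * \1_(annulus 0 b) (0 + b *: y)); last first.
    rewrite add0r direction_scale//; congr (_ * _).
    rewrite !indicE; congr (_%:R); congr nat_of_bool; apply/idP/idP; rewrite !inE/=;
      rewrite /annulus/= enormZ ?(ltW b0)// pmulr_rgt0// -ler_pdivlMl// mulrC divff ?gt_eqF//.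
  over.
rewrite H//; first last.
- by move=> y; rewrite lee_fin mulr_ge0.
- apply/measurable_EFinP; apply: measurable_funM; first exact: measurable_comp_direction.
  by apply: measurable_indic; exact: measurable_annulus.
rewrite gtr0_norm// muleA -EFinM mulfV ?mul1e// expf_neq0// gt_eqF//.
Qed.

Section cancellation.
Variables Phi1 Phi2 : 'rV[R]_n -> R.
Hypotheses (P10 : forall t, 0 <= Phi1 t) (P20 : forall t, 0 <= Phi2 t).
Hypotheses (mP1 : measurable_fun setT Phi1) (mP2 : measurable_fun setT Phi2).
Hypothesis P12 : (\int[sigma]_t (Phi1 t)%:E = \int[sigma]_t (Phi2 t)%:E)%E.
Hypothesis Poo : (\int[sigma]_t (Phi1 t)%:E < +oo)%E.

Let annulus_split (a c : R) : 0 < a -> a <= c ->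
  annulus 0 c = annulus 0 a `|` annulus a c.
Proof.
move=> a0 ac; apply/seteqP; split => y /=; rewrite /annulus /=.
  move=> /andP[y0 yc]; have [ya|ya] := lerP (enorm y) a; [left|right];
  by rewrite ?y0 ?ya.
move=> [/andP[y0 ya]|/andP[ya yc]]; first by rewrite y0 (le_trans ya).
by rewrite yc (lt_trans a0).
Qed.

Let split_integral Phi (a c : R) : (forall t, 0 <= Phi t) -> measurable_fun setT Phi ->
  0 < a -> a <= c ->
  (\int[leb]_(y in annulus 0 c) (Phi (direction y))%:E =
   \int[leb]_(y in annulus 0 a) (Phi (direction y))%:E +
   \int[leb]_(y in annulus a c) (Phi (direction y))%:E)%E.
Proof.
move=> P0 mP a0 ac; rewrite (annulus_split a0 ac) ge0_integral_setU//.
- exact: measurable_annulus.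
- exact: measurable_annulus.
- apply: measurable_funTS; apply/measurable_EFinP; exact: measurable_comp_direction.
- by move=> y _; rewrite lee_fin.
- apply/disj_setPS => y [/= /andP[_ ya] /andP[ay _]].
  by move: (lt_le_trans ay ya); rewrite ltxx.
Qed.

Lemma eq_integral_annulus (a c : R) : 0 < a ->
  (\int[leb]_(y in annulus a c) (Phi1 (direction y))%:E =
   \int[leb]_(y in annulus a c) (Phi2 (direction y))%:E)%E.
Proof.
move=> a0; have [ac|ca] := lerP a c; last first.
  rewrite (_ : annulus a c = set0) ?integral_set0//.
  apply/seteqP; split => y //= /andP[ay yc].
  by move: (lt_le_trans ay yc); rewrite ltNge ltW.
have c0 := lt_le_trans a0 ac.
have := split_integral P20 mP2 a0 ac; have := split_integral P10 mP1 a0 ac.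
rewrite !integral_cone// -P12 => -> E.
set u := (_ * _)%E in E; have fu : u \is a fin_num.
  rewrite fin_numM// ge0_fin_numE// integral_ge0// => t _.
  by rewrite lee_fin.
by have := congr1 (fun v => v - u)%E E; rewrite ![(u + _)%E]addeC !addeK.
Qed.

(** Writing [|y|^-n] as the length of [{t : 0 < t <= |y|^-n}] turns the weighted
    integral into an integral over [t] of unweighted integrals over annuli,
    each of which only depends on the spherical mean. *)
Let layer_cake Phi (a b : R) : (forall t, 0 <= Phi t) -> measurable_fun setT Phi ->
  0 < a ->
  (\int[leb]_(y in annulus a b) (Phi (direction y) / enorm y ^+ n)%:E =
   \int[@lebesgue_measure R]_t (if (0 < t :> R)%R then
     \int[leb]_(y in annulus a (Num.min b (t^-1 `^ n%:R^-1))%R) (Phi (direction y))%:E else 0)%E)%E.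
Proof.
move=> P0 mP a0; rewrite integral_in_indic.
pose S := [set z : 'rV[R]_n * R | 0 < z.2 /\ z.2 * enorm z.1 ^+ n <= 1].
have mS : measurable S.
  have m2 : measurable_fun setT (fun z : 'rV[R]_n * R => z.2) by exact: measurable_snd.
  have m1 : measurable_fun setT (fun z : 'rV[R]_n * R => z.2 * enorm z.1 ^+ n).
    apply: measurable_funM => //; apply: measurable_funX.
    exact: measurableT_comp (@measurable_enorm R n) measurable_fst.
  rewrite (_ : S = [set z | 0 < z.2] `&` ~` [set z | 1 < z.2 * enorm z.1 ^+ n]).
    apply: measurableI; first exact: measurable_superlevel.
    by apply: measurableC; exact: measurable_superlevel.
  apply/seteqP; split => z /= [z0 z1]; split => //.
    by apply/negP; rewrite -leNgt.
  by rewrite leNgt; apply/negP.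
pose g (z : 'rV[R]_n * R) := (Phi (direction z.1) * \1_(annulus a b) z.1 * \1_S z)%:E.
have mg : measurable_fun setT g.
  apply/measurable_EFinP; apply: measurable_funM; last exact: measurable_indic.
  apply: (@measurableT_comp _ _ _ _ _ _ (fun y => Phi (direction y) * \1_(annulus a b) y)
    _ fst); last exact: measurable_fst.
  apply: measurable_funM; first exact: measurable_comp_direction.
  by apply: measurable_indic; exact: measurable_annulus.
have g0 z : (0 <= g z)%E by rewrite lee_fin !mulr_ge0.
transitivity (\int[leb]_y \int[@lebesgue_measure R]_t g (y, t))%E.
  apply: eq_integral => y _; rewrite /g /=.
  under eq_integral do rewrite EFinM.
  rewrite ge0_integralZl//; first last.
  - by rewrite lee_fin mulr_ge0.
  - apply/measurable_EFinP; apply: (@measurableT_comp _ _ _ _ _ _ (\1_S : _ -> R)).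
      exact: measurable_indic.
    exact: measurable_pair1.
  have [yA|yA] := boolP (y \in annulus a b); last first.
    by rewrite indicE (negbTE yA) !mulr0 mul0e.
  have /andP[ay yb] : annulus a b y by rewrite inE in yA.
  have y0 : 0 < enorm y ^+ n by rewrite exprn_gt0// (lt_trans a0).
  rewrite (_ : (\int[_]_t _)%E = ((enorm y ^+ n)^-1)%:E).
    by rewrite -EFinM; congr EFin; ring.
  rewrite (_ : (fun t => _) = (fun t => (\1_(`]0%R, (enorm y ^+ n)^-1]%classic) t)%:E)).
    rewrite integral_indic// setIT -[LHS]/(@lebesgue_measure R _) lebesgue_measure_itv/= lte_fin invr_gt0 y0.
    by rewrite oppr0 adde0.
  apply/funext => t; rewrite !indicE; congr (_%:R%:E); congr nat_of_bool.
  apply/idP/idP; rewrite !inE /S /= in_itv/= -ler_pdivlMr// div1r.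
    by move=> [-> ->].
  by move=> /andP.
rewrite fubini_tonelli//.
apply: eq_integral => t _; case: ifPn => t0; last first.
  apply: integral0_eq => y _; rewrite /g [X in _ * X]indicE memNset ?mulr0//.
  by move=> [/= t0' _]; rewrite t0' in t0.
rewrite [RHS]integral_in_indic; apply: eq_integral => y _; rewrite /g /= -mulrA; congr (_ * _)%:E.
rewrite !indicE -natrM mulnb; congr (_%:R); congr nat_of_bool.
have tn : ((t^-1 `^ n%:R^-1) ^+ n = t^-1).
  rewrite -powR_mulrn ?powR_ge0// -powRrM mulVf ?powRr1 ?invr_ge0 ?(ltW t0)//.
  by rewrite pnatr_eq0 -lt0n.
have yE : (t * enorm y ^+ n <= 1) = (enorm y <= t^-1 `^ n%:R^-1).
  rewrite -ler_pdivlMl// mulr1 -{1}tn ler_pXn2r// nnegrE ?powR_ge0//.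
  exact: sqrtr_ge0.
apply/andP/idP; rewrite !inE /annulus /S /= yE le_min.
  by move=> [/andP[-> ->] [_ ->]].
by move=> /and3P[-> -> ->].
Qed.

Lemma eq_integral_kernel (a b : R) : 0 < a ->
  (\int[leb]_(y in annulus a b) (Phi1 (direction y) / enorm y ^+ n)%:E =
   \int[leb]_(y in annulus a b) (Phi2 (direction y) / enorm y ^+ n)%:E)%E.
Proof.
move=> a0; rewrite !layer_cake//; apply: eq_integral => t _.
by case: ifP => // _; exact: eq_integral_annulus.
Qed.

End cancellation.

End polar.

Section kernel.
Context (R : realType) (n : nat).
Local Notation leb := (@lebesgue_rV R n).
Local Notation sigma := (@sphere_measure R n).
Hypothesis n0 : (0 < n)%N.

Lemma annulus_sub_cball (a b : R) : @annulus R n a b `<=` cball 0 b.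
Proof.
move=> y /= /andP[_ yb] i; rewrite mxE subr0; exact: le_trans (coord_le_enorm y i) yb.
Qed.

Lemma sphere_measure_lty : (sigma setT < +oo)%E.
Proof.
rewrite /sphere_measure; apply: lte_mul_pinfty => //.
apply: le_lt_trans (lebesgue_cball_lty 0 1).
apply: le_measure; rewrite ?inE; [|exact: measurable_cball|].
  rewrite (_ : mkset _ = annulus 0 1); first exact: measurable_annulus.
  by apply/seteqP; split => y //= [].
by move=> y /= [+ _]; apply: annulus_sub_cball.
Qed.

Lemma sphere_Lrho_L1 (h : 'rV[R]_n -> R) (rho : R) : 1 < rho -> measurable_fun setT h ->
  (\int[sigma]_t (`|h t| `^ rho)%:E < +oo)%E -> (\int[sigma]_t (`|h t|)%:E < +oo)%E.
Proof.
move=> r1 mh hoo.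
have mabs : measurable_fun setT (fun t => `|h t|) by exact: measurableT_comp.
have mpow : measurable_fun setT (fun t => `|h t| `^ rho).
  exact: measurableT_comp (measurable_powR _) mabs.
apply: (@le_lt_trans _ _ (\int[sigma]_t ((1%:E + (`|h t| `^ rho)%:E))%E)%E).
  apply: ge0_le_integral => //.
  - exact/measurable_EFinP.
  - by apply: emeasurable_funD; [exact: measurable_cst|exact/measurable_EFinP].
  move=> t _; rewrite -EFinD lee_fin; have [h1|h1] := lerP `|h t| 1.
    by rewrite (le_trans h1)// lerDl powR_ge0.
  rewrite (@le_trans _ _ (`|h t| `^ rho))// ?lerDr//.
  by rewrite -{1}[`|h t|]powRr1// ler_powR// ltW.
rewrite ge0_integralD//; [|exact/measurable_EFinP].
rewrite lte_add_pinfty// integral_cst// mul1e.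
exact: sphere_measure_lty.
Qed.

(** The cone over a spherical null set is a countable union of truncated cones,
    each null by [integral_cone]. *)
Lemma ae_direction (g h : 'rV[R]_n -> R) : {ae sigma, forall t, g t = h t} ->
  {ae leb, forall y, 0 < enorm y -> g (direction y) = h (direction y)}.
Proof.
move=> [N [mN N0 HN]].
pose D (k : nat) := annulus 0 k.+1%:R `&` (@direction R n) @^-1` N.
have mdN : measurable ((@direction R n) @^-1` N).
  by rewrite -[X in measurable X]setTI; exact: measurable_direction.
have mD k : measurable (D k).
  by apply: measurableI => //; exact: measurable_annulus.
suff : leb.-negligible (\bigcup_k D k).
  apply: negligibleS => y /= /not_implyP[y0 H].
  exists (Num.truncn (enorm y)) => //; split.
    by rewrite /= /annulus/= y0 ltW// truncnS_gt.
  exact: HN.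
apply: negligible_bigcup => k; apply/negligibleP => //.
have N1 t : 0 <= \1_N t :> R by [].
have mI : measurable_fun setT (\1_N : 'rV[R]_n -> R) by exact: measurable_indic.
have := integral_cone n0 (ltr0Sn R k) N1 mI.
rewrite [X in (_ * X)%E]integral_indic// setIT -[X in (_ * X)%E]/(sigma N) N0 mule0 => <-.
transitivity (\int[leb]_y (\1_(D k) y)%:E)%E; first by rewrite integral_indic// setIT.
rewrite [RHS]integral_in_indic.
apply: eq_integral => y _; rewrite !indicE -natrM mulnb; congr (_%:R%:E).
by rewrite /D in_setI andbC; congr (nat_of_bool (_ && _)); apply/idP/idP; rewrite !inE.
Qed.

Definition rough_kernel (h : 'rV[R]_n -> R) (y : 'rV[R]_n) := h (direction y) / enorm y ^+ n.

Section cancellation.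
Variable h : 'rV[R]_n -> R.
Hypothesis mh : measurable_fun setT h.
Hypothesis h1 : (\int[sigma]_t (`|h t|)%:E < +oo)%E.


Lemma measurable_rough_kernel : measurable_fun setT (rough_kernel h).
Proof.
apply: measurable_funM; first exact: measurable_comp_direction.
rewrite (_ : (fun x => _) = (fun x => (enorm x ^+ n) `^ (-1))); last first.
  by apply/funext => x; rewrite powR_inv1// exprn_ge0// enorm_ge0.
apply: measurableT_comp (measurable_powR _) _; apply: measurable_funX.
exact: measurable_enorm.
Qed.

Lemma integrable_rough_kernel (a b : R) : 0 < a ->
  leb.-integrable (annulus a b) (EFin \o rough_kernel h).
Proof.
move=> a0; have mA : measurable (annulus a b : set 'rV[R]_n) by exact: measurable_annulus.
have [ab|ba] := lerP a b; last first.
  rewrite (_ : annulus a b = set0); last first.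
    apply/seteqP; split => y //= /andP[ay yb].
    by move: (lt_le_trans ay yb); rewrite ltNge ltW.
  exact: integrable_set0.
have b0 := lt_le_trans a0 ab.
apply/integrableP; split.
  by apply/measurable_EFinP; apply: measurable_funTS; exact: measurable_rough_kernel.
apply: (@le_lt_trans _ _ (((a ^+ n)^-1)%:E * \int[leb]_(y in annulus 0 b) (`|h (direction y)|)%:E)%E).
  have mhd : measurable_fun setT (fun y => `|h (direction y)|).
    by apply: measurableT_comp => //; exact: measurable_comp_direction.
  apply: (@le_trans _ _ (\int[leb]_(y in annulus a b) (((a ^+ n)^-1)%:E * (`|h (direction y)|)%:E))%E).
    apply: ge0_le_integral => //.
    - apply/measurable_EFinP; apply: measurable_funTS; apply: measurableT_comp => //.
      exact: measurable_rough_kernel.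
    - apply: measurable_funeM; apply/measurable_EFinP; exact: measurable_funTS.
    move=> y /= /andP[ay _]; rewrite -EFinM lee_fin normrM mulrC ler_wpM2r//.
    have y0 := lt_trans a0 ay.
    rewrite normfV (ger0_norm (exprn_ge0 _ (enorm_ge0 _))) lef_pV2 ?posrE ?exprn_gt0//.
    by rewrite lerXn2r ?nnegrE ?ltW.
  rewrite ge0_integralZl//; first last.
  - by rewrite lee_fin invr_ge0 exprn_ge0// ltW.
  - by apply/measurable_EFinP; exact: measurable_funTS.
  rewrite lee_pmul2l ?lte_fin ?invr_gt0 ?exprn_gt0//.
  apply: ge0_subset_integral => //; first exact: measurable_annulus.
  - by apply/measurable_EFinP; exact: measurable_funTS.
  - by move=> y /= /andP[ay yb]; rewrite /annulus/= yb (lt_trans a0 ay).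
rewrite (@integral_cone R n n0 (fun t => `|h t|))//; last exact: measurableT_comp.
by rewrite muleA lte_mul_pinfty// -EFinM lee_fin mulr_ge0 ?invr_ge0 ?divr_ge0 ?exprn_ge0// ltW.
Qed.

(** Positive and negative parts have the same spherical mean, hence the same
    integrals against the kernel. *)
Lemma kernel_cancellation (a b : R) : 0 < a ->
  (\int[sigma]_t (h t)%:E = 0)%E ->
  (\int[leb]_(y in annulus a b) (rough_kernel h y)%:E = 0)%E.
Proof.
move=> a0 hmean.
pose hp t := Num.max (h t) 0; pose hn t := Num.max (- h t) 0.
have mhp : measurable_fun setT hp by exact: measurable_maxr.
have mhn : measurable_fun setT hn.
  by apply: measurable_maxr => //; exact: measurableT_comp.
have hp0 t : 0 <= hp t by rewrite le_max lexx orbT.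
have hn0 t : 0 <= hn t by rewrite le_max lexx orbT.
have hple t : hp t <= `|h t| by rewrite ge_max ler_norm normr_ge0.
have hpoo : (\int[sigma]_t (hp t)%:E < +oo)%E.
  apply: le_lt_trans h1; apply: ge0_le_integralE => //.
  exact: measurableT_comp.
have hnoo : (\int[sigma]_t (hn t)%:E < +oo)%E.
  apply: le_lt_trans h1; apply: ge0_le_integralE => //.
    exact: measurableT_comp.
  by move=> t; rewrite ge_max normr_ge0 -normrN ler_norm.
have mean : (\int[sigma]_t (hp t)%:E = \int[sigma]_t (hn t)%:E)%E.
  move: hmean; rewrite integralE.
  rewrite [X in (X - _)%E](_ : _ = \int[sigma]_t (hp t)%:E)%E; last first.
    by apply: eq_integral => t _; rewrite funeposE -EFin_max.
  rewrite [X in (_ - X)%E](_ : _ = \int[sigma]_t (hn t)%:E)%E; last first.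
    by apply: eq_integral => t _; rewrite funenegE -EFinN -EFin_max.
  move=> /eqP; rewrite sube_eq ?add0e; first by move/eqP.
    by rewrite ge0_fin_numE// integral_ge0// => t _; rewrite lee_fin.
  by rewrite fin_num_adde_defr// fin_numN ge0_fin_numE// integral_ge0// => t _; rewrite lee_fin.
have K0 (y : 'rV[R]_n) : 0 <= (enorm y ^+ n)^-1 by rewrite invr_ge0 exprn_ge0// enorm_ge0.
have E := eq_integral_kernel n0 hp0 hn0 mhp mhn mean hpoo b a0.
have fin := integrable_pos_fin_num (measurable_annulus a b) (integrable_rough_kernel b a0).
rewrite integralE; move: fin.
rewrite (_ : (\int[leb]_(y in annulus a b) _)%E =
  (\int[leb]_(y in annulus a b) (hp (direction y) / enorm y ^+ n)%:E)%E); last first.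
  apply: eq_integral => y _; rewrite funeposE -EFin_max; congr EFin.
  by rewrite /hp /rough_kernel maxr_pMl// mul0r.
rewrite [X in (_ - X)%E](_ : _ =
  (\int[leb]_(y in annulus a b) (hn (direction y) / enorm y ^+ n)%:E)%E); last first.
  apply: eq_integral => y _; rewrite funenegE -EFinN -EFin_max; congr EFin.
  by rewrite /hn /rough_kernel maxr_pMl// mul0r mulNr.
by move=> fin; rewrite -E subee.
Qed.

End cancellation.
End kernel.

(** * The contribution of one annulus *)

Section annulus_bound.
Context (R : realType) (n : nat).
Local Notation leb := (@lebesgue_rV R n).
Local Notation sigma := (@sphere_measure R n).
Hypothesis n0 : (0 < n)%N.
Variables (rho P Q : R).
Hypotheses (rho1 : 1 < rho) (P1 : 1 < P) (PQ : P < Q).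
Hypotheses (PQn : P^-1 - Q^-1 = n%:R^-1) (rhoQ : rho^-1 + Q^-1 = 1).

Let Q0 : 0 < Q. Proof. by rewrite (lt_trans _ PQ)// (lt_trans _ P1). Qed.
Let P0 : 0 < P. Proof. by rewrite (lt_trans _ P1). Qed.
Let rho0 : 0 < rho. Proof. by rewrite (lt_trans _ rho1). Qed.

Lemma measurable_reflection (f : 'rV[R]_n -> R) (x : 'rV[R]_n) : continuous f ->
  measurable_fun setT (fun y : 'rV[R]_n => f (x - y)).
Proof.
move=> cf; rewrite (_ : (fun y => _) = f \o (fun y => x + (-1) *: y)); last first.
  by apply/funext => y /=; rewrite scaleN1r.
apply: measurableT_comp; first exact: continuous_measurable_rV.
exact: measurable_affine.
Qed.

Section bound.
Variables (h f : 'rV[R]_n -> R) (x : 'rV[R]_n) (k : int) (a b c M : R).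
Hypotheses (mh : measurable_fun setT h) (cf : continuous f).
Hypothesis hoo : (\int[sigma]_t (`|h t| `^ rho)%:E < +oo)%E.
Hypotheses (ka : 2 ^ k <= a) (bk : b <= 2 * 2 ^ k).
Hypothesis fc : (\int[leb]_(z in cball x (2 * 2 ^ k)) (`|f z - c| `^ Q)%:E <= M%:E)%E.
Hypothesis M0 : 0 <= M.

Let N := fine (\int[sigma]_t (`|h t| `^ rho)%:E).
Let u (y : 'rV[R]_n) := `|h (direction y)| `^ rho * \1_(annulus a b) y.
Let v (y : 'rV[R]_n) := `|f (x - y) - c| `^ Q * \1_(annulus a b) y.

Let u0 y : 0 <= u y. Proof. by rewrite mulr_ge0// powR_ge0. Qed.
Let v0 y : 0 <= v y. Proof. by rewrite mulr_ge0// powR_ge0. Qed.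
Let m1 : measurable_fun setT (\1_(annulus a b) : 'rV[R]_n -> R).
Proof. by apply: measurable_indic; exact: measurable_annulus. Qed.
Let mabs : measurable_fun setT (fun t => `|h t| `^ rho).
Proof. by apply: measurableT_comp (measurable_powR _) _; exact: measurableT_comp. Qed.
Let mu_ : measurable_fun setT u.
Proof.
apply: measurable_funM => //.
exact: (@measurable_comp_direction _ _ (fun t => `|h t| `^ rho)).
Qed.
Let mfx : measurable_fun setT (fun y : 'rV[R]_n => f (x - y)).
Proof. exact: measurable_reflection. Qed.
Let mv : measurable_fun setT v.
Proof.
apply: measurable_funM => //; apply: measurableT_comp (measurable_powR _) _.
by apply: measurableT_comp => //; exact: measurable_funB.
Qed.

Let int_u : (\int[leb]_y (u y)%:E <= ((2 * 2 ^ k) ^+ n / n%:R * N)%:E)%E.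
Proof.
have p0 : 0 < 2 * 2 ^ k :> R by rewrite mulr_gt0// pow2_gt0.
have -> : ((2 * 2 ^ k) ^+ n / n%:R * N)%:E =
    (\int[leb]_(y in annulus 0 (2 * 2 ^ k)) (`|h (direction y)| `^ rho)%:E)%E.
  rewrite (@integral_cone R n n0 (fun t => `|h t| `^ rho))//.
  rewrite EFinM fineK// ge0_fin_numE//; apply: integral_ge0 => t _.
  by rewrite lee_fin powR_ge0.
rewrite /u -integral_in_indic; apply: ge0_subset_integral.
- exact: measurable_annulus.
- exact: measurable_annulus.
- apply/measurable_EFinP; apply: measurable_funTS.
  exact: (@measurable_comp_direction _ _ (fun t => `|h t| `^ rho)).
- by move=> y _; rewrite lee_fin powR_ge0.
move=> y /= /andP[ay yb]; rewrite /annulus/= (le_trans yb bk) andbT.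
by apply: lt_trans ay; apply: lt_le_trans ka; exact: pow2_gt0.
Qed.

Let int_v : (\int[leb]_y (v y)%:E <= M%:E)%E.
Proof.
apply: le_trans fc; rewrite [leRHS]integral_in_indic.
pose g z := `|f z - c| `^ Q * \1_(cball x (2 * 2 ^ k)) z.
have mg : measurable_fun setT g.
  apply: measurable_funM; last by apply: measurable_indic; exact: measurable_cball.
  apply: measurableT_comp (measurable_powR _) _; apply: measurableT_comp => //.
  by apply: measurable_funB => //; exact: continuous_measurable_rV.
have g0 z : 0 <= g z by rewrite mulr_ge0// powR_ge0.
have := @ge0_integral_rV_affine R n (-1) x (EFin \o g).
rewrite normrN1 expr1n invr1 mul1e => <-//; first last.
- exact/measurable_EFinP.
apply: ge0_le_integralE => //.
  by apply: measurableT_comp mg _; exact: measurable_affine.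
move=> y; rewrite /v /g scaleN1r ler_wpM2l ?powR_ge0// !indicE ler_nat.
have [yA|//] := boolP (y \in annulus a b).
suff H : cball x (2 * 2 ^ k) (x - y) by rewrite mem_set.
move=> i; rewrite !mxE addrAC subrr add0r normrN.
have /andP[_ yb] : annulus a b y by rewrite inE in yA.
apply: le_trans (coord_le_enorm y i) _; exact: le_trans bk.
Qed.

Let kernel_le y : annulus a b y ->
  `|rough_kernel h y * (f (x - y) - c)| <= (2 ^ k) ^- n * (u y `^ rho^-1 * v y `^ Q^-1).
Proof.
move=> yA; have /andP[ay yb] := yA; have k0 := pow2_gt0 R k.
have ky : 2 ^ k < enorm y by exact: le_lt_trans ay.
rewrite /u /v indicE mem_set// !mulr1 -!powR_root// /rough_kernel !normrM normfV.
rewrite (ger0_norm (exprn_ge0 _ (enorm_ge0 _))) mulrAC mulrC.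
rewrite ler_wpM2r ?mulr_ge0// lef_pV2 ?posrE ?exprn_gt0// ?(lt_trans k0)//.
by rewrite lerXn2r ?nnegrE ?(ltW k0) ?enorm_ge0// ltW.
Qed.

Lemma annulus_hoelder :
  (\int[leb]_(y in annulus a b) `|(rough_kernel h y * (f (x - y) - c))%:E| <=
    ((2 ^ k) ^- n * ((((2 * 2 ^ k) ^+ n / n%:R * N) `^ rho^-1) * M `^ Q^-1))%:E)%E.
Proof.
have k0 := pow2_gt0 R k.
have mA : measurable (annulus a b : set 'rV[R]_n) by exact: measurable_annulus.
have mw : measurable_fun setT (fun y : 'rV[R]_n => u y `^ rho^-1 * v y `^ Q^-1).
  by apply: measurable_funM; apply: measurableT_comp (measurable_powR _) _.
have mk := measurable_rough_kernel mh.
have mKf : measurable_fun setT (fun y : 'rV[R]_n => rough_kernel h y * (f (x - y) - c)).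
  by apply: measurable_funM => //; exact: measurable_funB.
apply: (@le_trans _ _ (\int[leb]_(y in annulus a b)
   ((2 ^ k) ^- n * (u y `^ rho^-1 * v y `^ Q^-1))%:E)%E).
  apply: ge0_le_integral => //.
  - by apply: measurable_funTS; apply: measurableT_comp => //; exact/measurable_EFinP.
  - apply: measurable_funTS; apply/measurable_EFinP; exact: measurable_funM.
apply: (@le_trans _ _ (\int[leb]_y
   ((2 ^ k) ^- n * (u y `^ rho^-1 * v y `^ Q^-1))%:E)%E).
  apply: ge0_subset_integral => //.
  - by apply/measurable_EFinP; exact: measurable_funM.
  - by move=> y _; rewrite lee_fin !mulr_ge0 ?powR_ge0// invr_ge0 exprn_ge0// ltW.
rewrite ge0_integralZlE//; first last.
- by move=> y; rewrite mulr_ge0 ?powR_ge0.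
- by rewrite invr_ge0 exprn_ge0// ltW.
rewrite EFinM lee_pmul2l ?lte_fin ?invr_gt0 ?exprn_gt0//.
have rQ : rho^-1 = 1 - Q^-1 by rewrite -rhoQ addrK.
have Q01 : 0 < Q^-1 < 1.
  by rewrite invr_gt0 Q0 -rhoQ ltrDr invr_gt0 rho0.
rewrite rQ; apply: le_trans (hoelder_ge0 leb Q01 mu_ mv u0 v0) _.
rewrite EFinM; apply: lee_pmul; rewrite ?poweR_ge0// -poweR_EFin.
  apply: gt0_ler_poweR int_u; rewrite ?in_itv/= ?leey ?andbT.
  - by rewrite subr_ge0; case/andP: Q01 => _ /ltW.
  - by apply: integral_ge0 => y _; rewrite lee_fin.
  - by apply: le_trans int_u; apply: integral_ge0 => y _; rewrite lee_fin.
apply: gt0_ler_poweR int_v; rewrite ?in_itv/= ?leey ?andbT ?lee_fin//.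
  by rewrite invr_ge0 ltW.
by apply: integral_ge0 => y _; rewrite lee_fin.
Qed.

(** The constant [c] is free because the kernel has integral zero over the
    annulus. *)
Lemma annulus_integral : (\int[sigma]_t (h t)%:E = 0)%E ->
  (`|\int[leb]_(y in annulus a b) (rough_kernel h y * f (x - y))%:E| <=
    ((2 ^ k) ^- n * ((((2 * 2 ^ k) ^+ n / n%:R * N) `^ rho^-1) * M `^ Q^-1))%:E)%E.
Proof.
move=> hmean; have a0 : 0 < a by apply: lt_le_trans ka; exact: pow2_gt0.
have mA : measurable (annulus a b : set 'rV[R]_n) by exact: measurable_annulus.
have h1 := sphere_Lrho_L1 rho1 mh hoo.
have ik := integrable_rough_kernel n0 mh h1 b a0.
have ikc : leb.-integrable (annulus a b) (fun y : 'rV[R]_n => (c%:E * (rough_kernel h y)%:E)%E).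
  exact: integrableZl.
have mk := measurable_rough_kernel mh.
have mKf : measurable_fun setT (fun y : 'rV[R]_n => rough_kernel h y * (f (x - y) - c)).
  by apply: measurable_funM => //; exact: measurable_funB.
have ikf : leb.-integrable (annulus a b) (fun y : 'rV[R]_n => (rough_kernel h y * (f (x - y) - c))%:E).
  apply/integrableP; split; first by apply/measurable_EFinP; exact: measurable_funTS.
  by apply: le_lt_trans annulus_hoelder _; rewrite ltry.
have E : (fun y : 'rV[R]_n => (rough_kernel h y * f (x - y))%:E) =
    (fun y => (rough_kernel h y * (f (x - y) - c))%:E + c%:E * (rough_kernel h y)%:E)%E.
  by apply/funext => y; rewrite -EFinM -EFinD; congr EFin; ring.
rewrite E integralD// integralZl// kernel_cancellation// mule0 adde0.
apply: le_trans annulus_hoelder; apply: le_abse_integral => //.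
by apply/measurable_EFinP; exact: measurable_funTS.
Qed.

End bound.

Lemma mass_power_mean (g : 'rV[R]_n -> R) (s : R) (i : lattice_index n) :
  (forall x, 0 <= g x) -> measurable_fun setT g -> P <= s ->
  (\int[leb]_(z in lcube (R := R) i) (g z `^ s)%:E < +oo)%E ->
  (\int[leb]_(z in lcube (R := R) i) (g z `^ P)%:E < +oo)%E ->
  mass (fun z => g z `^ P) (lcube (R := R) i) `^ P^-1 <=
  mass (fun z => g z `^ s) (lcube (R := R) i) `^ s^-1 * lvol R i `^ (P^-1 - s^-1).
Proof.
move=> g0 mg Ps soo Poo; have s0 : 0 < s by exact: lt_le_trans Ps.
have V0 := lvol_gt0 R i.
have [->|Pns] := eqVneq s P; first by rewrite subrr powRr0 mulr1.
have {Pns}Ps : P < s by rewrite lt_neqAle eq_sym Pns.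
have t01 : 0 < P / s < 1 by rewrite divr_gt0//= ltr_pdivrMr// mul1r.
have gp0 r x : 0 <= g x `^ r by exact: powR_ge0.
have mL := measurable_lcube (R := R) i.
have mI : measurable_fun setT (\1_(lcube (R := R) i) : 'rV[R]_n -> R) by exact: measurable_indic.
have mgs : measurable_fun setT (fun z => g z `^ s * \1_(lcube (R := R) i) z).
  by apply: measurable_funM => //; exact: measurableT_comp (measurable_powR _) mg.
have gs0 z : 0 <= g z `^ s * \1_(lcube (R := R) i) z by rewrite mulr_ge0.
have I0 z : 0 <= \1_(lcube (R := R) i) z :> R by [].
have := hoelder_ge0 leb t01 mI mgs I0 gs0.
rewrite (_ : (\int[leb]_z (_ `^ _ * _ `^ _)%:E)%E =
    \int[leb]_(z in lcube (R := R) i) (g z `^ P)%:E)%E; last first.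
  rewrite [RHS]integral_in_indic; apply: eq_integral => z _; congr EFin.
  rewrite indicE; case: (_ \in _); rewrite ?mulr1 ?mulr0 ?powR1 ?mul1r.
    by rewrite -powRrM [s * _]mulrC divfK// gt_eqF.
  rewrite powR0; last by rewrite gt_eqF//; case/andP: t01 => _; rewrite subr_gt0.
  by rewrite mul0r.
rewrite -integral_in_indic (massK (gp0 P) Poo) (massK (gp0 s) soo).
rewrite (_ : (\int[leb]_z (\1_(lcube (R := R) i) z)%:E)%E = (lvol R i)%:E); last first.
  by rewrite integral_indic// setIT -[LHS]/(leb _) lebesgue_cball ?(ltW (lradius_gt0 _ _)).
rewrite !poweR_EFin -EFinM lee_fin => H.
have := @ge0_ler_powR _ P^-1 _ _ _ _ _ H.
rewrite ?nnegrE invr_ge0 (ltW P0) mass_ge0// mulr_ge0 ?powR_ge0//.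
move=> /(_ isT isT isT); rewrite powRM ?powR_ge0// -!powRrM.
rewrite [_ / s / P]mulrAC mulfV ?gt_eqF// mul1r mulrBl mul1r [_ / s / P]mulrAC mulfV ?gt_eqF// mul1r.
by rewrite mulrC.
Qed.

(** The powers of [2^k] from the kernel, from the Hoelder factor of [Omega] and
    from the power mean combine to the volume power of [frac_avg]. *)
Lemma annulus_bound (s : R) : P <= s -> exists2 C : R, 0 <= C &
  forall (h f : 'rV[R]_n -> R) (x : 'rV[R]_n) (k : int) (a b : R),
    measurable_fun setT h -> (\int[sigma]_t (`|h t| `^ rho)%:E < +oo)%E ->
    (\int[sigma]_t (h t)%:E = 0)%E -> C1 f ->
    2 ^ k <= a -> b <= 2 * 2 ^ k ->
    (`|\int[leb]_(y in annulus a b) (rough_kernel h y * f (x - y))%:E| <=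
     (C * fine (\int[sigma]_t (`|h t| `^ rho)%:E) `^ rho^-1 *
      (lvol R (lindex (k + 1) x) `^ (s / n%:R - 1) *
        mass (fun z => l1_gradient f z `^ s) (lcube (R := R) (lindex (k + 1) x))) `^ s^-1)%:E)%E.
Proof.
move=> Ps; have s0 : 0 < s by exact: lt_le_trans Ps.
have [C0 C00 HC] := sobolev_poincare n0 P1 PQ PQn.
have nn0 : 0 < n%:R :> R by rewrite ltr0n.
exists ((2 ^+ n / n%:R) `^ rho^-1 * C0 `^ Q^-1 * (12 ^+ n) `^ Q^-1).
  by rewrite !mulr_ge0 ?powR_ge0.
move=> h f x k a b mh hoo hmean C1f ka bk; have [cf _ _] := C1f.
have [c Hc] := HC f C1f x k; set i := lindex (k + 1) x in Hc *.
set M1 := mass _ _ in Hc.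
have M10 : 0 <= M1 by apply: mass_ge0 => z; exact: powR_ge0.
have M0 : 0 <= C0 * M1 `^ (Q / P) by rewrite mulr_ge0// powR_ge0.
have H := annulus_integral mh cf hoo ka bk Hc M0 hmean.
apply: le_trans H _; rewrite lee_fin.
set N := fine _; set Ms := mass _ _.
have N0 : 0 <= N by apply: fine_ge0; apply: integral_ge0 => t _; rewrite lee_fin powR_ge0.
have Ms0 : 0 <= Ms by apply: mass_ge0 => z; exact: powR_ge0.
have G0 := l1_gradient_ge0 f; have mG := measurable_l1_gradient C1f.
have s1 : 1 < s by exact: lt_le_trans Ps.
have HM := mass_power_mean G0 mG Ps (l1_gradient_powR_lty C1f s1 i) (l1_gradient_powR_lty C1f P1 i).
have V0 := lvol_gt0 R i.
have d0 := pow2_gt0 R k; set d : R := 2 ^ k in d0 *.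
have D0 : 0 < d ^+ n by rewrite exprn_gt0.
have VE : lvol R i = 12 ^+ n * d ^+ n.
  by rewrite /lvol /lradius/= pow2S -exprMn; congr (_ ^+ _); rewrite /d; ring.
have E1 : ((2 * d) ^+ n / n%:R * N) `^ rho^-1 =
    (2 ^+ n / n%:R) `^ rho^-1 * ((d ^+ n) `^ rho^-1 * N `^ rho^-1).
  rewrite -[in RHS]powRM ?(ltW D0)// -powRM ?divr_ge0 ?exprn_ge0//.
    by congr (_ `^ _); rewrite exprMn; ring.
  by rewrite mulr_ge0// ltW.
have E2 : (C0 * M1 `^ (Q / P)) `^ Q^-1 = C0 `^ Q^-1 * M1 `^ P^-1.
  rewrite powRM ?powR_ge0// -[(M1 `^ _) `^ _]powRrM mulrAC mulfV ?gt_eqF// mul1r//.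
have E3 : (lvol R i `^ (s / n%:R - 1) * Ms) `^ s^-1 =
    lvol R i `^ (n%:R^-1 - s^-1) * Ms `^ s^-1.
  rewrite powRM ?powR_ge0// -[(_ `^ _) `^ s^-1]powRrM; congr (_ `^ _ * _).
  by field; rewrite !gt_eqF.
have E4 : (d ^+ n)^-1 * (d ^+ n) `^ rho^-1 * lvol R i `^ (P^-1 - s^-1) =
    (12 ^+ n) `^ Q^-1 * lvol R i `^ (n%:R^-1 - s^-1).
  have t0 : 0 < 12 ^+ n :> R by rewrite exprn_gt0.
  have -> : n%:R^-1 - s^-1 = - Q^-1 + (P^-1 - s^-1) by rewrite -PQn; ring.
  rewrite [in RHS]powRD ?(gt_eqF V0) ?implybT// mulrA; congr (_ * _).
  rewrite VE powRM ?(ltW t0) ?(ltW D0)// mulrA -powRD ?(gt_eqF t0) ?implybT//.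
  rewrite subrr powRr0 mul1r -powR_inv1 ?(ltW D0)//.
  by rewrite -powRD ?(gt_eqF D0) ?implybT//; congr (_ `^ _); rewrite -rhoQ; ring.
rewrite E1 E2 E3.
set a1 := (2 ^+ n / _) `^ _; set c0' := C0 `^ _; set nr := N `^ _.
have -> : a1 * c0' * (12 ^+ n) `^ Q^-1 * nr * (lvol R i `^ (n%:R^-1 - s^-1) * Ms `^ s^-1) =
   a1 * c0' * nr * Ms `^ s^-1 * ((12 ^+ n) `^ Q^-1 * lvol R i `^ (n%:R^-1 - s^-1)) by ring.
rewrite -E4.
have -> : a1 * c0' * nr * Ms `^ s^-1 *
     ((d ^+ n)^-1 * (d ^+ n) `^ rho^-1 * lvol R i `^ (P^-1 - s^-1)) =
   (d ^+ n)^-1 * (a1 * ((d ^+ n) `^ rho^-1 * nr) *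
     (c0' * (Ms `^ s^-1 * lvol R i `^ (P^-1 - s^-1)))) by ring.
rewrite ler_wpM2l ?invr_ge0 ?(ltW D0)// ler_wpM2l ?mulr_ge0 ?powR_ge0//.
by rewrite ler_wpM2l ?powR_ge0.
Qed.

End annulus_bound.

(** * Truncated integrals *)

Section pointwise.
Context (R : realType) (n : nat).
Local Notation leb := (@lebesgue_rV R n).
Local Notation sigma := (@sphere_measure R n).
Hypothesis n0 : (0 < n)%N.
Implicit Types (f h : 'rV[R]_n -> R) (x y : 'rV[R]_n).

Lemma enorm_le y (r : R) : 0 <= r -> (forall i, `|y ord0 i| <= r) -> enorm y <= n%:R * r.
Proof.
move=> r0 H; have nr0 : 0 <= n%:R * r by rewrite mulr_ge0.
rewrite -[leRHS]ger0_norm// -sqrtr_sqr /enorm ler_wsqrtr//.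
apply: (@le_trans _ _ (\sum_(i < n) r ^+ 2)).
  by apply: ler_sum => i _; rewrite -real_normK ?num_real// lerXn2r ?nnegrE.
rewrite sumr_const card_ord -[_ *+ n]mulr_natl exprMn ler_wpM2r ?exprn_ge0//.
by rewrite -natrX ler_nat -{1}(expn1 n) leq_pexp2l.
Qed.

Lemma compact_support_enorm f x : compact (closure [set z | f z != 0]) ->
  exists2 M : R, 0 < M & forall y, M < enorm y -> f (x - y) = 0.
Proof.
move=> /compact_bounded[M0 [_ HM]].
pose M1 := Num.max M0 0 + 1; have M1M : M0 < M1.
  by rewrite (@le_lt_trans _ _ (Num.max M0 0))// ?le_max ?lexx// ltrDl.
have M10 : 0 < M1 by rewrite ltr_wpDl// le_max lexx orbT.
exists (n%:R * (M1 + `|x|)); first by rewrite mulr_gt0 ?ltr0n// ltr_wpDr.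
move=> y ny; apply/eqP/negP => /negP fy.
have H : `|x - y| <= M1 by apply: (HM _ M1M); apply: subset_closure.
move: ny; apply/negP; rewrite -leNgt; apply: enorm_le.
  by rewrite addr_ge0// ltW.
move=> i; apply: le_trans (coord_le_norm y i) _.
rewrite -[y in leLHS](subKr x); apply: le_trans (ler_normB _ _) _.
by rewrite addrC lerD2r.
Qed.

(** Annuli that lie below the truncation level are empty, so the lowest scale
    only has to be small enough, and does not have to match [eps]. *)
Lemma truncated_dyadic (T : int -> R) h f x (eps : R) (k : int) :
  measurable_fun setT h -> continuous f ->
  (forall k, 0 <= T k) ->
  (forall (k : int) a b, 2 ^ k <= a -> b <= 2 * 2 ^ k ->
    (`|\int[leb]_(y in annulus a b) (rough_kernel h y * f (x - y))%:E| <= (T k)%:E)%E) ->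
  2 ^ k <= eps -> forall J : nat,
  (`|\int[leb]_(y in annulus eps (2 ^ (k + J%:Z))) (rough_kernel h y * f (x - y))%:E|
    <= (\sum_(j < J) T (k + j%:Z))%:E)%E.
Proof.
move=> mh cf T0 HT keps; elim=> [|J IH].
  rewrite big_ord0 addr0 (_ : annulus _ _ = set0) ?integral_set0 ?abse0//.
  apply/seteqP; split => y //= /andP[ey yk].
  by move: (lt_le_trans ey yk); rewrite ltNge keps.
have -> : k + J.+1%:Z = k + J%:Z + 1 by rewrite -addrA -PoszD addn1.
rewrite pow2S big_ord_recr/=; set d := 2 ^ (k + J%:Z) in IH *.
have d0 : 0 < d := pow2_gt0 R _.
have -> : annulus eps (2 * d) =
    annulus eps d `|` annulus (Num.max eps d) (2 * d) :> set 'rV[R]_n.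
  apply/seteqP; split => y; rewrite /annulus/= gt_max.
    move=> /andP[-> ->]; have [yd|dy] := lerP (enorm y) d; [left|right] => //.
  move=> [/andP[-> yd]|/andP[/andP[-> _] ->]]//=; lra.
rewrite integral_setU; [|exact: measurable_annulus|exact: measurable_annulus| |].
- rewrite EFinD; apply: le_trans (lee_abs_add _ _) _; apply: leeD => //.
  by apply: HT => //; rewrite le_max lexx orbT.
- apply/measurable_EFinP; apply: measurable_funTS; apply: measurable_funM.
    exact: measurable_rough_kernel.
  exact: measurable_reflection.
- apply/disj_setPS => y [/= /andP[_ yd]]; rewrite /annulus/= gt_max => /andP[/andP[_ dy] _].
  by move: (lt_le_trans dy yd); rewrite ltxx.
Qed.

Lemma truncated_bound (T : int -> R) h f x (eps : R) :
  measurable_fun setT h -> continuous f -> compact (closure [set z | f z != 0]) ->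
  (forall k, 0 <= T k) ->
  (forall (k : int) a b, 2 ^ k <= a -> b <= 2 * 2 ^ k ->
    (`|\int[leb]_(y in annulus a b) (rough_kernel h y * f (x - y))%:E| <= (T k)%:E)%E) ->
  0 < eps -> exists (k : int) (J : nat),
  (`|\int[leb]_(y in [set y | (eps < enorm y)%R]) (rough_kernel h y * f (x - y))%:E|
    <= (\sum_(j < J) T (k + j%:Z))%:E)%E.
Proof.
move=> mh cf sf T0 HT eps0.
have [M M0 HM] := compact_support_enorm x sf.
have pow_ge (v : R) : 0 < v -> exists m : nat, v <= 2 ^+ m.
  move=> v0; exists (Num.truncn v).+1; apply: ltW; apply: lt_le_trans (truncnS_gt _) _.
  by rewrite -natrX ler_nat ltnW// ltn_expl.
have ei0 : 0 < eps^-1 by rewrite invr_gt0.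
have [m Hm] := pow_ge _ ei0.
have [m' Hm'] := pow_ge M M0.
exists (- m%:Z), (m + m')%N.
rewrite (_ : (\int[leb]_(y in _) _)%E =
  (\int[leb]_(y in annulus eps (2 ^ (- m%:Z + (m + m')%:Z)))
    (rough_kernel h y * f (x - y))%:E)%E); last first.
  rewrite integral_mkcond [RHS]integral_mkcond; apply: eq_integral => y _.
  rewrite /patch; have [ye|ye] := boolP (y \in annulus _ _).
    by rewrite mem_set//=; move: ye; rewrite inE => /andP[].
  case: ifPn => //; rewrite inE/= => ey.
  rewrite HM ?mulr0// ltNge; apply: contra ye => yM; rewrite inE /annulus/= ey/=.
  by rewrite PoszD addrA addNr add0r -exprnP (le_trans yM).
apply: truncated_dyadic => //.
by rewrite -exprnN invf_ple ?posrE ?exprn_gt0.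
Qed.

End pointwise.

(** * The weight condition *)

Section positivity.
Context d (T : measurableType d) (R : realType) (mu : {measure set T -> \bar R}).

Lemma nonneg_integral_in_le (D' D : set T) (f g : T -> \bar R) : D' `<=` D ->
  (forall x, D' x -> (0 <= f x)%E) -> (forall x, D x -> (0 <= g x)%E) ->
  {ae mu, forall x, D' x -> (f x <= g x)%E} ->
  (\int[mu]_(x in D') f x <= \int[mu]_(x in D) g x)%E.
Proof.
move=> DD f0 g0 fg; rewrite integral_mkcond [leRHS]integral_mkcond.
apply: nonneg_integral_le.
- by move=> x; rewrite patchE; case: ifPn => //; rewrite inE => /f0.
- by move=> x; rewrite patchE; case: ifPn => //; rewrite inE => /g0.
apply: filterS fg => x H; rewrite !patchE; case: ifPn => [|_].
  by rewrite inE => xD; rewrite mem_set; [exact: H|exact: DD].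
by case: ifPn => //; rewrite inE => /g0.
Qed.

Lemma integral_gt0_eq0 (D : set T) (g : T -> R) : measurable D ->
  measurable_fun setT g -> (forall x, D x -> 0 < g x) ->
  (\int[mu]_(x in D) (g x)%:E = 0)%E -> mu D = 0%E.
Proof.
move=> mD mg g0 int0.
have mgD : measurable_fun D (EFin \o g) by apply/measurable_EFinP; exact: measurable_funTS.
have [+ _] := ae_eq_integral_abs mu mD mgD.
have -> : (\int[mu]_(x in D) `|(EFin \o g) x|)%E = 0%E.
  rewrite -[RHS]int0; apply: eq_integral => x; rewrite inE => /g0 gx.
  by rewrite /= ger0_norm// ltW.
move=> /(_ erefl) H; apply/negligibleP => //.
apply: negligibleS H => x Dx /= /(_ Dx) [] gx.
by have := g0 x Dx; rewrite gx ltxx.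
Qed.

End positivity.

Section weights.
Context (R : realType) (n : nat).
Local Notation leb := (@lebesgue_rV R n).
Hypothesis n0 : (0 < n)%N.
Variables (P Q : R).
Hypotheses (P1 : 1 < P) (PQ : P < Q).
Local Notation P' := (P / (P - 1)).

Let P0 : 0 < P. Proof. by rewrite (lt_trans _ P1). Qed.
Let Q0 : 0 < Q. Proof. by rewrite (lt_trans _ PQ). Qed.
Let P'0 : 0 < P'. Proof. by rewrite divr_gt0// subr_gt0. Qed.
Let P'V : P'^-1 = 1 - P^-1.
Proof. by field; rewrite !gt_eqF// subr_gt0. Qed.

Lemma Apq_const_ae_eq (v w : 'rV[R]_n -> R) : {ae leb, forall x, v x = w x} ->
  Apq_const P Q v = Apq_const P Q w.
Proof.
move=> vw.
have H1 (D : set 'rV[R]_n) : (\int[leb]_(x in D) (v x `^ Q)%:E = \int[leb]_(x in D) (w x `^ Q)%:E)%E.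
  by apply: eq_integral_in_ae; apply: filterS vw => x E; rewrite E.
have H2 (D : set 'rV[R]_n) : (\int[leb]_(x in D) ((v x `^ P')%:E)^-1 =
    \int[leb]_(x in D) ((w x `^ P')%:E)^-1)%E.
  by apply: eq_integral_in_ae; apply: filterS vw => x E; rewrite E.
apply: (congr1 (fun F : 'rV[R]_n * R -> \bar R =>
  ereal_sup [set F al | al in [set al | 0 < al.2]])).
apply/funext => al; rewrite /average H1 H2; reflexivity.
Qed.

Lemma Apq_const_ge0 (v : 'rV[R]_n -> R) : (0 <= Apq_const P Q v)%E.
Proof.
apply: le_trans (ereal_sup_ubound (ex_intro2 _ _ (0, 1) ltr01 erefl)).
by rewrite mule_ge0// poweR_ge0.
Qed.

Lemma Apq_cball (v : 'rV[R]_n -> R) (A : R) c r : (Apq_const P Q v <= A%:E)%E -> 0 < r ->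
  ((((r *+ 2) ^+ n)^-1%:E * \int[leb]_(x in cball c r) (v x `^ Q)%:E) `^ Q^-1 *
   (((r *+ 2) ^+ n)^-1%:E * \int[leb]_(x in cball c r) ((v x `^ P')%:E)^-1) `^ P'^-1
   <= A%:E)%E.
Proof.
move=> vA r0; apply: le_trans vA.
apply: ereal_sup_ubound; exists (c - const_mx r, r *+ 2) => /=.
  by rewrite mulrn_wgt0.
have r20 : (r *+ 2) ^+ n != 0 by rewrite expf_neq0// gt_eqF// mulrn_wgt0.
by rewrite -cballE /average lebesgue_cball ?(ltW r0)// inver (negbTE r20).
Qed.

(** Where the weight vanishes on a set of positive measure the second average
    is infinite, so finiteness of the product forces the first one to be zero. *)
Lemma Apq_dichotomy (v v1 : 'rV[R]_n -> R) (A : R) :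
  (forall x, 0 <= v x) -> measurable_fun setT v1 -> {ae leb, forall x, v x = v1 x} ->
  (Apq_const P Q v <= A%:E)%E ->
  {ae leb, forall x, v x = 0} \/ {ae leb, forall x, 0 < v1 x}.
Proof.
move=> v0 mv1 vv1 vA.
pose E1 := [set x | 0 < v1 x]; pose E0 := ~` E1.
have mE1 : measurable E1 by exact: measurable_superlevel.
have mE0 : measurable E0 by exact: measurableC.
pose B (k : nat) : set 'rV[R]_n := cball 0 k.+1%:R.
have mB k : measurable (B k) by exact: measurable_cball.
have BT x : exists k0, forall k, (k0 <= k)%N -> B k x.
  exists (Num.truncn `|x|) => k kx i; rewrite mxE subr0.
  apply: le_trans (coord_le_norm x i) _; apply: ltW.
  by apply: lt_le_trans (truncnS_gt _) _; rewrite ler_nat.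
have key k : leb (E0 `&` B k) = 0%E \/ leb (E1 `&` B k) = 0%E.
  have [E0B|E0B] := eqVneq (leb (E0 `&` B k)) 0%E; first by left.
  right; have {}E0B : (0 < leb (E0 `&` B k))%E by rewrite lt0e E0B measure_ge0.
  have mE0B : measurable (E0 `&` B k) by exact: measurableI.
  have mE1B : measurable (E1 `&` B k) by exact: measurableI.
  have k0 : 0 < k.+1%:R :> R by [].
  have V0 : 0 < ((k.+1%:R *+ 2) ^+ n)^-1 :> R by rewrite invr_gt0 exprn_gt0// mulrn_wgt0.
  have := Apq_cball 0 vA k0.
  have -> : (\int[leb]_(x in cball 0 k.+1%:R) ((v x `^ P')%:E)^-1 = +oo)%E.
    apply/eqP; rewrite -leye_eq.
    have <- : (\int[leb]_(x in E0 `&` B k) (cst +oo x) = +oo)%E.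
      by rewrite integral_cst// gt0_mulye.
    apply: nonneg_integral_in_le.
    - by move=> x [].
    - by move=> x _; exact: leey.
    - by move=> x _; rewrite inve_ge0 lee_fin powR_ge0.
    apply: filterS vv1 => x vx [E0x _].
    have -> : v x = 0.
      apply/eqP; rewrite eq_le v0 andbT vx leNgt; apply/negP; exact: E0x.
    by rewrite powR0 ?gt_eqF// inve0.
  rewrite gt0_muley ?lte_fin// poweRyr ?gt_eqF ?invr_gt0//.
  set X := (_ `^ Q^-1)%E => XA.
  have X0 : X = 0%E.
    apply/eqP/negPn/negP => Xn0.
    have : (0 < X)%E by rewrite lt0e Xn0 poweR_ge0.
    by move=> Xpos; move: XA; rewrite gt0_muley.
  move: X0; rewrite /X => /poweR_eq0_eq0 H.
  have int0 : (\int[leb]_(x in cball 0 k.+1%:R) (v x `^ Q)%:E = 0)%E.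
    have /H/eqP : (0 <= ((k.+1%:R *+ 2) ^+ n)^-1%:E *
        \int[leb]_(x in cball 0 k.+1%:R) (v x `^ Q)%:E)%E.
      rewrite mule_ge0// ?lee_fin ?(ltW V0)//; apply: integral_ge0 => x _.
      by rewrite lee_fin powR_ge0.
    by rewrite mule_eq0 eqe (gt_eqF V0)/= => /eqP.
  apply: (@integral_gt0_eq0 _ _ _ leb _ (fun x => v1 x `^ Q)) => //.
  - exact: measurableT_comp (measurable_powR _) mv1.
  - by move=> x [E1x _]; exact: powR_gt0.
  apply/eqP; rewrite eq_le; apply/andP; split; last first.
    by apply: integral_ge0 => x _; rewrite lee_fin powR_ge0.
  rewrite -int0; apply: nonneg_integral_in_le.
  - by move=> x [].
  - by move=> x _; rewrite lee_fin powR_ge0.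
  - by move=> x _; rewrite lee_fin powR_ge0.
  by apply: filterS vv1 => x ->.
have null (E : set 'rV[R]_n) : measurable E -> forall k0,
    (forall k, (k0 <= k)%N -> leb (E `&` B k) = 0%E) -> leb.-negligible E.
  move=> mE k0 H.
  suff sub : E `<=` \bigcup_k (E `&` B (k0 + k)%N).
    apply: (negligibleS sub); apply: negligible_bigcup => k.
    apply/negligibleP; first exact: measurableI.
    by apply: H; exact: leq_addr.
  move=> x Ex; have [k1 Hk1] := BT x; exists k1 => //; split => //.
  by apply: Hk1; exact: leq_addl.
have [[k1 Hk1]|noE1] := pselect (exists k, leb (E1 `&` B k) <> 0%E).
  right; apply: (null _ mE0 k1) => k kk1; have [//|E1k] := key k.
  exfalso; apply: Hk1; apply/eqP; rewrite eq_le measure_ge0 andbT -E1k.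
  apply: le_measure; rewrite ?inE; [exact: measurableI|exact: measurableI|].
  move=> x [E1x Bx]; split => // i; apply: le_trans (Bx i) _.
  by rewrite ler_nat ltnS.
left; have nE1 : leb.-negligible E1.
  by apply: (null _ mE1 0%N) => k _; apply: contrapT => H; apply: noE1; exists k.
have : {ae leb, forall x, ~ E1 x} by apply: negligibleS nE1 => x /= /contrapT.
apply: filterS2 vv1 => x vx nE; apply/eqP; rewrite eq_le v0 andbT vx leNgt; apply/negP; exact: nE.
Qed.


Lemma poweR_prod_lty (a b : \bar R) (al be : R) : (0 < a)%E -> (0 < b)%E ->
  0 < al -> 0 < be -> (a `^ al * b `^ be < +oo)%E -> (a < +oo)%E /\ (b < +oo)%E.
Proof.
move=> a0 b0 al0 be0 H; split; rewrite ltey; apply/eqP => E; move: H.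
  by rewrite E poweRyr ?gt_eqF// gt0_mulye// poweR_gt0.
by rewrite E poweRyr ?gt_eqF// gt0_muley// poweR_gt0.
Qed.

(** A positive weight has positive averages, so finiteness of the product makes
    both factors finite; the pair condition is the [A_(P,Q)] bound raised to the
    power that makes the exponents sum to one. *)
Lemma Apq_muckenhoupt_pair (v : 'rV[R]_n -> R) (A : R) :
  measurable_fun setT v -> (forall x, 0 < v x) -> (Apq_const P Q v <= A%:E)%E ->
  muckenhoupt_pair ((1 - P^-1) / (Q^-1 + 1 - P^-1)) (A `^ (Q^-1 + 1 - P^-1)^-1)
    (fun x => v x `^ Q) (fun x => v x `^ (- P')).
Proof.
move=> mv v0 vA; set e := Q^-1 + 1 - P^-1.
have Qi0 : 0 < Q^-1 by rewrite invr_gt0.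
have P'i0 : 0 < P'^-1 by rewrite invr_gt0.
have eE : e = Q^-1 + P'^-1 by rewrite P'V addrA.
have e0 : 0 < e by rewrite eE addr_gt0.
rewrite -P'V; have t1 : 1 - P'^-1 / e = Q^-1 / e.
  by rewrite -[X in X - _](mulfV (lt0r_neq0 e0)) -mulrBl eE addrK.
have mm : measurable_fun setT (fun x => v x `^ Q) by exact: measurableT_comp (measurable_powR _) mv.
have mt : measurable_fun setT (fun x => v x `^ (- P')) by exact: measurableT_comp (measurable_powR _) mv.
have m0 x : 0 < v x `^ Q by exact: powR_gt0.
have tau0 x : 0 < v x `^ (- P') by exact: powR_gt0.
split => //.
  move=> x; rewrite t1 -!powRrM -powRD ?(gt_eqF (v0 x)) ?implybT//.
  rewrite mulrA mulfV ?gt_eqF// mulNr mulrA mulfV ?gt_eqF// subrr powRr0//.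
move=> c r r0; have mB := measurable_cball c r.
have V0 : 0 < (r *+ 2) ^+ n by rewrite exprn_gt0// mulrn_wgt0.
have VB : leb (cball c r) = ((r *+ 2) ^+ n)%:E by rewrite lebesgue_cball// ltW.
have pos (u : 'rV[R]_n -> R) : measurable_fun setT u -> (forall x, 0 < u x) ->
    (0 < ((r *+ 2) ^+ n)^-1%:E * \int[leb]_(x in cball c r) (u x)%:E)%E.
  move=> mu_ u0; rewrite mule_gt0 ?lte_fin ?invr_gt0// lt0e integral_ge0 ?andbT; last first.
    by move=> x _; rewrite lee_fin ltW.
  apply/eqP => int0; have := integral_gt0_eq0 mB mu_ (fun x _ => u0 x) int0.
  by rewrite -[LHS]/(leb _) VB => -[] /eqP; rewrite gt_eqF.
have := Apq_cball c vA r0.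
have -> : (\int[leb]_(x in cball c r) ((v x `^ P')%:E)^-1 =
    \int[leb]_(x in cball c r) (v x `^ (- P'))%:E)%E.
  by apply: eq_integral => x _; rewrite inver gt_eqF ?powR_gt0// powRN.
move=> H; have [fm ft] := poweR_prod_lty (pos _ mm m0) (pos _ mt tau0) Qi0 P'i0
  (le_lt_trans H (ltry A)).
have lty (u : 'rV[R]_n -> R) : (forall x, 0 < u x) ->
    (((r *+ 2) ^+ n)^-1%:E * \int[leb]_(x in cball c r) (u x)%:E < +oo)%E ->
    (\int[leb]_(x in cball c r) (u x)%:E < +oo)%E.
  move=> u0; rewrite !ltey; apply: contra => /eqP ->.
  by rewrite gt0_muley// lte_fin invr_gt0.
have {}fm := lty _ m0 fm; have {}ft := lty _ tau0 ft.
split => //; move: H.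
rewrite (massK (fun x => ltW (m0 x)) fm) (massK (fun x => ltW (tau0 x)) ft).
set M1 := mass _ _; set M2 := mass _ _.
have M10 : 0 <= M1 by apply: mass_ge0 => x; exact: ltW.
have M20 : 0 <= M2 by apply: mass_ge0 => x; exact: ltW.
set V := (r *+ 2) ^+ n in V0 *; have Vi0 : 0 <= V^-1 by rewrite invr_ge0 ltW.
rewrite -[(V^-1%:E * M1%:E)%E]EFinM -[(V^-1%:E * M2%:E)%E]EFinM !poweR_EFin -EFinM lee_fin => H.
have N1 : 0 <= V^-1 * M1 by rewrite mulr_ge0.
have N2 : 0 <= V^-1 * M2 by rewrite mulr_ge0.
have -> : M1 `^ (1 - P'^-1 / e) * M2 `^ (P'^-1 / e) =
    ((V^-1 * M1) `^ Q^-1 * (V^-1 * M2) `^ P'^-1) `^ e^-1 * V.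
  rewrite powRM ?powR_ge0// -!powRrM t1.
  rewrite -[M1 in LHS](mulVKf (lt0r_neq0 V0)) -[M2 in LHS](mulVKf (lt0r_neq0 V0)).
  rewrite ![(V * _) `^ _]powRM// ?(ltW V0)// mulrACA [RHS]mulrC; congr (_ * _).
  by rewrite -powRD ?(gt_eqF V0) ?implybT// -mulrDl -eE mulfV ?gt_eqF// powRr1// ltW.
rewrite ler_wpM2r ?(ltW V0)// ge0_ler_powR ?invr_ge0 ?(ltW e0)// nnegrE.
  by rewrite mulr_ge0 ?powR_ge0.
by apply: le_trans H; rewrite mulr_ge0 ?powR_ge0.
Qed.

End weights.

(** * The maximal operator *)

Lemma poweR_estimate (R : realType) (K C v p q j i : R) (L : \bar R) :
  0 <= K -> 0 <= C -> 0 <= v -> 0 < p -> 0 < q -> 0 <= j -> 0 <= i -> (0 <= L)%E ->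
  (L <= (K `^ q * (C * j `^ (q / p)))%:E)%E -> j <= v `^ p * i ->
  (L `^ q^-1 <= (K * (C `^ q^-1 * (v * i `^ p^-1)))%:E)%E.
Proof.
move=> K0 C0 v0 p0 q0 j0 i0 L0 LK ji.
have qV0 : 0 <= q^-1 by rewrite invr_ge0 ltW.
apply: (@le_trans _ _ ((K `^ q * (C * j `^ (q / p)))%:E `^ q^-1)%E).
  apply: gt0_ler_poweR LK; rewrite ?in_itv/= ?leey ?andbT//.
  by rewrite lee_fin !mulr_ge0 ?powR_ge0.
rewrite poweR_EFin lee_fin.
rewrite [(K `^ q * _) `^ _]powRM ?mulr_ge0 ?powR_ge0// -powR_root//.
rewrite [(C * _) `^ _]powRM ?powR_ge0// -[(j `^ _) `^ _]powRrM.
rewrite (_ : q / p / q = p^-1); last by field; rewrite !gt_eqF.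
rewrite ler_wpM2l// ler_wpM2l ?powR_ge0//.
rewrite [X in X * _](powR_root p0 v0) -powRM ?powR_ge0//.
by rewrite ge0_ler_powR ?nnegrE ?invr_ge0 ?(ltW p0)// mulr_ge0 ?powR_ge0.
Qed.

Section maximal_bound.
Context (R : realType) (n : nat).
Local Notation leb := (@lebesgue_rV R n).
Local Notation sigma := (@sphere_measure R n).
Local Notation Tmax := (@maximal_rough_singular_integral R n).
Hypothesis n0 : (0 < n)%N.

Lemma maximal_ge0 (h f : 'rV[R]_n -> R) x : (0 <= Tmax h f x)%E.
Proof.
apply: le_trans (ereal_sup_ubound _); last by exists 1; [exact: ltr01|reflexivity].
exact: abse_ge0.
Qed.

(** If [z] is infinite the claim is only nontrivial for [K = 0], where the
    maximal function vanishes; if [z] is finite it bounds all the sums. *)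
Lemma maximal_pointwise (h f : 'rV[R]_n -> R) x (K s q m : R)
    (fa : lattice_index n -> R) (z : \bar R) :
  measurable_fun setT h -> continuous f -> compact (closure [set z | f z != 0]) ->
  0 <= K -> 0 < q -> 0 < m ->
  (forall (k : int) a b, 2 ^ k <= a -> b <= 2 * 2 ^ k ->
    (`|\int[leb]_(y in annulus a b) (rough_kernel h y * f (x - y))%:E| <=
     (K * fa (lindex (k + 1) x) `^ s^-1)%:E)%E) ->
  (0 <= z)%E ->
  (forall (k : int) (L : nat),
    (((\sum_(j < L) fa (lindex (k + j%:Z) x) `^ s^-1) `^ q * m)%:E <= z)%E) ->
  (Tmax h f x `^ q * m%:E <= (K `^ q)%:E * z)%E.
Proof.
move=> mh cf sf K0 q0 m0 HT z0 Hz.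
have T0 := maximal_ge0 h f x.
have key (B : R) : 0 <= B ->
    (forall (k : int) (L : nat), K * (\sum_(j < L) fa (lindex (k + j%:Z) x) `^ s^-1) <= B) ->
    (Tmax h f x <= B%:E)%E.
  move=> B0 HB; apply: ge_ereal_sup => _ [eps eps0 <-].
  have [k [J HJ]] := @truncated_bound R n n0 (fun k => K * fa (lindex (k + 1) x) `^ s^-1)
    h f x eps mh cf sf (fun k => mulr_ge0 K0 (powR_ge0 _ _)) HT eps0.
  apply: le_trans HJ _; rewrite lee_fin -mulr_sumr.
  by under eq_bigr do rewrite addrAC; exact: HB.
have T0q : Tmax h f x = 0%E -> (Tmax h f x `^ q * m%:E <= (K `^ q)%:E * z)%E.
  move=> ->; rewrite poweR0r ?gt_eqF// mul0e mule_ge0// lee_fin powR_ge0//.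
have [K00|K00] := eqVneq K 0.
  apply: T0q; apply/eqP; rewrite eq_le T0 andbT.
  by apply: key => // k L; rewrite K00 mul0r.
have {}K0 : 0 < K by rewrite lt_neqAle eq_sym K00.
clear T0q; case: z z0 Hz => [z|_ _|//]; last by rewrite gt0_muley ?leey// lte_fin powR_gt0.
rewrite lee_fin => z0 Hz.
have zm0 : 0 <= z / m by rewrite divr_ge0// ltW.
have HB : (Tmax h f x <= (K * (z / m) `^ q^-1)%:E)%E.
  apply: key => [|k L]; first by rewrite mulr_ge0 ?powR_ge0// ltW.
  rewrite ler_wpM2l ?(ltW K0)//; set S := \sum_(j < L) _.
  have S0 : 0 <= S by apply: sumr_ge0 => j _; exact: powR_ge0.
  rewrite (powR_root q0 S0) ge0_ler_powR ?invr_ge0 ?(ltW q0) ?nnegrE ?powR_ge0//.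
  by rewrite ler_pdivlMr// -lee_fin; exact: Hz.
have -> : ((K `^ q)%:E * z%:E = ((K * (z / m) `^ q^-1) `^ q)%:E * m%:E)%E.
  rewrite -!EFinM powRM ?powR_ge0 ?(ltW K0)// -[((z / m) `^ _) `^ _]powRrM.
  by rewrite mulVf ?gt_eqF// powRr1// -mulrA divfK// gt_eqF.
rewrite lee_wpmul2r ?lee_fin ?(ltW m0)// -poweR_EFin.
apply: gt0_ler_poweR HB; rewrite ?in_itv/= ?leey ?andbT ?(ltW q0)//.
by rewrite lee_fin mulr_ge0 ?powR_ge0// ltW.
Qed.

Lemma l1_gradient_le_enorm (f : 'rV[R]_n -> R) x :
  l1_gradient f x <= n%:R * enorm (gradient f x).
Proof.
apply: (@le_trans _ _ (\sum_(i < n) enorm (gradient f x))).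
  apply: ler_sum => i _; apply: le_trans (coord_le_enorm (gradient f x) i).
  by rewrite mxE.
by rewrite sumr_const card_ord mulr_natl.
Qed.

Lemma measurable_gradient (f : 'rV[R]_n -> R) : C1 f -> measurable_fun setT (gradient f).
Proof.
move=> [_ _ cD]; apply: measurable_fun_rV => i.
rewrite (_ : (fun t => _) = (fun t => 'D_(basis_vector R i) f t)).
  by apply: continuous_measurable_rV; exact: cD.
by apply/funext => t; rewrite mxE.
Qed.

Variables (rho s p q : R).
Hypotheses (rho1 : 1 < rho) (rhon : rho < n%:R).
Hypothesis rhos : rho * n%:R / (rho * n%:R + rho - n%:R) <= s.
Hypotheses (sp : s < p) (pn : p < n%:R) (pq : p^-1 - q^-1 = n%:R^-1).

Let nn0 : 0 < n%:R :> R. Proof. by rewrite ltr0n. Qed.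
Let rho0 : 0 < rho. Proof. exact: lt_trans rho1. Qed.

Let P0 : R := rho * n%:R / (rho * n%:R + rho - n%:R).
Let Q0 : R := rho / (rho - 1).
Let den0 : 0 < rho * n%:R + rho - n%:R.
Proof.
have : 0 < (rho - 1) * n%:R by rewrite mulr_gt0// subr_gt0.
have := rho0; lra.
Qed.
Let P0V : P0^-1 = 1 + n%:R^-1 - rho^-1.
Proof. by rewrite /P0; field; rewrite !gt_eqF. Qed.
Let Q0V : Q0^-1 = 1 - rho^-1.
Proof. by rewrite /Q0; field; rewrite !gt_eqF// subr_gt0. Qed.
Let P0Q0 : P0^-1 - Q0^-1 = n%:R^-1.
Proof. by rewrite P0V Q0V; ring. Qed.
Let P00 : 0 < P0. Proof. by rewrite divr_gt0// mulr_gt0. Qed.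
Let Q00 : 0 < Q0. Proof. by rewrite divr_gt0// subr_gt0. Qed.
Let P01 : 1 < P0.
Proof.
rewrite -ltf_pV2 ?posrE// invr1 P0V -addrA gtrDl subr_lt0 ltf_pV2 ?posrE//.
Qed.
Let P0ltQ0 : P0 < Q0.
Proof. by rewrite -ltf_pV2 ?posrE// -subr_gt0 P0Q0 invr_gt0. Qed.
Let rhoQ0 : rho^-1 + Q0^-1 = 1. Proof. by rewrite Q0V; ring. Qed.
Let s0 : 0 < s. Proof. exact: lt_le_trans rhos. Qed.
Let p0 : 0 < p. Proof. exact: lt_trans sp. Qed.
Let qV0 : 0 < q^-1.
Proof. by have -> : q^-1 = p^-1 - n%:R^-1; [rewrite -pq; ring|rewrite subr_gt0 ltf_pV2 ?posrE]. Qed.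
Let q0 : 0 < q. Proof. by rewrite -invr_gt0. Qed.
Let p_lt_q : p < q. Proof. by rewrite -ltf_pV2 ?posrE// -subr_gt0 pq invr_gt0. Qed.
Let P1 : 1 < p / s. Proof. by rewrite ltr_pdivlMr// mul1r. Qed.
Let PQ : p / s < q / s. Proof. by rewrite ltr_pM2r ?invr_gt0. Qed.

(** The two cases split off first are those in which the right-hand side is not
    a product of finite positive numbers: [||Omega|| = 0], where the maximal
    function vanishes, and an infinite gradient norm. *)
Lemma rough_maximal_bound (A : R) : exists2 C : R, 0 < C &
  forall h f v : 'rV[R]_n -> R,
    measurable_fun setT h -> (\int[sigma]_t (`|h t| `^ rho)%:E < +oo)%E ->
    (\int[sigma]_t (h t)%:E = 0)%E ->
    measurable_fun setT v -> (forall x, 0 < v x) ->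
    (Apq_const (p / s) (q / s) v <= A%:E)%E -> Cc_infty f ->
    (weighted_norm q (fun x => v x `^ (q / s))%R (Tmax h f) <=
     C%:E * (\int[sigma]_t (`|h t| `^ rho)%:E) `^ rho^-1 *
     weighted_norm p (fun x => v x `^ (p / s))%R (fun x => (enorm (gradient f x))%:E))%E.
Proof.
have [C1 C10 HC1] := annulus_bound n0 rho1 P01 P0ltQ0 P0Q0 rhoQ0 rhos.
have sV0 : 0 < s^-1 by rewrite invr_gt0.
have [C2 C20 HC2] := fractional_bound (A `^ ((q / s)^-1 + 1 - (p / s)^-1)^-1) n0 P1 PQ sV0.
exists (C1 * C2 `^ q^-1 * n%:R + 1).
  by rewrite ltr_wpDl// !mulr_ge0// powR_ge0.
move=> h f v mh hoo hmean mv v0 vA [smf sf].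
have C1f := smooth_C1 smf; have [cf _ _] := C1f.
set N := (\int[sigma]_t (`|h t| `^ rho)%:E)%E in hoo *.
have N0 : (0 <= N)%E by apply: integral_ge0 => t _; rewrite lee_fin powR_ge0.
have fN : N \is a fin_num by rewrite ge0_fin_numE.
set K := C1 * fine N `^ rho^-1.
have K0 : 0 <= K by rewrite mulr_ge0// powR_ge0.
pose F x := l1_gradient f x `^ s.
pose m x := v x `^ (q / s).
have m0 x : 0 < m x by exact: powR_gt0.
have HT x (k : int) a b : 2 ^ k <= a -> b <= 2 * 2 ^ k ->
    (`|\int[leb]_(y in annulus a b) (rough_kernel h y * f (x - y))%:E| <=
     (K * frac_avg (p / s) (q / s) F (lindex (k + 1) x) `^ s^-1)%:E)%E.
  move=> ka bk; have := HC1 h f x k a b mh hoo hmean C1f ka bk.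
  rewrite /frac_avg (_ : - _ = s / n%:R - 1)//.
  rewrite -pq; field; rewrite !gt_eqF//.
have ptw x z : (0 <= z)%E -> (forall (k : int) (L : nat),
    (((\sum_(j < L) frac_avg (p / s) (q / s) F (lindex (k + j%:Z) x) `^ s^-1) `^ q * m x)%:E
      <= z)%E) -> (Tmax h f x `^ q * (m x)%:E <= (K `^ q)%:E * z)%E.
  by move=> z0; apply: maximal_pointwise => //; exact: HT.
set I := (\int[leb]_x (`|(enorm (gradient f x))%:E| `^ p * (v x `^ (p / s))%:E))%E.
rewrite /weighted_norm -/I.
have I0 : (0 <= I)%E.
  by apply: integral_ge0 => x _; rewrite mule_ge0 ?poweR_ge0// lee_fin powR_ge0.
under eq_integral do rewrite gee0_abs ?maximal_ge0//.
have [K00|K00] := eqVneq (fine N `^ rho^-1) 0.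
  have KE : K = 0 by rewrite /K K00 mulr0.
  have -> : (\int[leb]_x (Tmax h f x `^ q * (v x `^ (q / s))%:E) = 0)%E.
    apply: integral0_eq => x _; apply/eqP; rewrite eq_le; apply/andP; split.
      have := @ptw x +oo%E le0y; rewrite KE powR0 ?gt_eqF// mul0e; apply.
      by move=> k L; exact: leey.
    by rewrite mule_ge0 ?poweR_ge0// lee_fin powR_ge0.
  by rewrite poweR0r ?gt_eqF// !mule_ge0 ?poweR_ge0// lee_fin addr_ge0// !mulr_ge0// powR_ge0.
have NV : (N `^ rho^-1 = (fine N `^ rho^-1)%:E)%E by rewrite -{1}(fineK fN) poweR_EFin.
have NV0 : 0 < fine N `^ rho^-1 by rewrite lt_neqAle eq_sym K00 powR_ge0.
have Cpos : 0 < C1 * C2 `^ q^-1 * n%:R + 1 by rewrite ltr_wpDl// !mulr_ge0// powR_ge0.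
have [Ioo|Ioo] := eqVneq I +oo%E.
  by rewrite Ioo poweRyr ?gt_eqF ?invr_gt0// NV -EFinM gt0_muley ?leey// lte_fin mulr_gt0.
have fI : I \is a fin_num by rewrite ge0_fin_numE// ltey.
have tauE : muckenhoupt_pair ((1 - (p / s)^-1) / ((q / s)^-1 + 1 - (p / s)^-1))
    (A `^ ((q / s)^-1 + 1 - (p / s)^-1)^-1) m (fun x => v x `^ (- (p / s / (p / s - 1)))).
  exact: Apq_muckenhoupt_pair.
have G0 := l1_gradient_ge0 f; have mG := measurable_l1_gradient C1f.
have F0 x : 0 <= F x by exact: powR_ge0.
have mF : measurable_fun setT F by exact: measurableT_comp (measurable_powR _) mG.
have FE x : F x `^ (p / s) * (v x `^ (- (p / s / (p / s - 1)))) `^ (1 - p / s) =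
    l1_gradient f x `^ p * v x `^ (p / s).
  rewrite -!powRrM; congr (_ `^ _ * _ `^ _); first by field; rewrite gt_eqF.
  by rewrite -[1 - _]opprB mulrNN divfK// subr_eq0 gt_eqF.
set J := (\int[leb]_x (F x `^ (p / s) * (v x `^ (- (p / s / (p / s - 1)))) `^ (1 - p / s))%:E)%E.
have JI : (J <= (n%:R `^ p)%:E * I)%E.
  rewrite /J /I -ge0_integralZl//; first last.
  - by move=> x _; rewrite mule_ge0 ?poweR_ge0// lee_fin powR_ge0.
  - under eq_fun do rewrite abse_EFin poweR_EFin -EFinM.
    apply/measurable_EFinP; apply: measurable_funM; apply: measurableT_comp (measurable_powR _) _ => //.
    apply: measurableT_comp => //.
    exact: measurableT_comp (@measurable_enorm R n) (measurable_gradient C1f).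
  apply: nonneg_integral_le.
  - by move=> x; rewrite lee_fin mulr_ge0 ?powR_ge0.
  - move=> x; apply: mule_ge0; first by rewrite lee_fin powR_ge0.
    by apply: mule_ge0; [exact: poweR_ge0|rewrite lee_fin powR_ge0].
  apply: aeW => x; rewrite FE abse_EFin poweR_EFin -!EFinM lee_fin mulrA.
  rewrite ler_wpM2r ?powR_ge0// -powRM// ge0_ler_powR ?nnegrE ?(ltW p0)//.
  by rewrite ger0_norm ?enorm_ge0//; exact: l1_gradient_le_enorm.
have J0 : (0 <= J)%E by apply: integral_ge0 => x _; rewrite lee_fin mulr_ge0 ?powR_ge0.
have Joo : (J < +oo)%E by apply: le_lt_trans JI _; rewrite -(fineK fI) -EFinM ltry.
have [Z [mZ Z0 iZ HZ]] := HC2 m _ F tauE F0 mF Joo.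
have main : (\int[leb]_x (Tmax h f x `^ q * (v x `^ (q / s))%:E) <=
    (K `^ q * (C2 * fine J `^ (q / p)))%:E)%E.
  apply: (@le_trans _ _ (\int[leb]_x ((K `^ q)%:E * Z x))%E).
    apply: nonneg_integral_le.
    - by move=> x; rewrite mule_ge0 ?poweR_ge0// lee_fin powR_ge0.
    - by move=> x; rewrite mule_ge0// lee_fin powR_ge0.
    apply: aeW => x; apply: ptw => // k L.
    by have := HZ x k L; rewrite invrK divfK// gt_eqF.
  rewrite ge0_integralZl//; last by rewrite lee_fin powR_ge0.
  rewrite EFinM lee_wpmul2l ?lee_fin ?powR_ge0//; apply: le_trans iZ _.
  by rewrite -/J (_ : q / s / (p / s) = q / p)//; field; rewrite !gt_eqF.
have fJ : fine J <= n%:R `^ p * fine I.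
  have fJ' : J \is a fin_num by rewrite (ge0_fin_numE J0).
  by rewrite -lee_fin EFinM (fineK fJ') (fineK fI).
have fJ0 := fine_ge0 J0; have fI0 := fine_ge0 I0.
have L0 : (0 <= \int[leb]_x (Tmax h f x `^ q * (v x `^ (q / s))%:E))%E.
  by apply: integral_ge0 => x _; apply: mule_ge0; [exact: poweR_ge0|rewrite lee_fin powR_ge0].
rewrite NV -[X in (_ <= _ * X `^ _)%E](fineK fI) poweR_EFin -!EFinM.
apply: le_trans (poweR_estimate K0 C20 (ler0n _ n) p0 q0 fJ0 fI0 L0 main fJ) _.
rewrite lee_fin /K; set nr := _ `^ rho^-1; set ii := _ `^ p^-1.
have -> : C1 * nr * (C2 `^ q^-1 * (n%:R * ii)) = C1 * C2 `^ q^-1 * n%:R * (nr * ii) by ring.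
by rewrite -[leRHS]mulrA ler_wpM2r ?lerDl// mulr_ge0 ?powR_ge0.
Qed.

End maximal_bound.

Section representatives.
Context (R : realType) (n : nat).
Local Notation leb := (@lebesgue_rV R n).
Local Notation sigma := (@sphere_measure R n).
Hypothesis n0 : (0 < n)%N.

Lemma weighted_norm_ae_eq (r : R) (u u' : 'rV[R]_n -> R) (g : 'rV[R]_n -> \bar R) :
  {ae leb, forall x, u x = u' x} -> weighted_norm r u g = weighted_norm r u' g.
Proof.
move=> uu'; rewrite /weighted_norm (_ : (\int[leb]_x _)%E =
  (\int[leb]_x (`|g x| `^ r * (u' x)%:E))%E)//.
by apply: eq_integral_ae; apply: filterS uu' => x E; rewrite E.
Qed.

Lemma weighted_norm_eq0 (r : R) (u : 'rV[R]_n -> R) (g : 'rV[R]_n -> \bar R) : r != 0 ->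
  {ae leb, forall x, u x = 0} -> weighted_norm r u g = 0%E.
Proof.
move=> r0 u0; rewrite (weighted_norm_ae_eq r g u0) /weighted_norm.
rewrite integral0_eq => [|x _]; last by rewrite mule0.
by rewrite poweR0r// invr_eq0.
Qed.

Lemma weighted_norm_ge0 (r : R) (u : 'rV[R]_n -> R) (g : 'rV[R]_n -> \bar R) :
  (0 <= weighted_norm r u g)%E.
Proof. exact: poweR_ge0. Qed.

(** The kernel vanishes at the origin, where division by zero gives zero; away
    from it the exceptional set is a cone over a null set of the sphere. *)
Lemma maximal_ae_eq (Omega h f : 'rV[R]_n -> R) : {ae sigma, forall t, Omega t = h t} ->
  maximal_rough_singular_integral Omega f = maximal_rough_singular_integral h f.
Proof.
move=> Oh; apply/funext => x.
apply: (congr1 (fun F : R -> \bar R => ereal_sup [set F eps | eps in [set eps | 0 < eps]])).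
apply/funext => eps; congr abse; apply: eq_integral_in_ae.
apply: filterS (ae_direction n0 Oh) => y H.
have [y0|y0] := lerP (enorm y) 0; last by rewrite H.
have -> : enorm y = 0 by apply/eqP; rewrite eq_le y0 enorm_ge0.
by rewrite expr0n eqn0Ngt n0 invr0 !mulr0 !mul0r.
Qed.

Lemma positive_representative (v v1 : 'rV[R]_n -> R) : measurable_fun setT v1 ->
  {ae leb, forall x, v x = v1 x} -> {ae leb, forall x, 0 < v1 x} ->
  exists v2 : 'rV[R]_n -> R, [/\ measurable_fun setT v2, forall x, 0 < v2 x &
    {ae leb, forall x, v x = v2 x}].
Proof.
move=> mv1 vv1 v10; pose E := [set x | 0 < v1 x].
have mE : measurable E by exact: measurable_superlevel.
exists (fun x => v1 x * \1_E x + \1_(~` E) x); split.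
- apply: measurable_funD; last by apply: measurable_indic; exact: measurableC.
  by apply: measurable_funM => //; exact: measurable_indic.
- move=> x; rewrite !indicE; have [Ex|Ex] := pselect (E x).
    by rewrite mem_set// memNset ?mulr1 ?addr0// => /(_ Ex).
  by rewrite memNset// mem_set// mulr0 add0r.
apply: filterS2 vv1 v10 => x -> Ex.
by rewrite !indicE mem_set// memNset ?mulr1 ?addr0// => /(_ Ex).
Qed.

End representatives.

Theorem theorem4p1 (R : realType) (n : nat) (rho s p q : R)
  (hn : (2 <= n)%N)
  (hrho : 1 < rho < n%:R)
  (hs : rho * n%:R / (rho * n%:R + rho - n%:R) <= s < n%:R)
  (hp : s < p < n%:R)
  (hq : p^-1 - q^-1 = n%:R^-1) :
  exists C : R -> R,
    forall (Omega w f : 'rV[R]_n -> R),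
      mem_Lp (@sphere_measure R n) rho Omega ->
      (\int[@sphere_measure R n]_theta (Omega theta)%:E = 0)%E ->
      weight w ->
      Apq (p / s) (q / s) (fun x => w x `^ s) ->
      Cc_infty f ->
      (weighted_norm q (fun x => (w x `^ q)%R)
         (maximal_rough_singular_integral Omega f) <=
       (C (fine (Apq_const (p / s) (q / s) (fun x => (w x `^ s)%R))))%:E *
       'N[@sphere_measure R n]_(rho%:E)[EFin \o Omega] *
       weighted_norm p (fun x => (w x `^ p)%R)
         (fun x => (enorm (gradient f x))%:E))%E.
Proof.
have n0 : (0 < n)%N by exact: leq_trans hn.
have /andP[rho1 rhon] := hrho; have /andP[rhos sn] := hs; have /andP[sp pn] := hp.
have nn0 : 0 < n%:R :> R by rewrite ltr0n.
have rho0 : 0 < rho by exact: lt_trans rho1.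
have s0 : 0 < s.
  apply: lt_le_trans rhos; rewrite divr_gt0 ?mulr_gt0//.
  have : 0 < (rho - 1) * n%:R by rewrite mulr_gt0// subr_gt0.
  lra.
have p0 : 0 < p by exact: lt_trans sp.
have qV0 : 0 < q^-1.
  have -> : q^-1 = p^-1 - n%:R^-1 by rewrite -hq; ring.
  by rewrite subr_gt0 ltf_pV2 ?posrE.
have q0 : 0 < q by rewrite -invr_gt0.
have pq : p < q by rewrite -ltf_pV2 ?posrE// -subr_gt0 hq invr_gt0.
have P1 : 1 < p / s by rewrite ltr_pdivlMr// mul1r.
have PQ : p / s < q / s by rewrite ltr_pM2r ?invr_gt0.
have HC (A : R) := rough_maximal_bound n0 rho1 rhon rhos sp pn hq A.
have [C HCA] := choice (fun A => let: ex_intro2 C C0 H := HC A in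
  ex_intro (fun C => 0 < C /\ _) C (conj C0 H)).
exists C => Omega w f [[h mh Oh] finO] meanO [w0 [w1 mw1 ww1] _] wA Cf.
pose v x := w x `^ s; set A := fine _.
have AE : Apq_const (p / s) (q / s) v = A%:E.
  by rewrite fineK// ge0_fin_numE//; exact: Apq_const_ge0.
have powE (r : R) x : w x `^ r = v x `^ (r / s).
  by rewrite /v -powRrM mulrCA mulfV ?mulr1// gt_eqF.
have mv1 : measurable_fun setT (fun x => w1 x `^ s).
  exact: measurableT_comp (measurable_powR _) mw1.
have vv1 : {ae lebesgue_rV n, forall x, v x = w1 x `^ s}.
  by apply: filterS ww1 => x E; rewrite /v E.
have vAle : (Apq_const (p / s) (q / s) v <= A%:E)%E by rewrite AE.
have v0 x : 0 <= v x by exact: powR_ge0.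
have [C0 HA] := HCA A.
have NO : ('N[@sphere_measure R n]_(rho%:E)[EFin \o Omega] =
    (\int[@sphere_measure R n]_t (`|h t| `^ rho)%:E) `^ rho^-1)%E.
  rewrite unlock (_ : (\int[@sphere_measure R n]_t _)%E =
    (\int[@sphere_measure R n]_t (`|h t| `^ rho)%:E)%E); first reflexivity.
  by apply: eq_integral_ae; apply: filterS Oh => t E; rewrite /= E.
have [vz|v1pos] := Apq_dichotomy P1 v0 mv1 vv1 vAle.
  rewrite weighted_norm_eq0 ?gt_eqF//.
    apply: mule_ge0; last exact: weighted_norm_ge0.
    by apply: mule_ge0; [rewrite lee_fin ltW|rewrite NO; exact: poweR_ge0].
  by apply: filterS vz => x vx; rewrite powE vx powR0// mulf_neq0 ?invr_eq0 ?gt_eqF.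
have [v2 [mv2 v20 vv2]] := positive_representative mv1 vv1 v1pos.
have wE (r : R) : {ae lebesgue_rV n, forall x, w x `^ r = v2 x `^ (r / s)}.
  by apply: filterS vv2 => x E; rewrite powE E.
rewrite (weighted_norm_ae_eq _ _ (wE q)) (weighted_norm_ae_eq _ _ (wE p)).
rewrite (maximal_ae_eq n0 f Oh) NO.
have hoo : (\int[@sphere_measure R n]_t (`|h t| `^ rho)%:E < +oo)%E.
  move: finO; rewrite /finite_norm NO; apply: lty_poweRy.
  by rewrite invr_eq0 gt_eqF.
have meanh : (\int[@sphere_measure R n]_t (h t)%:E = 0)%E.
  rewrite -meanO; apply: eq_integral_ae; apply: filterS Oh => t E; rewrite E.
  reflexivity.
have v2A : (Apq_const (p / s) (q / s) v2 <= A%:E)%E.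
  by rewrite -(Apq_const_ae_eq _ _ vv2).
exact: (HA h f v2 mh hoo meanh mv2 v20 v2A Cf).
Qed.
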